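(* Let $K$ be a field with $\operatorname{char} K \neq 2$, let $a,b,c \in K^\times$, and let $x,y,z$ be independent indeterminates over $K$. Let $\rho$ and $\rho'$ be the $K$-automorphisms of $K(x,y,z)$ given by $$\rho: x \mapsto -x,\ y \mapsto -y,\ z \mapsto \frac{c(x^2-a)(y^2-b)}{z},$$ $$\rho': x \mapsto x,\ y \mapsto -y,\ z \mapsto -\frac{c(x^2-ay^2)(y^2-b)}{z}.$$ Then $K(x,y,z)^{\langle\rho\rangle}$ is rational over $K$ if and only if $[K(\sqrt{a},\sqrt{b},\sqrt{c}):K] \le 4$; likewise $K(x,y,z)^{\langle\rho'\rangle}$ is rational over $K$ if and only if $[K(\sqrt{a},\sqrt{b},\sqrt{c}):K] \le 4$.
   Context: Rational over $K$ means purely transcendental over $K$. $F^{\langle\rho\rangle}$ denotes the subfield of $F$ fixed by the group generated by $\rho$. *)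

(* Defs.v *)
From HB Require Import structures.
From mathcomp Require Export all_boot all_order all_algebra all_field.
From mathcomp Require Export fraction mpoly.

Set Implicit Arguments.
Unset Strict Implicit.
Unset Printing Implicit Defensive.

Import GRing.Theory.
Local Open Scope ring_scope.

(* A field extension F/K is an embedding iota : {rmorphism K -> F}; its         *)
(* intermediate fields are Prop-valued predicates on F.                         *)
Section Rationality.

Variables (K F : fieldType) (iota : {rmorphism K -> F}).

(* Since 0^-1 = 0 in MathComp, v = 0 is harmless in the last clause. *)
Definition is_subfield (E : F -> Prop) : Prop :=
  [/\ E 1,
      forall u v, E u -> E v -> E (u - v)
    & forall u v, E u -> E v -> E (u / v)].

Definition generated_field (S : F -> Prop) (u : F) : Prop :=
  forall E : F -> Prop, is_subfield E -> (forall k, E (iota k)) ->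
    (forall s, S s -> E s) -> E u.

Definition algebraically_independent (S : F -> Prop) : Prop :=
  forall (n : nat) (t : 'I_n -> F), injective t -> (forall i, S (t i)) ->
  forall p : {mpoly K[n]}, mmap iota t p = 0 -> p = 0.

Definition rational (E : F -> Prop) : Prop :=
  exists S : F -> Prop,
    algebraically_independent S /\ (forall u, E u <-> generated_field S u).

Definition K_automorphism (rho : {rmorphism F -> F}) : Prop :=
  bijective rho /\ forall k, rho (iota k) = iota k.

End Rationality.

Inductive generated_group (T : Type) (rho : T -> T) : (T -> T) -> Prop :=
| generated_group_id : generated_group rho id
| generated_group_gen : generated_group rho rho
| generated_group_comp g h :
    generated_group rho g -> generated_group rho h ->
    generated_group rho (g \o h)
| generated_group_inv g h :
    generated_group rho g -> cancel g h -> cancel h g ->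
    generated_group rho h.

Definition fixed_by_group (T : Type) (rho : T -> T) (u : T) : Prop :=
  forall g, generated_group rho g -> g u = u.

Definition ratfun3 (K : fieldType) : fieldType := {fraction {mpoly K[3]}}.

Definition ratfun3C (K : fieldType) : {rmorphism K -> ratfun3 K} :=
  [the {rmorphism K -> ratfun3 K} of @tofrac {mpoly K[3]} \o @mpolyC 3 K].

Definition ratfun3X (K : fieldType) (i : 'I_3) : ratfun3 K :=
  @tofrac {mpoly K[3]} 'X_i.

(* Main.v *)
From HB Require Import structures.
Require Import Defs.
From mathcomp Require Import ring zify.
From Stdlib Require Import Classical ClassicalEpsilon.
Import GRing.Theory.
Set Implicit Arguments.
Unset Strict Implicit.
Unset Printing Implicit Defensive.
Local Open Scope ring_scope.

Local Open Scope quotient_scope.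

(** * Fraction fields *)

(** Write z = s + x t with s and t fixed by [rho], and put w = y / x. Completing a square, the fixed
    field of [rho] is generated by w, t, Z, e subject to Z^2 - c e^2 = f, where f = (t^2 - bc - ac
    w^2)^2 - 4 a b c^2 w^2 is the product of the four linear forms t +- sqrt(bc) +- sqrt(ac) w
    ([fixedP], [rel_Z]). The degree is at most 4 exactly when one of a, b, c, ab, ac, bc, abc is a
    square in K ([dim_triquadratic]).

    If one of them is a square, the equation can be parametrized: either it factors, or it is a
    quadric containing a line, or f regroups into two factors so that a quadric with a rational
    point appears ([rational_of_squares]).

    Otherwise let M = K(sqrt(ac), sqrt(bc), sqrt c), with group G = (Z/2)^3. In the compositum of M
    and the fixed field, f has the form alpha s(alpha) for every s != 0 in G, because f = P^2 - ac
    Q^2, f = P'^2 - bc Q'^2 and f = Z^2 - c e^2. If the fixed field were K(l) for an independent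
    list l, this compositum would be M(l) with G acting on coefficients. There a prime factor stable
    under some s != 0 occurs to an even power, and the other primes come in free orbits; so f =
    lambda N(g) h^2 with lambda in M and N the product over G ([normlike_ext], [tower]).

    The compositum is also M(w, t)(zeta) with zeta = Z + sqrt(c) e, and the elements of G that
    negate sqrt c send zeta to f / zeta. Let v be the order of vanishing at t = sqrt(bc) + sqrt(ac)
    w: then v(f) = 1, and v is invariant under the element negating sqrt c alone. Up to squares,
    N(g) becomes a twisted norm N(p) of a polynomial p in zeta with p(0) != 0. If f lambda N(p) is a
    square, sorting the primes into stable and free ones again shows that the sum over s in G of
    v(s(lead(p) p(0))) is divisible by 4 ([vsum_tnorm_square]). Then the leading coefficient of N(p)
    has even valuation and that of f lambda N(p) odd valuation, which is absurd ([tnorm_not_square],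
    [not_rational_obstruction]).

    In the coordinates x / y, y, z / y the automorphism [rho'] has the shape of [rho]. *)

Lemma fraction_repr (R : idomainType) (x : {fraction R}) :
  tofrac \n_(repr x) = x * tofrac \d_(repr x).
Proof.
have piE (r : {ratio R}) : tofrac \n_r = \pi_{fraction R} r * tofrac \d_r.
  unlock FracField.tofrac; rewrite -[RHS]FracField.pi_mul; apply/eqmodP => /=.
  rewrite /FracField.equivf /FracField.mulf.
  rewrite !numden_Ratio ?mulf_neq0 ?denom_ratioP ?oner_eq0 //.
  by rewrite !mulr1 mulrC mul1r mulrC.
by rewrite piE reprK.
Qed.

Lemma fraction_split (R : idomainType) (x : {fraction R}) :
  exists n d : R, d != 0 /\ x = tofrac n / tofrac d.
Proof.
exists \n_(repr x), \d_(repr x); split; first exact: denom_ratioP.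
by rewrite fraction_repr mulfK // tofrac_eq0 denom_ratioP.
Qed.

Section FracLift.

Variables (R : idomainType) (W : fieldType) (f : {rmorphism R -> W}).
Hypothesis f_neq0 : forall p, p != 0 -> f p != 0.

Definition frac_lift (x : {fraction R}) : W := f \n_(repr x) / f \d_(repr x).

(** The representative picked by [repr] does not matter: two fractions for the same element
    cross-multiply to an identity in [R], which [f] preserves. *)
Lemma frac_lift_div (n d : R) : d != 0 ->
  frac_lift (tofrac n / tofrac d) = f n / f d.
Proof.
move=> d0; rewrite /frac_lift; set x := tofrac n / _.
have dx0 : \d_(repr x) != 0 by exact: denom_ratioP.
have e : n * \d_(repr x) = \n_(repr x) * d.
  apply/eqP; rewrite -(tofrac_eq _) !tofracM.
  have -> : tofrac n = x * tofrac d by rewrite mulfVK // tofrac_eq0.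
  rewrite fraction_repr.
  by apply/eqP; rewrite mulrAC.
by apply/eqP; rewrite eqr_div ?f_neq0 // -!rmorphM e.
Qed.

Lemma frac_lift_tofrac (n : R) : frac_lift (tofrac n) = f n.
Proof.
by rewrite -[tofrac n]divr1 -(tofrac1 R) frac_lift_div ?oner_neq0 // rmorph1 divr1.
Qed.

Lemma frac_lift_zmod : zmod_morphism frac_lift.
Proof.
move=> x y; have [n [d [d0 ->]]] := fraction_split x.
have [m [e [e0 ->]]] := fraction_split y.
rewrite -mulNr addf_div ?tofrac_eq0 // -tofracN -!tofracM -tofracD.
by rewrite !frac_lift_div ?mulf_neq0 // -mulNr addf_div ?f_neq0 // rmorphD !rmorphM rmorphN.
Qed.

Lemma frac_lift_monoid : monoid_morphism frac_lift.
Proof.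
split=> [|x y]; first by rewrite -(tofrac1 R) frac_lift_tofrac rmorph1.
have [n [d [d0 ->]]] := fraction_split x; have [m [e [e0 ->]]] := fraction_split y.
by rewrite mulf_div -!tofracM !frac_lift_div ?mulf_neq0 // !rmorphM mulf_div.
Qed.

(** Closed by [Qed] as a sigma type, so that the extension is known only through its values on [R]
    and never unfolds. *)
Fact frac_lift_rmorphism_key :
  {g : {rmorphism {fraction R} -> W} | forall n, g (tofrac n) = f n}.
Proof.
pose g : {rmorphism {fraction R} -> W} := HB.pack frac_lift
  (GRing.isZmodMorphism.Build {fraction R} W frac_lift frac_lift_zmod)
  (GRing.isMonoidMorphism.Build {fraction R} W frac_lift frac_lift_monoid).
by exists g => n; exact: frac_lift_tofrac.
Qed.

Definition frac_lift_rmorphism : {rmorphism {fraction R} -> W} :=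
  sval frac_lift_rmorphism_key.

Lemma frac_lift_rmorphism_tofrac (n : R) : frac_lift_rmorphism (tofrac n) = f n.
Proof. exact: (svalP frac_lift_rmorphism_key). Qed.

End FracLift.

Local Close Scope quotient_scope.

(** * Fields with a group action *)

(** The group is written additively because the only instance needed is the space of row vectors
    over F_2. The two laws make every [gact s] an automorphism. *)
Record gfield (G : finZmodType) := GField {
  gf_sort :> fieldType;
  gact : G -> {rmorphism gf_sort -> gf_sort};
  gact0 : forall u, gact 0 u = u;
  gactD : forall s r u, gact (s + r) u = gact s (gact r u)
}.

Arguments gact {G k} s : rename.
Arguments gact0 {G k} u : rename.
Arguments gactD {G k} s r u : rename.

Section GfieldExt.

Variable G : finZmodType.

Lemma map_poly_act0 (k : gfield G) (p : {poly k}) : map_poly (gact 0) p = p.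
Proof. by apply/polyP => i; rewrite coef_map /= gact0. Qed.

Lemma map_poly_actD (k : gfield G) s r (p : {poly k}) :
  map_poly (gact (s + r)) p = map_poly (gact s) (map_poly (gact r) p).
Proof. by apply/polyP => i; rewrite !coef_map /= gactD. Qed.

(* The interface hides the fraction field, whose unfolding makes conversion
   tests diverge. *)
Record rational_ext (k : gfield G) := RationalExt {
  re_sort : gfield G;
  re_poly : {rmorphism {poly k} -> re_sort};
  re_neq0 : forall p, p != 0 -> re_poly p != 0;
  re_split : forall u, exists n d, d != 0 /\ u = re_poly n / re_poly d;
  re_act : forall s p, gact s (re_poly p) = re_poly (map_poly (gact s) p);
  re_lift : forall (W : fieldType) (f : {rmorphism {poly k} -> W}),
    (forall p, p != 0 -> f p != 0) ->
    {g : {rmorphism re_sort -> W} | forall p, g (re_poly p) = f p}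
}.

Fact ext_key (k : gfield G) : rational_ext k.
Proof.
pose Fr := {fraction {poly k}}.
have neq0 s (p : {poly k}) : p != 0 ->
    [the {rmorphism {poly k} -> Fr} of @tofrac {poly k} \o map_poly (gact s)] p != 0.
  by move=> p0; rewrite /= tofrac_eq0 map_poly_eq0.
pose act s := frac_lift_rmorphism (neq0 s).
have actE s p : act s (tofrac p) = tofrac (map_poly (gact s) p).
  by rewrite frac_lift_rmorphism_tofrac.
have act0 u : act 0 u = u.
  have [n [d [_ ->]]] := fraction_split u.
  by rewrite fmorph_div !actE !map_poly_act0.
have actD s r u : act (s + r) u = act s (act r u).
  have [n [d [_ ->]]] := fraction_split u.
  by rewrite !fmorph_div !actE !map_poly_actD.
exists (GField act0 actD) [the {rmorphism {poly k} -> Fr} of @tofrac {poly k}].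
- by move=> p; rewrite tofrac_eq0.
- exact: fraction_split.
- exact: actE.
- by move=> W f f0; exists (frac_lift_rmorphism f0); exact: frac_lift_rmorphism_tofrac.
Qed.

(** The rational function field k(X), with the group acting on coefficients and fixing X. *)
Definition ext (k : gfield G) : gfield G := re_sort (ext_key k).
Definition extP (k : gfield G) : {rmorphism {poly k} -> ext k} := re_poly (ext_key k).
Arguments extP {k}.

Section Ext.
Variable k : gfield G.
Implicit Types (p : {poly k}) (u : ext k).

Lemma extP_neq0 p : p != 0 -> extP p != 0.
Proof. exact: re_neq0. Qed.

Lemma extP_eq0 p : (extP p == 0) = (p == 0).
Proof.
by apply/idP/idP => [|/eqP ->]; rewrite ?rmorph0 //; apply: contraLR; exact: extP_neq0.
Qed.

Lemma extP_inj : injective (@extP k).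
Proof.
by move=> p q /eqP; rewrite -subr_eq0 -rmorphB extP_eq0 subr_eq0 => /eqP.
Qed.

Lemma ext_split u : exists n d, d != 0 /\ u = extP n / extP d.
Proof. exact: re_split. Qed.

Lemma act_extP s p : gact s (extP p) = extP (map_poly (gact s) p).
Proof. exact: re_act. Qed.

Definition extC : {rmorphism k -> ext k} :=
  [the {rmorphism k -> ext k} of @extP k \o polyC].

Lemma act_extC s v : gact s (extC v) = extC (gact s v).
Proof. by rewrite /extC /= act_extP map_polyC. Qed.

End Ext.

Definition equivariant (k W : gfield G) (f : k -> W) :=
  forall s u, f (gact s u) = gact s (f u).

Definition gnorm (k : gfield G) (u : k) : k := \prod_(s : G) gact s u.

Lemma gnormM (k : gfield G) (u v : k) : gnorm (u * v) = gnorm u * gnorm v.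
Proof. by rewrite /gnorm -big_split; apply: eq_bigr => s _; rewrite rmorphM. Qed.

Lemma gnorm_morph (k W : gfield G) (f : {rmorphism k -> W}) u :
  equivariant f -> f (gnorm u) = gnorm (f u).
Proof. by move=> ef; rewrite rmorph_prod; apply: eq_bigr => s _; rewrite ef. Qed.

End GfieldExt.
Arguments extP {G k}.

Definition transcendental_over (k W : fieldType) (f : {rmorphism k -> W}) (u : W) :=
  forall p : {poly k}, p != 0 -> (map_poly f p).[u] != 0.

Section EvalExt.
Variables (G : finZmodType) (k : gfield G) (W : fieldType) (f : {rmorphism k -> W}) (u : W).
Hypothesis tu : transcendental_over f u.

Lemma comm_eval : commr_rmorph f u.
Proof. by move=> v; apply: mulrC. Qed.

Definition ext_eval : {rmorphism ext k -> W} :=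
  sval (@re_lift _ _ (ext_key k) W
    [the {rmorphism {poly k} -> W} of horner_morph comm_eval] tu).

Lemma ext_eval_extP p : ext_eval (extP p) = (map_poly f p).[u].
Proof.
exact: (svalP (@re_lift _ _ (ext_key k) W
  [the {rmorphism {poly k} -> W} of horner_morph comm_eval] tu)).
Qed.

Lemma ext_eval_extC c : ext_eval (extC k c) = f c.
Proof. by rewrite /extC /= ext_eval_extP map_polyC hornerC. Qed.

Lemma ext_evalX : ext_eval (extP 'X) = u.
Proof. by rewrite ext_eval_extP map_polyX hornerX. Qed.

End EvalExt.

Lemma ext_eval_equivariant (G : finZmodType) (k W : gfield G) (f : {rmorphism k -> W}) u
    (tu : transcendental_over f u) :
  equivariant f -> (forall s, gact s u = u) -> equivariant (ext_eval tu).
Proof.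
move=> ef fu s v; have [n [d [_ ->]]] := ext_split v.
have e p : ext_eval tu (gact s (extP p)) = gact s (ext_eval tu (extP p)).
  rewrite act_extP !ext_eval_extP -horner_map /= fu -!map_poly_comp.
  by congr (_.[_]); apply: eq_map_poly => c /=; rewrite ef.
by rewrite !fmorph_div !e.
Qed.

(** * Irreducible polynomials *)

Section Irreducible.

Variable k : fieldType.
Implicit Types p q D pi : {poly k}.

Lemma monic_irreducible_factor p : (1 < size p)%N ->
  exists pi : {poly k}, [/\ irreducible_poly pi, pi \is monic & pi %| p].
Proof.
move: {2}(size p) (leqnn (size p)) => n; elim: n p => [|n IHn] p.
  by move=> le_p lt_p; have := leq_trans lt_p le_p.
move=> le_p lt_p; have [irr|nirr] := classic (irreducible_poly p).
  exists ((lead_coef p)^-1 *: p); have lp0 : lead_coef p != 0.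
    by rewrite lead_coef_eq0 -size_poly_gt0 (ltn_trans _ lt_p).
  have pE : (lead_coef p)^-1 *: p %= p by rewrite eqp_scale ?invr_neq0.
  split; last by rewrite dvdpZl ?invr_neq0 ?dvdpp.
    split=> [|q sq]; first by rewrite (eqp_size pE).
    by rewrite (eqp_dvdr _ pE) => /(apply_irredp irr sq)/eqp_trans -> //; rewrite eqp_sym.
  by rewrite monicE lead_coefZ mulVf.
have [q [q1 qp nq]] : exists q, [/\ size q != 1%N, q %| p & ~~ (q %= p)].
  apply: NNPP => H; apply: nirr; split=> // q q1 qp; apply/negPn/negP => nq.
  by apply: H; exists q.
have p0 : p != 0 by rewrite -size_poly_gt0 (ltn_trans _ lt_p).
have q0 : q != 0 by apply: contraNneq p0 => q0; move: qp; rewrite q0 dvd0p.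
have sqp : (size q < size p)%N.
  by rewrite ltn_neqAle dvdp_leq // andbT; apply: contra nq => se; rewrite -dvdp_size_eqp.
have [||pi [ipi mpi piq]] := IHn q.
- by rewrite -ltnS (leq_trans sqp).
- by rewrite ltn_neqAle eq_sym q1 size_poly_gt0.
by exists pi; split=> //; apply: dvdp_trans qp.
Qed.

Section OnePrime.
Variable pi : {poly k}.
Hypothesis irr_pi : irreducible_poly pi.

Lemma irreducible_dvdM p q : pi %| p * q -> pi %| p \/ pi %| q.
Proof.
have [|npi] := boolP (pi %| p); first by left.
by rewrite Gauss_dvdpr ?irreducible_poly_coprime //; right.
Qed.

Lemma irreducible_dvd_prod (I : Type) (r : seq I) (P : pred I) (F : I -> {poly k}) :
  pi %| \prod_(i <- r | P i) F i -> exists2 i, P i & pi %| F i.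
Proof.
elim: r => [|i r IHr]; rewrite ?big_nil ?big_cons.
  by rewrite dvdp1 => s1; case: irr_pi; rewrite (eqP s1).
case Pi: (P i) => // /irreducible_dvdM[d|]; last exact: IHr.
by exists i.
Qed.

(* Every prime power dividing [p * phi p] or [q * phi q] has an even exponent,
   so the same holds for their quotient [D]. *)
Lemma irreducible_sqr_dvd (phi : {rmorphism {poly k} -> {poly k}}) D p q :
  (forall u, (pi %| phi u) = (pi %| u)) ->
  q != 0 -> phi pi != 0 -> D * (q * phi q) = p * phi p ->
  pi %| D -> pi ^+ 2 %| D.
Proof.
move=> piphi; move: {2}(size q) (leqnn (size q)) => n.
have pi0 := irredp_neq0 irr_pi.
elim: n p q => [|n IHn] p q; first by rewrite leqn0 size_poly_eq0 => ->.
move=> le_q q0 phipi0 e piD.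
have pip : pi %| p.
  have : pi %| p * phi p by rewrite -e dvdp_mulr.
  by case/irreducible_dvdM; rewrite ?piphi.
(* If [pi] does not divide [q], then [pi ^+ 2], which divides [p * phi p], is coprime to
   [q * phi q]. Otherwise [pi] cancels from both [p] and [q], and [q] gets smaller. *)
have [piq|npiq] := boolP (pi %| q); last first.
  have cop u : ~~ (pi %| u) -> coprimep (pi ^+ 2) u.
    by move=> nu; rewrite coprimep_expl // irreducible_poly_coprime.
  have : pi ^+ 2 %| D * (q * phi q) by rewrite e expr2 dvdp_mul ?piphi.
  by rewrite Gauss_dvdpl // coprimepMr !cop ?piphi.
case/dvdpP: piq => q' qE; case/dvdpP: pip => p' pE.
have q'0 : q' != 0 by apply: contraNneq q0 => q'0; rewrite qE q'0 mul0r.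
apply: (IHn p' q') => //.
  rewrite -ltnS (leq_trans _ le_q) // qE size_mul // -subn1 -addnBA; last first.
    by rewrite ltnW //; case: irr_pi.
  rewrite -[X in (X < _)%N]addn0 ltn_add2l subn_gt0; by case: irr_pi.
apply: (mulfI (mulf_neq0 pi0 phipi0)).
have -> : pi * phi pi * (p' * phi p') = p * phi p by rewrite pE rmorphM; ring.
by rewrite -e qE rmorphM; ring.
Qed.

End OnePrime.

Lemma irreducible_dvd_eqp pi pi' : irreducible_poly pi -> irreducible_poly pi' ->
  pi %| pi' -> pi %= pi'.
Proof.
by move=> [s1 _] irr' d; apply: (apply_irredp irr' _ d); rewrite neq_ltn s1 orbT.
Qed.

Lemma monic_eqp_eq p q : p \is monic -> q \is monic -> p %= q -> p = q.
Proof. by move=> mp mq e; apply/eqP; rewrite -eqp_monic. Qed.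

(** Distinct monic irreducible polynomials are pairwise coprime, and so are their powers. *)
Lemma prod_irreducible_dvd (s : seq {poly k}) n D : uniq s ->
  (forall q, q \in s -> [/\ irreducible_poly q, q \is monic & q ^+ n %| D]) ->
  (\prod_(q <- s) q) ^+ n %| D.
Proof.
elim: s => [|q s IHs] /= => [_ _|/andP[qs us] H]; first by rewrite big_nil expr1n dvd1p.
rewrite big_cons exprMn Gauss_dvdp.
  have [_ _ ->] := H q (mem_head _ _); apply: IHs => // r rs.
  by apply: H; rewrite in_cons rs orbT.
apply: coprimep_expl; apply: coprimep_expr.
have [irrq mq _] := H q (mem_head _ _).
rewrite irreducible_poly_coprime //; apply/negP => qd.
have [r rs qr] : exists2 r, r \in s & q %| r.
  move: qd; rewrite big_seq => /(irreducible_dvd_prod irrq); case=> r rs d; by exists r.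
have [|irrr mr _] := H r; first by rewrite in_cons rs orbT.
by move: qs; rewrite (monic_eqp_eq mq mr (irreducible_dvd_eqp irrq irrr qr)) rs.
Qed.

End Irreducible.

(** * Elements that are norms for every involution *)

(* [T] is a set of representatives of the cosets of [{0, s}]. *)
Definition halving (G : finZmodType) (s : G) (T : pred G) :=
  forall r, T (s + r) = ~~ T r.

Lemma big_halving (G : finZmodType) (R : Type) (idx : R) (op : Monoid.com_law idx)
    (s : G) (T P : pred G) (F : G -> R) :
  halving s T -> (forall r, P (s + r) = P r) ->
  \big[op/idx]_(r | P r) F r =
  op (\big[op/idx]_(r | P r && T r) F r) (\big[op/idx]_(r | P r && T r) F (s + r)).
Proof.
move=> hT hP; rewrite (bigID T); congr (op _ _).
rewrite (reindex_inj (addrI s)) /=; apply: eq_bigl => r.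
by rewrite hP hT negbK.
Qed.

Section NormLike.

Variable G : finZmodType.

(** [D] is a relative norm down to the fixed field of each nontrivial element of the group. This is
    the property of f that a purely transcendental fixed field would force into a very special
    shape. *)
Definition normlike (k : gfield G) (D : k) :=
  forall s : G, s != 0 -> exists al : k, D = al * gact s al.

Section Split.
Hypothesis G_exp2 : forall s : G, s + s = 0.
Hypothesis G_halving : forall s : G, s != 0 -> exists T, halving s T.

(** Take for [al] the partial product over representatives of the cosets of [s]. *)
Lemma gnorm_normlike (k : gfield G) (u : k) : normlike (gnorm u).
Proof.
move=> s /G_halving[T hT]; exists (\prod_(r | T r) gact r u).
rewrite /gnorm (@big_halving _ _ _ _ s T) //= rmorph_prod; congr (_ * _).
by apply: eq_bigr => r _; rewrite gactD.
Qed.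

Lemma normlike_mul (k : gfield G) (u v : k) :
  normlike u -> normlike v -> normlike (u * v).
Proof.
move=> nu nv s s0; have [a ->] := nu s s0; have [b ->] := nv s s0.
by exists (a * b); rewrite rmorphM; ring.
Qed.

Lemma normlike_inv (k : gfield G) (u : k) : normlike u -> normlike u^-1.
Proof.
move=> nu s s0; have [a ->] := nu s s0.
by exists a^-1; rewrite fmorphV invfM.
Qed.

Lemma normlike_sqr (k : gfield G) (u : k) : (forall s, gact s u = u) -> normlike (u ^+ 2).
Proof. by move=> fu s _; exists u; rewrite fu expr2. Qed.

Lemma normlike_fixed (k : gfield G) (u : k) s : normlike u -> gact s u = u.
Proof.
have [->|s0] := eqVneq s 0; first by rewrite gact0.
by move=> /(_ s s0)[a ->]; rewrite rmorphM -gactD G_exp2 gact0 mulrC.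
Qed.

Lemma act_dvdp (k : gfield G) s (p q : {poly k}) :
  (map_poly (gact s) p %| map_poly (gact s) q) = (p %| q).
Proof. exact: dvdp_map. Qed.

Lemma act_irreducible (k : gfield G) s (p : {poly k}) :
  irreducible_poly p -> irreducible_poly (map_poly (gact s) p).
Proof.
move=> irr; split; first by rewrite size_map_poly; case: irr.
move=> q q1 qp; have e : map_poly (gact s) (map_poly (gact (- s)) q) = q.
  by rewrite -map_poly_actD subrr map_poly_act0.
move: qp; rewrite -{1}e act_dvdp => /(apply_irredp irr).
rewrite size_map_poly => /(_ q1) /andP[qp pq].
by rewrite -e /eqp !act_dvdp qp pq.
Qed.

(** Taking leading coefficients of the numerator and denominator of [al] turns a witness over k(X)
    into one over k. *)
Lemma normlike_const (k : gfield G) (c : k) : normlike (extC k c) -> normlike c.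
Proof.
move=> nc s s0; have [al] := nc s s0; have [n [d [d0 ->]]] := ext_split al.
rewrite fmorph_div !act_extP mulf_div -!rmorphM => e.
have dd : d * map_poly (gact s) d != 0 by rewrite mulf_neq0 ?map_poly_eq0.
have {}e : n * map_poly (gact s) n = c%:P * (d * map_poly (gact s) d).
  by apply: extP_inj; rewrite [RHS]rmorphM -[extP c%:P]/(extC k c) e mulfVK // extP_eq0.
have := congr1 lead_coef e; rewrite !lead_coefM lead_coefC !lead_coef_map => e'.
exists (lead_coef n / lead_coef d); rewrite fmorph_div mulf_div e' mulfK //.
by rewrite mulf_neq0 ?fmorph_eq0 ?lead_coef_eq0.
Qed.

(* A prime fixed by some [s != 0] divides [D = al * s al] to an even power, and
   the other primes come in free orbits, whose products are norms. *)
Lemma normlike_ext_poly (k : gfield G) (D : {poly k}) : D != 0 -> normlike (extP D) ->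
  exists (D0 : k) (g h : ext k), [/\ D0 != 0, g != 0, h != 0, normlike D0 &
    extP D = extC k D0 * gnorm g * h ^+ 2].
Proof.
move: {2}(size D) (leqnn (size D)) => n; elim: n D => [|n IHn] D.
  by rewrite leqn0 size_poly_eq0 => ->.
move=> le_D D0 nD; have [s1|s1] := leqP (size D) 1.
  have DE := size1_polyC s1; move: nD; rewrite DE => nD.
  exists D`_0, 1, 1; split; rewrite ?oner_neq0 //.
  - by apply: contraNneq D0 => c0; rewrite DE c0.
  - exact: normlike_const.
  - by rewrite expr1n mulr1 /gnorm big1 ?mulr1 // => s _; rewrite rmorph1.
have [pi [irr mon piD]] := monic_irreducible_factor s1.
have pi0 := irredp_neq0 irr.
have irr_s s : irreducible_poly (map_poly (gact s) pi) by exact: act_irreducible.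
have mon_s s : map_poly (gact s) pi \is monic by rewrite map_monic.
have fixD s : map_poly (gact s) D = D.
  apply: extP_inj; rewrite -act_extP.
  exact: (@normlike_fixed (ext k)).
have pi_s s : map_poly (gact s) pi %| D by rewrite -(fixD s) act_dvdp.
pose conj := [seq map_poly (gact s) pi | s <- enum G].
have [[s s0 pis]|free] := classic (exists2 s, s != 0 & map_poly (gact s) pi = pi).
  (* [undup] keeps each conjugate once, as [pi] has a nontrivial stabilizer. The product [P] is
     invariant, so dividing [D] by [P ^+ 2] preserves [normlike]. *)
  pose P := \prod_(q <- undup conj) q.
  have fixP r : map_poly (gact r) P = P.
    rewrite rmorph_prod -(big_map (map_poly (gact r)) xpredT id) /=.
    apply: perm_big; apply: uniq_perm; rewrite ?undup_uniq //.
      by rewrite map_inj_uniq ?undup_uniq //; exact: map_poly_inj.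
    move=> q; apply/mapP/idP => [[q']|].
      rewrite !mem_undup => /mapP[t _ ->] ->; rewrite -map_poly_actD.
      by apply: map_f; rewrite mem_enum.
    rewrite mem_undup => /mapP[t _ ->]; exists (map_poly (gact (r + t)) pi).
      by rewrite mem_undup; apply: map_f; rewrite mem_enum.
    by rewrite -map_poly_actD addrA G_exp2 add0r.
  have sqD r : map_poly (gact r) pi ^+ 2 %| D.
    rewrite -(fixD r) -rmorphXn act_dvdp.
    have [al] := nD s s0; have [p [q [q0 ->]]] := ext_split al.
    rewrite fmorph_div !act_extP mulf_div => e.
    apply: (@irreducible_sqr_dvd _ _ irr (map_poly (gact s)) D p q) => //.
    - by move=> u; rewrite -{1}pis act_dvdp.
    - by rewrite map_poly_eq0.
    apply: extP_inj; rewrite !rmorphM e mulfVK //.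
    by rewrite mulf_neq0 // extP_eq0 ?map_poly_eq0.
  have : P ^+ 2 %| D.
    apply: prod_irreducible_dvd; first exact: undup_uniq.
    by move=> q; rewrite mem_undup => /mapP[t _ ->].
  case/dvdpP => D' DE; have D'0 : D' != 0 by apply: contraNneq D0 => e; rewrite DE e mul0r.
  have P0 : P != 0 by apply: contraNneq D0 => e; rewrite DE e expr0n mulr0.
  have eP0 : extP P != 0 by rewrite extP_eq0.
  have eD : extP D = extP D' * extP P ^+ 2 by rewrite DE rmorphM rmorphXn.
  have sP : (1 < size P)%N.
    have [s1' _] := irr; apply: (leq_trans s1'); apply: dvdp_leq => //.
    rewrite /P (big_rem pi) /= ?dvdp_mulr //.
    by rewrite mem_undup; apply/mapP; exists 0; rewrite ?mem_enum ?map_poly_act0.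
  have [||c [g [h [c0 g0 h0 nc e]]]] := IHn D' _ D'0.
  - rewrite -ltnS (leq_trans _ le_D) // DE size_mul ?expf_neq0 //.
    have : (1 < size (P ^+ 2))%N.
      by rewrite (leq_trans sP) // dvdp_leq ?expf_neq0 // expr2 dvdp_mulr.
    by case: (size (P ^+ 2)) => // [[//|m]] _; rewrite addnS /= addnS ltnS leq_addr.
  - have -> : extP D' = extP D * (extP P ^+ 2)^-1 by rewrite eD mulfK ?expf_neq0.
    apply: normlike_mul => //; apply: normlike_inv; apply: normlike_sqr => r.
    by rewrite act_extP fixP.
  exists c, g, (h * extP P); split; [exact: c0|exact: g0| |exact: nc|].
    exact: mulf_neq0.
  by rewrite eD e -mulrA -exprMn.
(* With a trivial stabilizer the conjugates are distinct, so their product, which is the norm of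
   [pi], divides [D] and can be split off. *)
have uconj : uniq conj.
  rewrite map_inj_in_uniq ?enum_uniq // => s r _ _ e.
  apply/eqP; rewrite -subr_eq0 addrC; apply/negP => sr; apply: free.
  exists (- r + s); first exact/negP.
  by rewrite map_poly_actD e -map_poly_actD addNr map_poly_act0.
have : (\prod_(q <- conj) q) ^+ 1 %| D.
  by apply: prod_irreducible_dvd => // q /mapP[t _ ->]; rewrite expr1.
rewrite expr1 big_map big_enum /= => /dvdpP[D' DE].
have NE : extP (\prod_s map_poly (gact s) pi) = gnorm (extP pi).
  by rewrite rmorph_prod; apply: eq_bigr => s _; rewrite act_extP.
have D'0 : D' != 0 by apply: contraNneq D0 => e; rewrite DE e mul0r.
have N0 : gnorm (extP pi) != 0.
  by rewrite -NE extP_eq0; apply: contraNneq D0 => e; rewrite DE e mulr0.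
have eD : extP D = extP D' * gnorm (extP pi) by rewrite DE rmorphM -NE.
have [||c [g [h [c0 g0 h0 nc e]]]] := IHn D' _ D'0.
- rewrite -ltnS (leq_trans _ le_D) //.
  pose P := \prod_(s : G) map_poly (gact s) pi.
  have DP : D = D' * P by [].
  have P0 : P != 0 by apply: contraNneq D0 => e; rewrite DP e mulr0.
  have sP : (1 < size P)%N.
    have [s1' _] := irr; apply: (leq_trans s1'); apply: dvdp_leq => //.
    by rewrite /P (bigD1 0) //= map_poly_act0 dvdp_mulr.
  rewrite DP size_mul //.
  by case: (size P) sP => // [[//|m]] _; rewrite addnS /= addnS ltnS leq_addr.
- have -> : extP D' = extP D * (gnorm (extP pi))^-1 by rewrite eD mulfK.
  by apply: normlike_mul => //; apply: normlike_inv; apply: gnorm_normlike.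
exists c, (g * extP pi), h; split; [exact: c0| |exact: h0|exact: nc|].
  by rewrite mulf_neq0 // extP_eq0.
by rewrite eD e gnormM; ring.
Qed.

(** Reduction to a polynomial: with D = n / d and N = gnorm d = d c, one has D N^2 = n d c^2, and
    N^2 is the square of an invariant element. *)
Lemma normlike_ext (k : gfield G) (D : ext k) : D != 0 -> normlike D ->
  exists (D0 : k) (g h : ext k), [/\ D0 != 0, g != 0, h != 0, normlike D0 &
    D = extC k D0 * gnorm g * h ^+ 2].
Proof.
move=> D0 nD; have [n [d [d0 DE]]] := ext_split D.
have n0 : n != 0 by apply: contraNneq D0 => e; rewrite DE e rmorph0 mul0r.
pose N := gnorm (extP d).
have N0 : N != 0.
  by apply/prodf_neq0 => s _; rewrite fmorph_eq0 extP_eq0.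
have [c ccE] : exists c, N = extP d * extP c.
  exists (\prod_(s | s != 0) map_poly (gact s) d).
  rewrite /N /gnorm (bigD1 0) //= gact0; congr (_ * _).
  by rewrite rmorph_prod; apply: eq_bigr => s _; rewrite act_extP.
have c0 : c != 0 by apply: contraNneq N0 => e; rewrite ccE e rmorph0 mulr0.
have ed0 : extP d != 0 by rewrite extP_eq0.
have DN : extP (n * d * c ^+ 2) = D * N ^+ 2.
  by rewrite ccE DE !rmorphM; field.
have [||m [g [h [m0 g0 h0 nm e]]]] := @normlike_ext_poly k (n * d * c ^+ 2).
- by rewrite !mulf_neq0.
- rewrite DN; apply: normlike_mul => //; apply: normlike_sqr => s.
  by apply: normlike_fixed; apply: gnorm_normlike.
exists m, g, (h / N); split; [exact: m0|exact: g0| |exact: nm|].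
  by rewrite mulf_neq0 ?invr_neq0.
by rewrite expr_div_n mulrA -e DN mulfK ?expf_neq0.
Qed.

End Split.
End NormLike.

(** * Twisted action on polynomials *)

Lemma eqp_prod (k : fieldType) (I : Type) (r : seq I) (P : pred I) (F F' : I -> {poly k}) :
  (forall i, P i -> F i %= F' i) -> \prod_(i <- r | P i) F i %= \prod_(i <- r | P i) F' i.
Proof.
move=> H; apply: (big_rec2 (fun p q => p %= q)) => [|i p q Pi pq]; first by rewrite eqpxx.
by apply: eqp_trans (eqp_mulr _ (H i Pi)) (eqp_mull _ pq).
Qed.

(* [reverse f p] is [X ^ deg p * p (f / X)]. *)
Definition reverse (k : fieldType) (f : k) (p : {poly k}) : {poly k} :=
  \poly_(i < size p) (p`_((size p).-1 - i) * f ^+ ((size p).-1 - i)).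

Section Reverse.

Variables (k : fieldType) (f : k).
Hypothesis f0 : f != 0.
Implicit Types p q pi : {poly k}.

Lemma reverse_eval (W : fieldType) (phi : {rmorphism k -> W}) p x : x != 0 ->
  (map_poly phi (reverse f p)).[x] = x ^+ (size p).-1 * (map_poly phi p).[phi f / x].
Proof.
move=> x0; rewrite (@horner_coef_wide _ (size p)); last first.
  by rewrite (leq_trans (size_poly _ _)) // size_poly.
rewrite (@horner_coef_wide _ (size p) (map_poly phi p)) ?size_map_poly // mulr_sumr.
rewrite (reindex_inj rev_ord_inj) /=; apply: eq_bigr => i _.
have le_i : (i <= (size p).-1)%N by case: (size p) i => [[]//|m i]; rewrite -ltnS.
have -> : (size p - i.+1 = (size p).-1 - i)%N by rewrite subnS predn_sub.
rewrite !coef_map coef_poly /= subKn //.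
have -> : ((size p).-1 - i < size p)%N.
  by case: (size p) i le_i => [[]//|m i] _; rewrite ltnS leq_subr.
rewrite rmorphM rmorphXn expr_div_n -{2}(subnK le_i) exprD.
by field; rewrite expf_neq0.
Qed.

Lemma size_reverse p : p`_0 != 0 -> size (reverse f p) = size p.
Proof.
have [->|p0 c0] := eqVneq p 0; first by rewrite coef0 eqxx.
rewrite /reverse; apply: size_poly_eq; rewrite subnn expr0 mulr1 //.
Qed.

Lemma lead_coef_reverse p : p`_0 != 0 -> lead_coef (reverse f p) = p`_0.
Proof.
move=> c0; rewrite lead_coefE size_reverse // coef_poly.
have p0 : p != 0 by apply: contraNneq c0 => ->; rewrite coef0.
by rewrite prednK ?size_poly_gt0 // leqnn subnn expr0 mulr1.
Qed.

Lemma coef0_reverse p : (reverse f p)`_0 = lead_coef p * f ^+ (size p).-1.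
Proof.
have [->|p0] := eqVneq p 0; first by rewrite lead_coef0 mul0r coef_poly size_poly0.
by rewrite coef_poly size_poly_gt0 p0 subn0 lead_coefE.
Qed.

Lemma reverseK p : p`_0 != 0 -> reverse f (reverse f p) = f ^+ (size p).-1 *: p.
Proof.
move=> c0; apply/polyP => i; rewrite {1}/reverse size_reverse // coef_poly coefZ.
case: ltnP => [lt_i|le_i]; last by rewrite (nth_default _ le_i) mulr0.
have le_i : (i <= (size p).-1)%N by case: (size p) lt_i.
rewrite coef_poly subKn //.
have -> : ((size p).-1 - i < size p)%N.
  by case: (size p) lt_i => // m _; rewrite ltnS leq_subr.
by rewrite -mulrA -exprD subnKC // mulrC.
Qed.

End Reverse.

Lemma double_eq8 (w n : int) : w + w = 8 * n -> w = 4 * n.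
Proof. by lia. Qed.

Lemma half_sum (P Q S m : int) : P + Q = 2 * Q -> 2 * S + 2 * Q = 4 * m -> P + S = 2 * m.
Proof. by lia. Qed.

Lemma odd_neq_even (m q u : int) : 1 + 2 * m + (q + q) = u + u -> False.
Proof. by lia. Qed.

Section Twisted.

Variables (G : finZmodType) (k : gfield G) (f : k) (tw : G -> bool).
Hypothesis G_exp2 : forall s : G, s + s = 0.
Hypothesis G_halving : forall s : G, s != 0 -> exists T, halving s T.
Hypothesis f0 : f != 0.
Hypothesis fixf : forall s, gact s f = f.
Hypothesis twD : forall s r, tw (s + r) = tw s (+) tw r.
Implicit Types p q pi : {poly k}.

Lemma map_extC_X p : (map_poly (extC k) p).[extP 'X] = extP p.
Proof.
by rewrite -[in RHS](comp_polyXr p) /comp_poly -horner_map -map_poly_comp.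
Qed.

(** Seen in k(X), [reverse f p] is X^(deg p) p(f / X), and both factors are multiplicative in p. *)
Lemma reverseM p q : p != 0 -> q != 0 ->
  reverse f (p * q) = reverse f p * reverse f q.
Proof.
move=> p0 q0; apply: extP_inj; rewrite rmorphM.
rewrite -(map_extC_X (reverse f (p * q))) -(map_extC_X (reverse f p)).
rewrite -(map_extC_X (reverse f q)).
have X0 : extP 'X != 0 :> ext k by rewrite extP_eq0 polyX_eq0.
rewrite !reverse_eval // rmorphM hornerM size_mul //.
have -> : ((size p + size q).-1.-1 = (size p).-1 + (size q).-1)%N.
  by move: p0 q0; rewrite -!size_poly_gt0; lia.
by rewrite exprD; ring.
Qed.

Lemma map_reverse s p : map_poly (gact s) (reverse f p) = reverse f (map_poly (gact s) p).
Proof.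
apply/polyP => i; rewrite coef_map [in LHS]coef_poly [RHS]coef_poly size_map_poly /=.
by case: ifP; rewrite ?rmorph0 // rmorphM rmorphXn fixf coef_map.
Qed.

(** The variable stands for zeta, which elements with [tw s] send to f / zeta. The reversal clears
    the resulting denominator, at the price of a power of zeta that is accounted for in
    [act_theta]. *)
Definition tact (s : G) p : {poly k} :=
  if tw s then reverse f (map_poly (gact s) p) else map_poly (gact s) p.

Lemma tw0 : tw 0 = false.
Proof. by have := twD 0 0; rewrite addr0 addbb. Qed.

Lemma tact0 p : tact 0 p = p.
Proof. by rewrite /tact tw0 map_poly_act0. Qed.

Lemma tact1 s : tact s 1 = 1.
Proof.
rewrite /tact rmorph1; case: ifP => // _; apply/polyP => i.
rewrite /reverse size_poly1 coef_poly coef1.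
by case: i => [|i]; rewrite /= ?coef1 ?expr0 ?mulr1 ?mul0r.
Qed.

Lemma tactM s p q : p != 0 -> q != 0 -> tact s (p * q) = tact s p * tact s q.
Proof.
by move=> p0 q0; rewrite /tact rmorphM; case: ifP => // _; rewrite reverseM ?map_poly_eq0.
Qed.

Section NonzeroConstant.
Variables (p : {poly k}).
Hypothesis nzp : p`_0 != 0.

Lemma coef0_neq0 : p != 0.
Proof. by apply: contraNneq nzp => ->; rewrite coef0. Qed.

Lemma map_coef0_neq0 s : (map_poly (gact s) p)`_0 != 0.
Proof. by rewrite coef_map fmorph_eq0. Qed.

Lemma size_tact s : size (tact s p) = size p.
Proof.
by rewrite /tact; case: ifP => _; rewrite ?size_reverse ?map_coef0_neq0 // size_map_poly.
Qed.

Lemma coef0_tact s : (tact s p)`_0 =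
  if tw s then gact s (lead_coef p) * f ^+ (size p).-1 else gact s p`_0.
Proof.
rewrite /tact; case: ifP => _; last by rewrite coef_map.
by rewrite coef0_reverse lead_coef_map size_map_poly.
Qed.

Lemma coef0_tact_neq0 s : (tact s p)`_0 != 0.
Proof.
rewrite coef0_tact; case: ifP => _; rewrite ?fmorph_eq0 //.
by rewrite mulf_neq0 ?expf_neq0 // fmorph_eq0 lead_coef_eq0 coef0_neq0.
Qed.

Lemma lead_coef_tact s : lead_coef (tact s p) =
  if tw s then gact s p`_0 else gact s (lead_coef p).
Proof.
rewrite /tact; case: ifP => _; last by rewrite lead_coef_map.
by rewrite lead_coef_reverse ?map_coef0_neq0 // coef_map.
Qed.

Lemma tactD s r : tact s (tact r p) %= tact (s + r) p.
Proof.
rewrite /tact twD map_poly_actD.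
case: (tw s); case: (tw r); rewrite /= ?map_reverse ?eqpxx //.
by rewrite reverseK ?eqp_scale ?expf_neq0 // !coef_map /= !fmorph_eq0.
Qed.

End NonzeroConstant.

Lemma dvdp_coef0 p q : q`_0 != 0 -> p %| q -> p`_0 != 0.
Proof.
move=> nzq /dvdpP[r qE]; apply: contraNneq nzq => p0.
by rewrite qE coef0M p0 mulr0.
Qed.

Lemma dvdp_tact s p q : q`_0 != 0 -> p %| q -> tact s p %| tact s q.
Proof.
move=> nzq pq; have nzp := dvdp_coef0 nzq pq; case/dvdpP: pq => r qE.
have r0 : r != 0 by apply: contraNneq nzq => r0; rewrite qE r0 mul0r coef0.
by rewrite qE tactM ?(coef0_neq0 nzp) // dvdp_mull.
Qed.

Lemma eqp_tact s p q : p`_0 != 0 -> p %= q -> tact s p %= tact s q.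
Proof.
move=> nzp /andP[pq qp]; have nzq := dvdp_coef0 nzp qp.
by rewrite /eqp !dvdp_tact.
Qed.

Lemma irreducible_tact s p : p`_0 != 0 -> irreducible_poly p -> irreducible_poly (tact s p).
Proof.
move=> nzp irr; split; first by rewrite size_tact //; case: irr.
move=> q q1 qp; have nzq := dvdp_coef0 (coef0_tact_neq0 nzp s) qp.
have e : tact s q %= p.
  apply: (apply_irredp irr); first by rewrite size_tact.
  rewrite -(tact0 p) -(G_exp2 s) -(eqp_dvdr _ (tactD nzp s s)).
  by apply: dvdp_tact qp; exact: coef0_tact_neq0.
by rewrite -dvdp_size_eqp // size_tact // -(eqp_size e) size_tact.
Qed.

Definition tnorm p := \prod_(s : G) tact s p.

Lemma tnormM p q : p != 0 -> q != 0 -> tnorm (p * q) = tnorm p * tnorm q.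
Proof. by move=> p0 q0; rewrite /tnorm -big_split; apply: eq_bigr => s _; exact: tactM. Qed.

Lemma tnorm_tact s p : p`_0 != 0 -> tnorm (tact s p) %= tnorm p.
Proof.
move=> nzp; rewrite /tnorm [X in _ %= X](reindex_inj (addIr s)).
by apply: eqp_prod => r _; exact: tactD.
Qed.

(** * Parity of a valuation on twisted norms *)

Variables (c0 : G) (v : k -> int).
Hypothesis tw_c0 : tw c0.
Hypothesis cardG : #|G| = 8%N.
Hypothesis vM : forall x y, x != 0 -> y != 0 -> v (x * y) = v x + v y.
Hypothesis v_c0 : forall x, v (gact c0 x) = v x.
Hypothesis vf : v f = 1.
Implicit Types (x y : k) (s r : G).

Definition vsum x : int := \sum_(s : G) v (gact s x).

Lemma vsumM x y : x != 0 -> y != 0 -> vsum (x * y) = vsum x + vsum y.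
Proof.
move=> x0 y0; rewrite /vsum -big_split; apply: eq_bigr => s _.
by rewrite rmorphM vM // fmorph_eq0.
Qed.

Lemma vsum_act s x : vsum (gact s x) = vsum x.
Proof.
rewrite /vsum [RHS](reindex_inj (addIr s)).
by apply: eq_bigr => r _; rewrite gactD.
Qed.

Lemma v1 : v 1 = 0.
Proof.
by apply: (addrI (v 1)); rewrite addr0 -[RHS](congr1 v (mulr1 1)) vM ?oner_neq0.
Qed.

Lemma vX x n : x != 0 -> v (x ^+ n) = v x *+ n.
Proof.
move=> x0; elim: n => [|n IHn]; first by rewrite expr0 v1.
by rewrite exprS vM ?expf_neq0 // IHn mulrS.
Qed.

Lemma vsum_fX n : vsum (f ^+ n) = 8 * n%:Z.
Proof.
rewrite /vsum (eq_bigr (fun=> n%:Z)) => [|s _].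
  by rewrite sumr_const cardG; lia.
by rewrite rmorphXn fixf vX // vf natz.
Qed.

Lemma halving_c0 : halving c0 (fun r => ~~ tw r).
Proof. by move=> r; rewrite twD tw_c0. Qed.

(** Translation by [c0] preserves [v] and exchanges the two values of [tw], so both halves of the
    sum agree. *)
Lemma vsum_half x : vsum x = 2 * \sum_(r | ~~ tw r) v (gact r x).
Proof.
rewrite /vsum (@big_halving _ _ _ _ c0 (fun r => ~~ tw r)) //=; last exact: halving_c0.
rewrite [X in _ + X](eq_bigr (fun r => v (gact r x))) => [|r _]; last by rewrite gactD v_c0.
by rewrite mulr2n mulrDl mul1r.
Qed.

(** Let c be the constant with [tact s pi = c *: pi]. If [tw s], comparing leading and constant
    coefficients gives s(pi(0)) pi(0) = f^(deg pi), whence twice the sum is 8 deg pi. If not, pi(0)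
    is fixed by [s], and the invariance under both [s] and [c0] makes the terms of the sum agree
    four by four. *)
Lemma vsum_stable s pi : s != 0 -> pi`_0 != 0 -> pi \is monic -> tact s pi %= pi ->
  exists m, vsum pi`_0 = 4 * m.
Proof.
move=> s0 nzpi mon /eqpf_eq[c cn0 e]; have [T hT] := G_halving s0.
have := congr1 lead_coef e; rewrite lead_coefZ (monicP mon) mulr1 lead_coef_tact //.
have := congr1 (fun p : {poly k} => p`_0) e; rewrite /= coefZ coef0_tact //.
rewrite (monicP mon) rmorph1 mul1r; case: ifP => tws e0 el.
  have : vsum pi`_0 + vsum pi`_0 = 8 * (size pi).-1%:Z.
    by rewrite -{2}(vsum_act s) -vsumM ?fmorph_eq0 // el mulrC -e0 vsum_fX.
  by move/double_eq8 ->; exists (size pi).-1%:Z.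
have {}e0 : gact s pi`_0 = pi`_0 by rewrite e0 -el mul1r.
rewrite vsum_half (@big_halving _ _ _ _ s T) //=; last by move=> r; rewrite twD tws.
set S := (X in X + _); have -> : \sum_(r | ~~ tw r && T r) v (gact (s + r) pi`_0) = S.
  by apply: eq_bigr => r _; rewrite addrC gactD e0.
by exists S; ring.
Qed.

(* The parity argument: a prime factor stable under some [s != 0] contributes a
   multiple of 4, the others occur in pairs of conjugate primes. *)
Lemma vsum_tnorm_square p (d : k) q u : p`_0 != 0 -> d != 0 -> q != 0 ->
  d *: tnorm p * q ^+ 2 = u ^+ 2 -> exists m, vsum (lead_coef p * p`_0) = 4 * m.
Proof.
move: {2}(size p) (leqnn (size p)) => n; elim: n p d q u => [|n IHn] p d q u.
  by rewrite leqn0 size_poly_eq0 => /eqP ->; rewrite coef0 eqxx.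
move=> le_p nzp d0 q0 e; have pn0 := coef0_neq0 nzp.
have [s1|s1] := leqP (size p) 1.
  have pE := size1_polyC s1; rewrite {1}pE lead_coefC vsumM // vsum_half.
  by exists (\sum_(r | ~~ tw r) v (gact r p`_0)); ring.
have [pi [irr mon pip]] := monic_irreducible_factor s1.
have nzpi := dvdp_coef0 nzp pip; have pi0 := coef0_neq0 nzpi.
case/dvdpP: (pip) => p' pE.
have nzp' : p'`_0 != 0 by apply: (dvdp_coef0 nzp); rewrite pE dvdp_mulr.
have p'0 := coef0_neq0 nzp'.
have lt_p' (r : {poly k}) : r != 0 -> p' = r \/ (exists2 t, t != 0 & p' = r * t) -> (size r <= n)%N.
  move=> r0 H; have : (size r <= size p')%N.
    by case: H => [-> //|[t t0 ->]]; rewrite dvdp_leq ?mulf_neq0 // dvdp_mulr.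
  move=> /leq_trans; apply; rewrite -ltnS (leq_trans _ le_p) // pE size_mul //.
  by case: irr => spi _; case: (size pi) spi => [|[|m]] // _; rewrite addnS /= addnS ltnS leq_addr.
have vE : vsum (lead_coef p * p`_0) = vsum (lead_coef p' * p'`_0) + vsum pi`_0.
  rewrite pE lead_coefM (monicP mon) mulr1 coef0M mulrA [in LHS]vsumM //.
  by rewrite mulf_neq0 // lead_coef_eq0.
have [[s s0 stab]|free] := classic (exists2 s, s != 0 & tact s pi %= pi).
  have [m mE] := vsum_stable s0 nzpi mon stab; have [T hT] := G_halving s0.
  pose ga := \prod_(r | T r) tact r pi.
  (* Stability under [s] pairs equal conjugates, so the twisted norm of [pi] is a square up to a
     constant and can be absorbed into [q]. *)
  have : tnorm pi %= ga ^+ 2.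
    rewrite /tnorm (@big_halving _ _ _ _ s T) //= expr2 eqp_mull //.
    apply: eqp_prod => r _; rewrite addrC.
    rewrite (eqp_trans _ (eqp_tact r (coef0_tact_neq0 nzpi s) stab)) //.
    by rewrite eqp_sym tactD.
  case/eqpf_eq => c cn0 cE.
  have ga0 : ga != 0.
    apply/prodf_neq0 => r _; exact: coef0_neq0 (coef0_tact_neq0 nzpi r).
  have [|||||m' m'E] := IHn p' (d * c) (ga * q) u.
  - by apply: lt_p' => //; left.
  - by [].
  - by rewrite mulf_neq0.
  - by rewrite mulf_neq0.
  - rewrite -e pE tnormM // cE -!scalerAl -!scalerAr -!scalerAl !scalerA; congr (_ *: _).
    by ring.
  by exists (m' + m); rewrite vE mE m'E mulrDr.
(* [pi] has even exponent in the twisted norm of [p], where one factor comes from [pi] itself. A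
   second factor cannot come from another conjugate of [pi], as the orbit is free, so it comes from
   [p']. *)
have [s pis] : exists s, pi %| tact s p'.
  have piD : pi ^+ 2 %| d *: tnorm p.
    apply: (@irreducible_sqr_dvd _ _ irr idfun _ u q) => //.
    rewrite dvdpZr // (dvdp_trans pip) //.
    by rewrite /tnorm (bigD1 0) //= tact0 dvdp_mulr.
  have tE : tnorm p = pi * (\prod_(r | r != 0) tact r pi * tnorm p').
    rewrite pE tnormM // [LHS]mulrC mulrA; congr (_ * _).
    by rewrite /tnorm (bigD1 0) //= tact0.
  move: piD; rewrite dvdpZr // tE expr2 dvdp_mul2l //.
  case/(irreducible_dvdM irr) => /(irreducible_dvd_prod irr)[s s0 pis]; last by exists s.
  case: free; exists s => //; rewrite eqp_sym.
  by apply: irreducible_dvd_eqp => //; exact: irreducible_tact.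
have : tact s pi %| p'.
  rewrite -(tact0 p') -(G_exp2 s) -(eqp_dvdr _ (tactD nzp' s s)).
  by apply: dvdp_tact pis; exact: coef0_tact_neq0.
case/dvdpP => t p'E.
have nzt : t`_0 != 0 by apply: (dvdp_coef0 nzp'); rewrite p'E dvdp_mulr.
have t0 := coef0_neq0 nzt.
have nzs := coef0_tact_neq0 nzpi s; have s0 := coef0_neq0 nzs.
have /eqpf_eq[c cn0 cE] := tnorm_tact s nzpi.
have N0 : tnorm pi != 0.
  by apply/prodf_neq0 => r _; exact: coef0_neq0 (coef0_tact_neq0 nzpi r).
have [|||||m mE] := IHn t (d * c) (tnorm pi * q) u.
- by apply: lt_p' => //; right; exists (tact s pi).
- by [].
- by rewrite mulf_neq0.
- by rewrite mulf_neq0.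
- rewrite -e pE p'E !tnormM ?mulf_neq0 // cE.
  rewrite -!scalerAl -!scalerAr -!scalerAl !scalerA; congr (_ *: _).
  by ring.
have svE : exists m', vsum (lead_coef (tact s pi) * (tact s pi)`_0) = vsum pi`_0 + 4 * m'.
  rewrite lead_coef_tact // coef0_tact //; case: ifP => _.
    exists (2 * (size pi).-1%:Z); rewrite (monicP mon) rmorph1 mul1r vsumM ?expf_neq0 ?fmorph_eq0 //.
    by rewrite vsum_act vsum_fX; ring.
  by exists 0; rewrite (monicP mon) rmorph1 mul1r vsum_act mulr0 addr0.
have [m' m'E] := svE.
have vpE : vsum (lead_coef p' * p'`_0) =
    vsum (lead_coef t * t`_0) + vsum (lead_coef (tact s pi) * (tact s pi)`_0).
  rewrite -vsumM ?mulf_neq0 ?lead_coef_eq0 //.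
  by rewrite p'E lead_coefM coef0M; congr vsum; ring.
rewrite vE vpE mE m'E vsum_half.
by exists (m + m' + \sum_(r | ~~ tw r) v (gact r pi`_0)); ring.
Qed.

(** Compare valuations of leading coefficients: [f] contributes 1, [la] contributes 0, the twisted
    norm and the squares contribute even numbers. *)
Lemma tnorm_not_square p (la : k) q u : p`_0 != 0 -> la != 0 -> v la = 0 -> q != 0 ->
  f * la *: tnorm p * q ^+ 2 = u ^+ 2 -> False.
Proof.
move=> nzp la0 vla q0 e.
have d0 : f * la != 0 by rewrite mulf_neq0.
have [m mE] := vsum_tnorm_square nzp d0 q0 e.
have l0 : lead_coef p != 0 by rewrite lead_coef_eq0 coef0_neq0.
have p0 : p`_0 != 0 by [].
have lt0 s : lead_coef (tact s p) != 0.
  by rewrite lead_coef_eq0 coef0_neq0 ?coef0_tact_neq0.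
have vprod (F : G -> k) : (forall s, F s != 0) -> v (\prod_s F s) = \sum_s v (F s).
  move=> F0; pose Q (x : k) (y : int) := v x = y /\ x != 0.
  suff [] : Q (\prod_s F s) (\sum_s v (F s)) by [].
  apply: (big_rec2 Q) => [|s y x _ [vx x0]]; first by rewrite /Q v1 oner_neq0.
  by rewrite /Q vM // vx mulf_neq0.
(* Elements with [tw s] contribute s(p(0)) and the others s(lead p). Each of these two sums is half
   of a [vsum], so their total is half of a multiple of 4. *)
have lN : v (lead_coef (tnorm p)) = 2 * m.
  rewrite /tnorm lead_coef_prod vprod // (bigID tw) /=.
  rewrite (eq_bigr (fun s => v (gact s p`_0))) => [|s tws]; last first.
    by rewrite lead_coef_tact // tws.
  rewrite [X in _ + X](eq_bigr (fun s => v (gact s (lead_coef p)))) => [|s ntws]; last first.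
    by rewrite lead_coef_tact // (negbTE ntws).
  have := vsum_half p`_0; rewrite /vsum (bigID tw) /= => e0.
  by move: mE; rewrite vsumM // !vsum_half; exact: (half_sum e0).
have tN0 : tnorm p != 0 by apply/prodf_neq0 => s _; rewrite -lead_coef_eq0 lt0.
have u0 : u != 0.
  have : f * la *: tnorm p * q ^+ 2 != 0.
    by rewrite mulf_neq0 ?expf_neq0 // scaler_eq0 negb_or d0.
  by rewrite e expf_eq0.
have N0 : lead_coef (tnorm p) != 0 by rewrite lead_coef_eq0.
have := congr1 (fun r : {poly k} => v (lead_coef r)) e.
rewrite /= !lead_coefM lead_coefZ.
have lq0 : lead_coef q != 0 by rewrite lead_coef_eq0.
have lu0 : lead_coef u != 0 by rewrite lead_coef_eq0.
rewrite !vM ?mulf_neq0 // vf vla lN addr0; exact: odd_neq_even.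
Qed.

End Twisted.

(** * Algebraic closure inside a field and the exchange property *)

Section SubfieldType.

Variables (F : fieldType) (E : F -> Prop).

Lemma is_subfield_closed : is_subfield E ->
  [/\ E 0, forall u, E u -> E (- u), forall u v, E u -> E v -> E (u + v),
      forall u, E u -> E u^-1 & forall u v, E u -> E v -> E (u * v)].
Proof.
case=> E1 EB ED; have E0 : E 0 by rewrite -(subrr 1); exact: EB.
have EN u : E u -> E (- u) by move=> Eu; rewrite -sub0r; exact: EB.
have EV u : E u -> E u^-1 by move=> Eu; rewrite -div1r; exact: ED.
split=> // u v Eu Ev; first by rewrite -(opprK v); apply: EB => //; exact: EN.
by rewrite -(invrK v); apply: ED => //; exact: EV.
Qed.

Hypothesis subE : is_subfield E.

(** Classical decidability turns a Prop-valued subfield into a boolean predicate, on which a subtype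
    with a field structure can be built. *)
Definition subfield_pred : {pred F} :=
  fun u => if excluded_middle_informative (E u) then true else false.

Lemma subfield_predP u : reflect (E u) (u \in subfield_pred).
Proof. by rewrite unfold_in /subfield_pred; case: excluded_middle_informative => h; constructor. Qed.

Lemma subfield_pred_closed : divring_closed subfield_pred.
Proof.
case: subE => E1 EB ED; split; first exact/subfield_predP.
  by move=> u v /subfield_predP Eu /subfield_predP Ev; apply/subfield_predP/EB.
by move=> u v /subfield_predP Eu /subfield_predP Ev; apply/subfield_predP/ED.
Qed.

HB.instance Definition _ := GRing.isDivringClosed.Build F subfield_pred subfield_pred_closed.

Record subfield_sort := SubfieldElt { subfield_val : F; _ : subfield_val \in subfield_pred }.
HB.instance Definition _ := [isSub for subfield_val].
HB.instance Definition _ := [Choice of subfield_sort by <:].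
HB.instance Definition _ := [SubChoice_isSubIntegralDomain of subfield_sort by <:].
HB.instance Definition _ := [SubIntegralDomain_isSubField of subfield_sort by <:].

(** Gives access, for Prop-valued subfields, to the theory of algebraic and integral elements over a
    field embedding. *)
Lemma subfield_as_type : exists (k : fieldType) (f : {rmorphism k -> F}),
  forall u, E u <-> exists a, u = f a.
Proof.
exists subfield_sort, [the {rmorphism subfield_sort -> F} of (val : subfield_sort -> F)].
move=> u; split=> [/subfield_predP Eu|[a ->]]; first by exists (SubfieldElt Eu).
exact/subfield_predP/(valP a).
Qed.

End SubfieldType.

Definition alg_over (F : fieldType) (E : F -> Prop) (u : F) :=
  exists p : {poly F}, [/\ p != 0, forall i, E p`_i & root p u].

Section AlgOver.

Variables (F : fieldType) (E : F -> Prop).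

Lemma lift_poly (k : fieldType) (f : {rmorphism k -> F}) (p : {poly F}) :
  (forall i, exists a, p`_i = f a) -> exists q, p = map_poly f q.
Proof.
elim/poly_ind: p => [|p c IHp] H; first by exists 0; rewrite rmorph0.
have [|q qE] := IHp.
  by move=> i; have := H i.+1; rewrite coefD coefMX coefC /= addr0.
have [a aE] := H 0%N; exists (q * 'X + a%:P).
rewrite coefD coefMX coefC add0r /= in aE.
by rewrite rmorphD rmorphM /= map_polyX map_polyC -qE aE.
Qed.

Hypothesis subE : is_subfield E.

Lemma alg_overP (k : fieldType) (f : {rmorphism k -> F}) u :
  (forall u, E u <-> exists a, u = f a) -> alg_over E u <-> algebraicOver f u.
Proof.
move=> Ef; split=> [[p [p0 pE pu]]|[q q0 qu]].
  have [q qE] : exists q, p = map_poly f q by apply: lift_poly => i; exact/Ef.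
  by exists q; [move: p0; rewrite qE map_poly_eq0 | rewrite -qE].
exists (map_poly f q); split=> //; first by rewrite map_poly_eq0.
by move=> i; apply/Ef; exists q`_i; rewrite coef_map.
Qed.

Lemma alg_over_id u : E u -> alg_over E u.
Proof.
move=> Eu; have [E0 EN _ _ _] := is_subfield_closed subE.
exists ('X - u%:P); rewrite root_XsubC; split=> // [|i]; first by rewrite polyXsubC_eq0.
rewrite coefB coefX coefC; case: subE => E1 EB _; apply: EB.
  by case: (i == 1%N).
by case: (i == 0%N).
Qed.

Lemma alg_over_subfield : is_subfield (alg_over E).
Proof.
have [k [f Ef]] := subfield_as_type subE.
have P u : alg_over E u <-> algebraicOver f u by exact: alg_overP.
split; first by apply/P; exact: algebraic1.
  by move=> u v /P au /P av; apply/P; exact: algebraic_sub.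
by move=> u v /P au /P av; apply/P; exact: algebraic_div.
Qed.

(** Over a field, algebraic means integral, and integrality is transitive. *)
Lemma alg_over_trans u : alg_over (alg_over E) u -> alg_over E u.
Proof.
have [k [f Ef]] := subfield_as_type subE.
have P v : alg_over E v <-> algebraicOver f v by exact: alg_overP.
case=> p [p0 pE pu]; apply/P/integral_algebraic; apply: (integral_root p0 pu).
by apply/integral_poly => i; apply/integral_algebraic/P.
Qed.

End AlgOver.

Lemma alg_over_mono (F : fieldType) (E E' : F -> Prop) u :
  (forall v, E v -> E' v) -> alg_over E u -> alg_over E' u.
Proof. by move=> EE' [p [p0 pE pu]]; exists p; split=> // i; exact: EE'. Qed.

Lemma map_poly_affine (R S : comNzRingType) (phi : {rmorphism R -> S}) e P c :
  map_poly phi (e *: P * 'X + c%:P) = phi e *: map_poly phi P * 'X + (phi c)%:P.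
Proof. by rewrite rmorphD rmorphM /= map_polyX map_polyC map_polyZ. Qed.

Section Exchange.

Variables (K F : fieldType) (iota : {rmorphism K -> F}).
Implicit Types (l : seq F) (u v : F).

Definition gen l := generated_field iota (fun v => v \in l).
Definition acl l := alg_over (gen l).

Lemma generated_subfield (S : F -> Prop) : is_subfield (generated_field iota S).
Proof.
split=> [E [] //|u v hu hv E sE EK ES|u v hu hv E sE EK ES]; have [_ EB ED] := sE.
  by apply: EB; [apply: hu | apply: hv].
by apply: ED; [apply: hu | apply: hv].
Qed.

Lemma gen_subfield l : is_subfield (gen l).
Proof. exact: generated_subfield. Qed.

Lemma gen_const l k : gen l (iota k).
Proof. by move=> E _ EK _; exact: EK. Qed.

Lemma gen_mem l u : u \in l -> gen l u.
Proof. by move=> ul E _ _; exact. Qed.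

Lemma gen_min l (E : F -> Prop) u : is_subfield E -> (forall k, E (iota k)) ->
  (forall v, v \in l -> E v) -> gen l u -> E u.
Proof. by move=> sE EK El; apply. Qed.

Lemma gen_sub l l' u : (forall v, v \in l -> gen l' v) -> gen l u -> gen l' u.
Proof. by move=> H; apply: gen_min H; [exact: gen_subfield | exact: gen_const]. Qed.

Lemma acl_subfield l : is_subfield (acl l).
Proof. exact/alg_over_subfield/gen_subfield. Qed.

Lemma acl_gen l u : gen l u -> acl l u.
Proof. exact/alg_over_id/gen_subfield. Qed.

Lemma acl_mem l u : u \in l -> acl l u.
Proof. by move/gen_mem/acl_gen. Qed.

Lemma acl_const l k : acl l (iota k).
Proof. by apply: acl_gen; exact: gen_const. Qed.

Lemma acl_closed l u : alg_over (acl l) u -> acl l u.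
Proof. exact/alg_over_trans/gen_subfield. Qed.

Lemma acl_trans l l' u : (forall v, v \in l -> acl l' v) -> acl l u -> acl l' u.
Proof.
move=> H au; apply: acl_closed; apply: alg_over_mono au => v.
by apply: gen_min H; [exact: acl_subfield | exact: acl_const].
Qed.

Lemma acl_sub l l' u : {subset l <= l'} -> acl l u -> acl l' u.
Proof. by move=> H; apply: acl_trans => v /H /acl_mem. Qed.

Lemma acl_sqr l u : acl l (u ^+ 2) -> acl l u.
Proof.
move=> au; have [E0 EN ED _ _] := is_subfield_closed (acl_subfield l).
apply: acl_closed; exists ('X^2 - (u ^+ 2)%:P); split.
- by rewrite -size_poly_gt0 size_XnsubC.
- move=> i; rewrite coefB coefXn coefC; apply: ED.
    by case: (i == 2%N) => //; apply: acl_gen; case: (gen_subfield l).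
  by case: (i == 0%N); apply: EN.
- by rewrite /root !hornerE subrr.
Qed.

Section OneStep.
Variables (l : seq F) (k : fieldType) (f : {rmorphism k -> F}).
Hypothesis kf : forall u, gen l u <-> exists a, u = f a.

Lemma gen_cons u v : gen (u :: l) v ->
  exists n d : {poly k}, (map_poly f d).[u] != 0 /\ v = (map_poly f n).[u] / (map_poly f d).[u].
Proof.
move: v; pose E v := exists n d : {poly k},
  (map_poly f d).[u] != 0 /\ v = (map_poly f n).[u] / (map_poly f d).[u].
have Econst a : E (f a).
  by exists a%:P, 1; rewrite rmorph1 map_polyC !hornerE oner_neq0 divr1.
move=> v; apply: (@gen_min _ E).
- split; first by rewrite -(rmorph1 f); exact: Econst.
    move=> _ _ [n [d [d0 ->]]] [m [e [e0 ->]]].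
    exists (n * e - m * d), (d * e); rewrite rmorphB !rmorphM !hornerE; split.
      by rewrite mulf_neq0.
    by field; rewrite e0 d0.
  move=> _ _ [n [d [d0 ->]]] [m [e [e0 ->]]].
  have [m0|m0] := eqVneq (map_poly f m).[u] 0.
    exists 0, 1; rewrite rmorph0 rmorph1 !hornerE oner_neq0 m0; split=> //.
    by rewrite mul0r invr0 mulr0 ?divr1 ?mul0r.
  exists (n * e), (d * m); rewrite !rmorphM !hornerE; split; first by rewrite mulf_neq0.
  by field; rewrite e0 d0 m0.
- by move=> c; have /kf[a ->] := @gen_const l c; exact: Econst.
- move=> w; rewrite in_cons => /orP[/eqP ->|wl].
    by exists 'X, 1; rewrite rmorph1 map_polyX !hornerE oner_neq0 divr1.
  by have /kf[a ->] := gen_mem wl; exact: Econst.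
Qed.

(** A common denominator [d] of the coefficients turns a polynomial over k(u) into a polynomial in
    two variables evaluated at u. *)
Lemma gen_cons_poly u (p : {poly F}) : (forall i, gen (u :: l) p`_i) ->
  exists (P : {poly {poly k}}) (d : {poly k}), (map_poly f d).[u] != 0 /\
    (map_poly f d).[u] *: p = map_poly (fun q => (map_poly f q).[u]) P.
Proof.
have comm : commr_rmorph f u by move=> x; exact: mulrC.
pose phi := [the {rmorphism {poly k} -> F} of horner_morph comm].
have -> : (fun q => (map_poly f q).[u]) = phi by [].
elim/poly_ind: p => [|p c IHp] H.
  by exists 0, 1; rewrite rmorph1 hornerE oner_neq0 scaler0 rmorph0.
have [|P [d [d0 dE]]] := IHp.
  by move=> i; have := H i.+1; rewrite coefD coefMX coefC /= addr0.
have [n [e [e0 eE]]] : exists n d : {poly k},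
    (map_poly f d).[u] != 0 /\ c = (map_poly f n).[u] / (map_poly f d).[u].
  by apply: gen_cons; have := H 0%N; rewrite coefD coefMX coefC add0r.
exists (e *: P * 'X + (n * d)%:P), (d * e).
have -> : (map_poly f (d * e)).[u] = (map_poly f d).[u] * (map_poly f e).[u].
  by rewrite rmorphM hornerM.
split; first by rewrite mulf_neq0.
have mapE : map_poly phi (e *: P * 'X + (n * d)%:P) =
    phi e *: map_poly phi P * 'X + (phi (n * d))%:P.
  exact: map_poly_affine.
rewrite mapE.
rewrite -dE.
rewrite scalerDr scalerAl !scalerA [_ * (map_poly f e).[u]]mulrC; congr (_ + _).
have phiE q : phi q = (map_poly f q).[u] by [].
rewrite rmorphM !phiE eE -mul_polyC -polyCM; congr (_%:P).
by field.
Qed.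

End OneStep.

(** Clear denominators in an equation of [v] over the field of [u :: l] to get a polynomial [P] in
    two variables vanishing at (u, v), and read it as an equation of [u] with coefficients in [v].
    It is not trivial: otherwise a nonzero coefficient of [swapXY P] would be an equation of [v]
    over the field of [l]. *)
Lemma acl_exchange l u v : acl (u :: l) v -> ~ acl l v -> acl (v :: l) u.
Proof.
move=> [p [p0 pE pv]] nv.
have [k [f kf]] := subfield_as_type (gen_subfield l).
have [P [d [d0 dE]]] := gen_cons_poly kf pE.
have comm x : commr_rmorph f x by move=> y; exact: mulrC.
pose phi x := [the {rmorphism {poly k} -> F} of horner_morph (comm x)].
have P0 : P != 0.
  apply: contraNneq p0 => P0; move: dE; rewrite P0 -[fun _ => _]/(phi u : _ -> _) rmorph0.
  by move/eqP; rewrite scaler_eq0 (negbTE d0).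
have Pv : (map_poly (phi u) P).[v] = 0.
  by rewrite -[map_poly _ P]dE hornerZ (eqP pv) mulr0.
pose Q := map_poly (phi v) (swapXY P).
exists Q; split.
- have : swapXY P != 0 by rewrite swapXY_eq0.
  apply: contraNneq => Q0; apply/eqP/polyP => i; rewrite coef0.
  apply/eqP/negPn/negP => c0; apply: nv; exists (map_poly f (swapXY P)`_i); split.
  + by rewrite map_poly_eq0.
  + by move=> j; apply/kf; exists (swapXY P)`_i`_j; rewrite coef_map.
  + by have := congr1 (fun q : {poly F} => q`_i) Q0; rewrite coef_map coef0 => /eqP.
- move=> i; rewrite coef_map /= /horner_morph horner_coef.
  have [E0 EN ED _ EM] := is_subfield_closed (gen_subfield (v :: l)).
  apply: big_rec => // j y _ Ey; apply: ED => //; apply: (EM).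
    rewrite coef_map; apply: (@gen_sub l); last by apply/kf; eexists.
    by move=> w wl; apply: gen_mem; rewrite in_cons wl orbT.
  elim: (j : nat) => [|m IHm]; first by rewrite expr0; case: (gen_subfield (v :: l)).
  by rewrite exprS; apply: EM IHm; apply: gen_mem; exact: mem_head.
- rewrite /root; apply/eqP; rewrite -Pv.
  have sw (x y : F) : (map_poly (phi y) (swapXY P)).[x] = (map_poly (phi x) P).[y].
    have e z (R : {poly {poly k}}) : map_poly (phi z) R =
        (swapXY (map_poly (map_poly f) R)).[z%:P].
      by rewrite horner_swapXY -map_poly_comp.
    by rewrite !e -swapXY_map swapXYK horner2_swapXY.
  by rewrite sw.
Qed.

End Exchange.

Section SubfieldMembership.

Variables (F : fieldType) (E : F -> Prop).
Hypothesis sE : is_subfield E.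

Lemma sub1 : E 1. Proof. by case: sE. Qed.
Lemma sub0 : E 0. Proof. by case: (is_subfield_closed sE). Qed.
Lemma subN u : E u -> E (- u). Proof. by case: (is_subfield_closed sE) u. Qed.
Lemma subD u v : E u -> E v -> E (u + v). Proof. by case: (is_subfield_closed sE) u v. Qed.
Lemma subV u : E u -> E u^-1. Proof. by case: (is_subfield_closed sE) u. Qed.
Lemma subM u v : E u -> E v -> E (u * v). Proof. by case: (is_subfield_closed sE) u v. Qed.
Lemma subX u n : E u -> E (u ^+ n).
Proof. by move=> Eu; elim: n => [|n IHn]; [exact: sub1 | rewrite exprS; exact: subM]. Qed.
Lemma sub_nat n : E n%:R.
Proof. by elim: n => [|n IHn]; [exact: sub0 | rewrite -natr1; apply: subD => //; exact: sub1]. Qed.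

End SubfieldMembership.

Ltac subfield_mem sE :=
  repeat first [ assumption | apply: (sub_nat sE) | apply: (sub1 sE) | apply: (sub0 sE)
    | apply: (subN sE) | apply: (subX sE) | apply: (subD sE) | apply: (subV sE)
    | apply: (subM sE) ].


Section Independence.

Variables (K F : fieldType) (iota : {rmorphism K -> F}).
Implicit Types (l xs ys zs : seq F) (u v x y z : F).
Local Notation acl := (acl iota).
Local Notation gen := (gen iota).

(** A recursive form suited to towers. It does not depend on the order of the list, by
    [indep_subset]. *)
Fixpoint indep l : Prop := if l is u :: l' then ~ acl l' u /\ indep l' else True.

Lemma indep_cat l l' : indep (l ++ l') -> indep l'.
Proof. by elim: l => //= u l IHl [_]. Qed.

Lemma indep_uniq l : indep l -> uniq l.
Proof.
elim: l => //= u l IHl [nu /IHl ->]; rewrite andbT.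
by apply/negP => ul; apply: nu; exact: acl_mem.
Qed.

Lemma acl_replace x xs zs : acl (xs ++ zs) x -> ~ acl xs x ->
  exists zs1 z zs2, zs = zs1 ++ z :: zs2 /\ acl (x :: xs ++ zs1 ++ zs2) z.
Proof.
elim: zs => [|z zs IHzs]; first by rewrite cats0.
move=> ax nx; have [ax'|nx'] := classic (acl (xs ++ zs) x).
  have [zs1 [z' [zs2 [-> az']]]] := IHzs ax' nx.
  exists (z :: zs1), z', zs2; split=> //; apply: acl_sub az' => w.
  by rewrite !inE !mem_cat !inE => /or4P[] ->; rewrite ?orbT.
exists [::], z, zs; split=> //=; apply: acl_exchange nx'.
by apply: acl_sub ax => w; rewrite !inE !mem_cat inE orbCA.
Qed.

Lemma exchange xs ys : indep xs -> (forall x, x \in xs -> acl ys x) ->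
  exists zs, (size zs + size xs)%N = size ys /\ forall y, y \in ys -> acl (xs ++ zs) y.
Proof.
elim: xs => [_ _|x xs IHxs /= [nx ixs] H].
  by exists ys; rewrite addn0; split=> // y; exact: acl_mem.
have [|zs [sz az]] := IHxs ixs; first by move=> y yxs; apply: H; rewrite inE yxs orbT.
have ax : acl (xs ++ zs) x by apply: acl_trans (H x (mem_head _ _)).
have [zs1 [z [zs2 [zsE az']]]] := acl_replace ax nx.
exists (zs1 ++ zs2); split.
  by rewrite -sz zsE !size_cat /= !addnS addSn.
move=> y /az; apply: acl_trans => w; rewrite zsE !mem_cat inE => /or4P[].
- by move=> h; apply: acl_mem; rewrite inE mem_cat h orbT.
- by move=> h; apply: acl_mem; rewrite !inE !mem_cat h !orbT.
- by move/eqP ->.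
- by move=> h; apply: acl_mem; rewrite !inE !mem_cat h !orbT.
Qed.

Lemma dependent_drop ys : ~ indep ys ->
  exists zs, (size zs).+1 = size ys /\ forall y, y \in ys -> acl zs y.
Proof.
elim: ys => [[]//|y ys IHys /= nI]; have [ay|ny] := classic (acl ys y).
  exists ys; split=> // w; rewrite inE => /orP[/eqP -> //|]; exact: acl_mem.
have [|zs [sz az]] := IHys; first by move=> I; apply: nI.
exists (y :: zs); rewrite /= sz; split=> // w; rewrite inE => /orP[/eqP ->|/az].
  by apply: acl_mem; rewrite mem_head.
by apply: acl_sub => v h; rewrite inE h orbT.
Qed.

(** A dependent [ys] could be shortened without losing any algebraic element, and the exchange lemma
    forbids a spanning list shorter than [xs]. *)
Lemma indep_spanning xs ys : indep xs -> (forall x, x \in xs -> acl ys x) ->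
  size ys = size xs -> indep ys.
Proof.
move=> ixs axs sz; apply: NNPP => nI; have [zs [szs azs]] := dependent_drop nI.
have [|ws [sws _]] := @exchange xs zs ixs.
  by move=> x /axs; apply: acl_trans.
by move: szs; rewrite sz -sws => /eqP; rewrite -addSn -{2}[size xs]add0n eqn_add2r.
Qed.

Lemma indep_subset l l' : indep l -> uniq l' -> {subset l' <= l} -> indep l'.
Proof.
move=> il ul' sub; pose r := [seq x <- l | x \notin l'].
have p : perm_eq l (r ++ l').
  apply: uniq_perm; first exact: indep_uniq.
    rewrite cat_uniq filter_uniq ?(indep_uniq il) //= ul' andbT.
    by apply/hasPn => x xl'; rewrite mem_filter negb_and negbK xl'.
  move=> x; rewrite mem_cat mem_filter; case xl': (x \in l') => //=; last by rewrite orbF.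
  exact: sub.
apply: (@indep_cat r); apply: (indep_spanning il); last by rewrite (perm_size p).
by move=> x xl; apply: acl_mem; rewrite -(perm_mem p).
Qed.

End Independence.

(** * Algebraic independence through multivariate polynomials *)

Lemma mpoly_rmorph_ext (R : comNzRingType) n (S : comNzRingType)
    (f g : {rmorphism {mpoly R[n]} -> S}) :
  (forall c, f c%:MP = g c%:MP) -> (forall i, f 'X_i = g 'X_i) -> f =1 g.
Proof.
move=> fgC fgX p; rewrite (mpolyE p) !rmorph_sum; apply: eq_bigr => m _.
rewrite -mul_mpolyC !rmorphM fgC; congr (_ * _).
rewrite mpolyXE_id !rmorph_prod; apply: eq_bigr => i _.
by rewrite !rmorphXn fgX.
Qed.

Section SplitLast.

Variables (K : fieldType) (n : nat).
Local Notation w := (widen_ord (leqnSn n)).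

(** [msplit] and [mjoin] are the inverse isomorphisms that single out the last variable, so that
    inductions on the number of variables reduce to one-variable polynomials. *)
Definition msplit : {rmorphism {mpoly K[n.+1]} -> {poly {mpoly K[n]}}} :=
  [the {rmorphism _ -> _} of mmap (@polyC {mpoly K[n]} \o @mpolyC n K)
    (fun i => if unlift ord_max i is Some j then ('X_j)%:P else 'X)].

Definition mwide : {rmorphism {mpoly K[n]} -> {mpoly K[n.+1]}} :=
  [the {rmorphism _ -> _} of mmap (@mpolyC n.+1 K) (fun j => 'X_(w j))].

Lemma w_lift j : w j = lift ord_max j.
Proof. by apply: val_inj; rewrite /= /bump leqNgt ltn_ord. Qed.

Lemma msplitC c : msplit c%:MP = (c%:MP)%:P.
Proof. by rewrite /msplit /= mmapC. Qed.

Lemma msplit_last : msplit 'X_ord_max = 'X.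
Proof. by rewrite /msplit /= mmapX mmap1U unlift_none. Qed.

Lemma msplit_wide j : msplit 'X_(w j) = ('X_j)%:P.
Proof. by rewrite /msplit /= mmapX mmap1U w_lift liftK. Qed.

Lemma mwideC c : mwide c%:MP = c%:MP.
Proof. by rewrite /mwide /= mmapC. Qed.

Lemma mwideX j : mwide 'X_j = 'X_(w j).
Proof. by rewrite /mwide /= mmapX mmap1U. Qed.

Lemma mjoin_comm : commr_rmorph mwide ('X_ord_max : {mpoly K[n.+1]}).
Proof. by move=> p; exact: mulrC. Qed.

Definition mjoin : {rmorphism {poly {mpoly K[n]}} -> {mpoly K[n.+1]}} :=
  [the {rmorphism _ -> _} of horner_morph mjoin_comm].

Lemma mjoinC p : mjoin p%:P = mwide p.
Proof. exact: horner_morphC. Qed.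

Lemma mjoinX : mjoin 'X = 'X_ord_max.
Proof. exact: horner_morphX. Qed.

Lemma ord_maxVwiden (i : 'I_n.+1) : i = ord_max \/ exists j, i = w j.
Proof.
by case: (unliftP ord_max i) => [j ->|]; [right; exists j; rewrite w_lift | left].
Qed.

Lemma msplitK : cancel msplit mjoin.
Proof.
apply: (@mpoly_rmorph_ext _ _ _ [the {rmorphism _ -> _} of mjoin \o msplit] idfun) => [c|i] /=.
  by rewrite msplitC mjoinC mwideC.
have [->|[j ->]] := ord_maxVwiden i; first by rewrite msplit_last mjoinX.
by rewrite msplit_wide mjoinC mwideX.
Qed.

Lemma msplit_mwide p : msplit (mwide p) = p%:P.
Proof.
apply: (@mpoly_rmorph_ext _ _ _ [the {rmorphism _ -> _} of msplit \o mwide] polyC) => [c|i] /=.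
  by rewrite mwideC msplitC.
by rewrite mwideX msplit_wide.
Qed.

Lemma mjoinK : cancel mjoin msplit.
Proof.
elim/poly_ind => [|P c IHP]; first by rewrite !rmorph0.
by rewrite !rmorphD !rmorphM IHP mjoinC mjoinX msplit_last msplit_mwide.
Qed.

Variables (F : fieldType) (iota : {rmorphism K -> F}) (t : 'I_n.+1 -> F).

Lemma mmap_msplit p :
  mmap iota t p = (map_poly (mmap iota (t \o w)) (msplit p)).[t ord_max].
Proof.
have comm : commr_rmorph (mmap iota (t \o w)) (t ord_max) by move=> q; exact: mulrC.
pose h := [the {rmorphism {poly {mpoly K[n]}} -> F} of horner_morph comm].
rewrite -[RHS]/(h (msplit p)).
apply: (@mpoly_rmorph_ext _ _ _ [the {rmorphism _ -> _} of mmap iota t]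
  [the {rmorphism _ -> _} of h \o msplit]) => [c|i].
  by rewrite -[RHS]/(h (msplit _)) msplitC /= horner_morphC /= !mmapC.
rewrite -[RHS]/(h (msplit _)) [LHS]mmapX mmap1U; have [->|[j ->]] := ord_maxVwiden i.
  by rewrite msplit_last /= horner_morphX.
by rewrite msplit_wide /= horner_morphC /= mmapX mmap1U.
Qed.

End SplitLast.

Section TupleIndependence.

Variables (K F : fieldType) (iota : {rmorphism K -> F}).

Definition tuple_indep n (t : 'I_n -> F) :=
  forall p : {mpoly K[n]}, mmap iota t p = 0 -> p = 0.

Fixpoint tlist n : ('I_n -> F) -> seq F :=
  if n is m.+1 then
    fun t => t ord_max :: tlist (fun i : 'I_m => t (widen_ord (leqnSn m) i))
  else fun=> [::].

Lemma mem_tlist n (t : 'I_n -> F) i : t i \in tlist t.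
Proof.
elim: n t i => [|n IHn] t i; first by case: i.
rewrite /= inE; have [->|[j ->]] := ord_maxVwiden i; first by rewrite eqxx.
by rewrite (IHn (fun i => t (widen_ord (leqnSn n) i))) orbT.
Qed.

Lemma tlistP n (t : 'I_n -> F) v : v \in tlist t -> exists i, v = t i.
Proof.
elim: n t => [|n IHn] t //=; rewrite inE => /orP[/eqP ->|/IHn[i ->]]; first by exists ord_max.
by exists (widen_ord (leqnSn n) i).
Qed.

Lemma tlist_uniq n (t : 'I_n -> F) : injective t -> uniq (tlist t).
Proof.
elim: n t => [|n IHn] t inj //=; rewrite IHn ?andbT => [|i j /inj /(congr1 val) /= e].
  apply/negP => /tlistP[i /inj /(congr1 val) /= e].
  by have := ltn_ord i; rewrite -e ltnn.
exact: val_inj.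
Qed.

(* Evaluations of [n]-variable polynomials lie in the field generated by the values. *)
Lemma gen_mmap n (t : 'I_n -> F) p : gen iota (tlist t) (mmap iota t p).
Proof.
have [E0 EN ED _ EM] := is_subfield_closed (gen_subfield iota (tlist t)).
have [E1 _ _] := gen_subfield iota (tlist t).
have EX u m : gen iota (tlist t) u -> gen iota (tlist t) (u ^+ m).
  by move=> Eu; elim: m => [|m IHm]; rewrite ?expr0 // exprS; exact: EM.
rewrite /mmap; apply: big_rec => // m u _ Eu; apply: (ED) => //; apply: (EM).
  exact: gen_const.
rewrite /mmap1; apply: big_rec => // i v _ Ev; apply: (EM) => //; apply: EX.
by apply: gen_mem; exact: mem_tlist.
Qed.

Lemma gen_tlist n (t : 'I_n -> F) u : gen iota (tlist t) u ->
  exists p q : {mpoly K[n]}, mmap iota t q != 0 /\ u = mmap iota t p / mmap iota t q.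
Proof.
apply: (@gen_min _ _ iota _ (fun u => exists p q : {mpoly K[n]},
  mmap iota t q != 0 /\ u = mmap iota t p / mmap iota t q)).
- split.
  + by exists 1, 1; rewrite rmorph1 oner_neq0 divr1.
  + move=> _ _ [p [q [q0 ->]]] [p' [q' [q'0 ->]]].
    exists (p * q' - p' * q), (q * q'); rewrite rmorphB !rmorphM; split.
      by rewrite mulf_neq0.
    by field; rewrite q0 q'0.
  + move=> _ _ [p [q [q0 ->]]] [p' [q' [q'0 ->]]].
    have [p'0|p'0] := eqVneq (mmap iota t p') 0.
      by exists 0, 1; rewrite rmorph0 rmorph1 oner_neq0 p'0 mul0r invr0 mulr0 divr1.
    exists (p * q'), (q * p'); rewrite !rmorphM; split; first by rewrite mulf_neq0.
    by field; rewrite q0 q'0 p'0.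
- by move=> c; exists c%:MP, 1; rewrite rmorph1 oner_neq0 divr1 mmapC.
- by move=> v /tlistP[i ->]; exists 'X_i, 1; rewrite rmorph1 oner_neq0 divr1 mmapX mmap1U.
Qed.

(** Induction on the last variable: a polynomial relation of the tuple is an equation of its last
    entry over the field of the others, and conversely once denominators are cleared. *)
Lemma tuple_indepP n (t : 'I_n -> F) : tuple_indep t <-> indep iota (tlist t).
Proof.
elim: n t => [|n IHn] t.
  split=> // _ p; have -> : p = (p@_0)%:MP.
    by apply/mpolyP => m; rewrite mcoeffC (_ : m = 0%MM) ?eqxx ?mulr1 //; apply/mnmP; case.
  by rewrite mmapC => /eqP; rewrite fmorph_eq0 => /eqP ->; rewrite mpolyC0.
pose t' := t \o widen_ord (leqnSn n).
have mapE P : map_poly (mmap iota t') P = 0 -> tuple_indep t' -> P = 0.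
  move=> P0 it'; apply/polyP => i; rewrite coef0; apply: it'.
  by have := congr1 (fun q : {poly F} => q`_i) P0; rewrite coef_map coef0.
split=> [it|/= [nt it] p].
  have it' : tuple_indep t'.
    move=> p p0; have: mwide K n p = 0.
      by apply: it; rewrite mmap_msplit msplit_mwide map_polyC hornerC.
    by move/(congr1 (msplit K n)); rewrite msplit_mwide rmorph0 => /eqP; rewrite polyC_eq0 => /eqP.
  split; last exact/IHn.
  case=> p [p0 pE pt].
  have [P [q [q0 qE]]] : exists (P : {poly {mpoly K[n]}}) (q : {mpoly K[n]}),
      mmap iota t' q != 0 /\ mmap iota t' q *: p = map_poly (mmap iota t') P.
    elim/poly_ind: p pE {p0 pt} => [_|p c IHp H].
      by exists 0, 1; rewrite rmorph1 oner_neq0 scaler0 rmorph0.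
    have [|P [q [q0 qE]]] := IHp.
      by move=> i; have := H i.+1; rewrite coefD coefMX coefC /= addr0.
    have [a [b [b0 bE]]] : exists a b : {mpoly K[n]},
        mmap iota t' b != 0 /\ c = mmap iota t' a / mmap iota t' b.
      by apply: gen_tlist; have := H 0%N; rewrite coefD coefMX coefC add0r.
    exists (b *: P * 'X + (a * q)%:P), (q * b).
    have -> : mmap iota t' (q * b) = mmap iota t' q * mmap iota t' b by rewrite rmorphM.
    split; first by rewrite mulf_neq0.
    rewrite map_poly_affine /= -qE [mmap iota t' (a * q)]rmorphM.
    rewrite scalerDr scalerAl !scalerA [_ * mmap iota t' b]mulrC; congr (_ + _).
    by rewrite bE -mul_polyC -polyCM; congr (_%:P); field.
  have P0 : P != 0.
    apply: contraNneq p0 => P0; move: qE; rewrite P0 rmorph0 => /eqP.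
    by rewrite scaler_eq0 (negbTE q0).
  case/eqP: P0; rewrite -(mjoinK P) (it (mjoin K n P)) ?rmorph0 //.
  by rewrite mmap_msplit mjoinK -[map_poly _ _]qE hornerZ (eqP pt) mulr0.
move=> p0; have it' : tuple_indep t' by exact/IHn.
rewrite -(msplitK p); apply: etrans (rmorph0 (mjoin K n)); congr (mjoin K n _).
apply: mapE it'; apply/eqP/negPn/negP => m0; apply: nt.
exists (map_poly (mmap iota t') (msplit K n p)); split=> // [i|].
  by rewrite coef_map; exact: gen_mmap.
by rewrite /root -mmap_msplit p0.
Qed.

Lemma indep_algebraically_independent l :
  indep iota l -> algebraically_independent iota (fun v => v \in l).
Proof.
move=> il n t inj tl; apply/tuple_indepP; apply: (indep_subset il).
  exact: tlist_uniq.
by move=> v /tlistP[i ->].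
Qed.

Lemma algebraically_independent_indep (S : F -> Prop) l :
  algebraically_independent iota S -> uniq l -> (forall v, v \in l -> S v) -> indep iota l.
Proof.
move=> iS ul lS; pose t (i : 'I_(size l)) := tnth (in_tuple l) i.
have it : tuple_indep t.
  apply: iS => [i j|i]; last by apply: lS; exact: mem_tnth.
  by rewrite /t !(tnth_nth 0) /= => /eqP; rewrite nth_uniq // => /eqP; exact: val_inj.
move/tuple_indepP: it => /indep_subset; apply=> // v vl.
have [i ->] : exists i, v = t i.
  by have := vl; rewrite -[l]/(tval (in_tuple l)) => /tnthP[i ->]; exists i.
exact: mem_tlist.
Qed.

Lemma indep_rational l (E : F -> Prop) :
  indep iota l -> (forall u, E u <-> gen iota l u) -> rational iota E.
Proof.
by move=> il El; exists (fun v => v \in l); split=> //; exact: indep_algebraically_independent.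
Qed.

End TupleIndependence.

(** * Quadratic extensions *)

Section Quad.

Variables (k : fieldType) (d : k).
Hypothesis nsq : forall x : k, x ^+ 2 != d.

(** k(sqrt d) as pairs. The proof that [d] is not a square is a parameter of the type, since the
    field instance attached to the type depends on it. *)
Definition quad of (forall x : k, x ^+ 2 != d) : Type := (k * k)%type.
Local Notation Q := (quad nsq).
HB.instance Definition _ := GRing.Zmodule.on Q.

Definition quad_mul (u v : Q) : Q := (u.1 * v.1 + d * u.2 * v.2, u.1 * v.2 + u.2 * v.1).
Definition quad_one : Q := (1, 0).
Definition quad_inv (u : Q) : Q :=
  (u.1 / (u.1 ^+ 2 - d * u.2 ^+ 2), - u.2 / (u.1 ^+ 2 - d * u.2 ^+ 2)).

Lemma quad_mulA : associative quad_mul.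
Proof. by move=> [a b] [a' b'] [a'' b'']; congr (_, _) => /=; ring. Qed.

Lemma quad_mulC : commutative quad_mul.
Proof. by move=> [a b] [a' b']; congr (_, _) => /=; ring. Qed.

Lemma quad_mul1 : left_id quad_one quad_mul.
Proof. by move=> [a b]; rewrite /quad_mul /=; congr (_, _) => /=; ring. Qed.

Lemma quad_mulD : left_distributive quad_mul +%R.
Proof. by move=> [a b] [a' b'] [a'' b'']; congr (_, _) => /=; ring. Qed.

Lemma quad_1_neq0 : quad_one != 0.
Proof. by rewrite xpair_eqE oner_eq0. Qed.

HB.instance Definition _ := GRing.Zmodule_isComNzRing.Build Q
  quad_mulA quad_mulC quad_mul1 quad_mulD quad_1_neq0.

Lemma quad_mulV (u : Q) : u != 0 -> quad_mul (quad_inv u) u = quad_one.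
Proof.
case: u => a b; rewrite xpair_eqE negb_and => ab.
have n0 : a ^+ 2 - d * b ^+ 2 != 0.
  rewrite subr_eq0; have [b0|b0] := eqVneq b 0.
    by move: ab; rewrite b0 eqxx orbF expr0n mulr0 expf_eq0.
  apply/eqP => e; case/eqP: (nsq (a / b)).
  by rewrite expr_div_n e mulfK // expf_neq0.
by rewrite /quad_mul /=; congr (_, _); field.
Qed.

Lemma quad_inv0 : quad_inv 0 = 0.
Proof. by rewrite /quad_inv /= oppr0 !mul0r. Qed.

HB.instance Definition _ := GRing.ComNzRing_isField.Build Q quad_mulV quad_inv0.

End Quad.

Section QuadGfield.

Variables (G : finZmodType) (chi : G -> bool).
Hypothesis chiD : forall s r, chi (s + r) = chi s (+) chi r.

(* The sealed interface of [k(sqrt d)], with [G] acting on [sqrt d] by the sign [chi]. *)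
Record quad_ext (k : gfield G) (d : k) := QuadExt {
  qe_sort : gfield G;
  qe_in : {rmorphism k -> qe_sort};
  qe_root : qe_sort;
  qe_root2 : qe_root ^+ 2 = qe_in d;
  qe_act_in : forall s u, gact s (qe_in u) = qe_in (gact s u);
  qe_act_root : forall s, gact s qe_root = (-1) ^+ chi s * qe_root;
  qe_split : forall u, exists x y, u = qe_in x + qe_in y * qe_root;
  qe_lift : forall (W : fieldType) (f : {rmorphism k -> W}) (w : W), w ^+ 2 = f d ->
    {g : {rmorphism qe_sort -> W} | (forall u, g (qe_in u) = f u) /\ g qe_root = w}
}.

Lemma quad_ext_exists (k : gfield G) (d : k) : (forall s, gact s d = d) ->
  (forall x : k, x ^+ 2 != d) -> quad_ext d.
Proof.
move=> fixd nsq; pose Q : fieldType := quad nsq.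
have lift (W : fieldType) (f : {rmorphism k -> W}) (w : W) : w ^+ 2 = f d ->
    {g : {rmorphism Q -> W} | forall x y, g (x, y) = f x + f y * w}.
  move=> we; pose g (u : Q) : W := f u.1 + f u.2 * w.
  have gB : zmod_morphism g.
    by move=> [a b] [a' b']; rewrite /g /= !rmorphB; ring.
  have gM : monoid_morphism g.
    split=> [|[a b] [a' b']]; rewrite /g /= ?rmorph1 ?rmorph0 ?mul0r ?addr0 //.
    by rewrite !rmorphD !rmorphM -we; ring.
  pose g' : {rmorphism Q -> W} := HB.pack g
    (GRing.isZmodMorphism.Build Q W g gB) (GRing.isMonoidMorphism.Build Q W g gM).
  by exists g'.
pose i (x : k) : Q := (x, 0).
have iB : zmod_morphism i by move=> a a'; congr (_, _); rewrite /= subrr.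
have iM : monoid_morphism i.
  by split=> // a a'; congr (_, _) => /=; ring.
pose i' : {rmorphism k -> Q} := HB.pack i
  (GRing.isZmodMorphism.Build k Q i iB) (GRing.isMonoidMorphism.Build k Q i iM).
pose r : Q := (0, 1).
have r2 : r ^+ 2 = i' d by rewrite expr2; congr (_, _) => /=; ring.
have split x y : (x, y) = i' x + i' y * r :> Q by congr (_, _) => /=; ring.
have sgn2 s : ((-1) ^+ chi s * r) ^+ 2 = [the {rmorphism k -> Q} of i' \o gact s] d.
  by rewrite exprMn -exprM mulnC exprM sqrrN expr1n expr1n mul1r r2 /= fixd.
pose act s : {rmorphism Q -> Q} := sval (lift _ _ _ (sgn2 s)).
have actE s x y : act s (x, y) = i' (gact s x) + i' (gact s y) * ((-1) ^+ chi s * r).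
  exact: (svalP (lift _ _ _ (sgn2 s))).
have act_in s x : act s (i' x) = i' (gact s x).
  by rewrite -[i' x]/((x, 0) : Q) actE !rmorph0 mul0r addr0.
have act_r s : act s r = (-1) ^+ chi s * r.
  by rewrite actE !rmorph0 !rmorph1 mul1r add0r.
have chi0 : chi 0 = false by have := chiD 0 0; rewrite addr0 addbb.
have act0 u : act 0 u = u.
  by case: u => x y; rewrite actE !gact0 chi0 expr0 mul1r -split.
have actD s t u : act (s + t) u = act s (act t u).
  case: u => x y; rewrite actE [act t _]actE [RHS]rmorphD [act s (_ * _)]rmorphM.
  rewrite [act s (_ ^+ _ * _)]rmorphM !act_in act_r -!gactD.
  have -> : act s ((-1) ^+ chi t) = (-1) ^+ chi t by rewrite rmorphXn rmorphN1.
  by rewrite chiD; case: (chi s); case: (chi t); rewrite /= ?expr0 ?expr1; ring.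
exists (GField act0 actD) i' r => //.
- by move=> [x y]; exists x, y.
- move=> W f w we; have [g gE] := lift W f w we; exists g; split=> [u|].
    by rewrite -[i' u]/((u, 0) : Q) gE rmorph0 mul0r addr0.
  by rewrite gE rmorph0 rmorph1 mul1r add0r.
Qed.

End QuadGfield.

(** If e = (x + y sqrt d)^2, then y = 0 makes e a square, x = 0 makes d e a square, and x y != 0
    puts sqrt d in k because 2 x y sqrt d lies in k. *)
Lemma quad_not_square (G : finZmodType) (chi : G -> bool) (k : gfield G) (d e : k)
    (q : quad_ext chi d) :
  (2%:R : k) != 0 -> d != 0 -> (forall x : k, x ^+ 2 != d) ->
  (forall x : k, x ^+ 2 != e) -> (forall x : k, x ^+ 2 != d * e) ->
  forall u : qe_sort q, u ^+ 2 != qe_in q e.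
Proof.
move=> two0 d0 nd ne nde u; apply/eqP => ue.
have [x [y uE]] := qe_split u.
have inj v : (qe_in q v == 0) = (v == 0) by rewrite fmorph_eq0.
have [y0|y0] := eqVneq y 0.
  move: ue; rewrite uE y0 rmorph0 mul0r addr0 -rmorphXn => /fmorph_inj e1.
  by case/eqP: (ne x).
have [x0|x0] := eqVneq x 0.
  move: ue; rewrite uE x0 rmorph0 add0r exprMn qe_root2 -rmorphXn -rmorphM => /fmorph_inj e1.
  by case/eqP: (nde (d * y)); rewrite -e1; ring.
have n0 : 2%:R * x * y != 0 by rewrite !mulf_neq0.
have e1 : qe_in q (2%:R * x * y) * qe_root q = qe_in q (e - x ^+ 2 - d * y ^+ 2).
  rewrite !rmorphB [qe_in q (d * _)]rmorphM [qe_in q (_ * y)]rmorphM.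
  by rewrite [qe_in q (_ * x)]rmorphM !rmorphXn rmorph_nat -qe_root2 -ue uE; ring.
have rE : qe_root q = qe_in q ((e - x ^+ 2 - d * y ^+ 2) / (2%:R * x * y)).
  by rewrite fmorph_div -e1 mulrAC mulfV ?mul1r // inj.
case/eqP: (nd ((e - x ^+ 2 - d * y ^+ 2) / (2%:R * x * y))).
by apply: (fmorph_inj (qe_in q)); rewrite rmorphXn -rE qe_root2.
Qed.

(** * The degree of a triquadratic extension *)

Definition is_square (K : fieldType) (u : K) := exists k : K, u = k ^+ 2.

(** Linear dependence over F_2 of the classes of a, b, c modulo squares, when a, b, c are
    nonzero. *)
Definition square_dependent (K : fieldType) (a b c : K) :=
  is_square a \/ is_square b \/ is_square c \/ is_square (a * b) \/
  is_square (a * c) \/ is_square (b * c) \/ is_square (a * b * c).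

Section Degree.

Variables (K : fieldType) (L : fieldExtType K).
Hypothesis two0 : (2%:R : K) != 0.

Lemma adjoin_sqrt_degree (U : {subfield L}) (u : L) :
  u ^+ 2 \in U -> (adjoin_degree U u <= 2)%N.
Proof.
move=> u2; rewrite -ltnS -size_minPoly.
have p0 : 'X^2 - (u ^+ 2)%:P != 0 :> {poly L} by rewrite -size_poly_gt0 size_XnsubC.
rewrite -[3%N]/(2.+1)%N -(@size_XnsubC _ 2 (u ^+ 2)) // dvdp_leq //.
apply: minPoly_dvdp; last by rewrite /root !hornerE subrr.
by rewrite rpredB ?rpredX ?polyOverX ?polyOverC.
Qed.

(** Write v = p0 + p1 u and square: if p0 p1 != 0, then u, hence v, already lies in [U]. If p0 = 0,
    then u v does. *)
Lemma sqrt_in_adjoin (U : {subfield L}) (u v : L) :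
  u ^+ 2 \in U -> v ^+ 2 \in U -> v \in <<U; u>>%VS -> v \in U \/ u * v \in U.
Proof.
move=> u2 v2 vU; pose p := Fadjoin_poly U u v.
have /polyOverP pU : p \is a polyOver U by exact: Fadjoin_polyOver.
have vE : v = p`_0 + p`_1 * u.
  rewrite -{1}(Fadjoin_poly_eq vU) (@horner_coef_wide _ 2); last first.
    by rewrite (leq_trans (size_Fadjoin_poly _ _ _)) // adjoin_sqrt_degree.
  by rewrite big_ord_recl big_ord1 /= expr0 mulr1 expr1.
have two : (2%:R : L) != 0.
  by rewrite -(rmorph_nat (in_alg L)) fmorph_eq0.
have [p10|p10] := eqVneq p`_1 0; first by left; rewrite vE p10 mul0r addr0.
have [p00|p00] := eqVneq p`_0 0.
  by right; rewrite vE p00 add0r mulrCA -expr2 rpredM.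
left; rewrite vE rpredD ?rpredM //.
have -> : u = (v ^+ 2 - p`_0 ^+ 2 - p`_1 ^+ 2 * u ^+ 2) / (2%:R * p`_0 * p`_1).
  by rewrite vE; field; rewrite two p00 p10.
apply: rpred_div; last by rewrite !rpredM ?rpred_nat.
apply: rpredB; last by apply: rpredM => //; rewrite rpredX.
by apply: rpredB => //; rewrite rpredX.
Qed.

Variables (a b c : K) (ra rb rc : L).
Hypotheses (raE : ra ^+ 2 = a%:A) (rbE : rb ^+ 2 = b%:A) (rcE : rc ^+ 2 = c%:A).

Lemma sqrt_mem1 (u : L) (d : K) : u ^+ 2 = d%:A -> u \in 1%VS <-> is_square d.
Proof.
move=> uE; split=> [/vlineP[k kE]|[k kE]].
  exists k; apply: (fmorph_inj (in_alg L)).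
  by rewrite rmorphXn /= -uE kE.
have : (u - k%:A) * (u + k%:A) = 0.
  by rewrite -subr_sqr uE kE -[k%:A]/(in_alg L k) -rmorphXn /= subrr.
move/eqP; rewrite mulf_eq0 subr_eq0 addr_eq0 => /orP[]/eqP ->.
  by rewrite memvZ ?mem1v.
by rewrite memvN memvZ ?mem1v.
Qed.

(** The degree is a product of three factors equal to 1 or 2, so it is at most 4 exactly when one
    root already lies in the field generated by the previous ones. [sqrt_in_adjoin] then pushes this
    condition down to K. *)
Lemma dim_triquadratic :
  (\dim <<1 & [:: ra; rb; rc]>>%VS <= 4)%N <-> square_dependent a b c.
Proof.
rewrite !adjoin_cons adjoin_nil agenv_id.
pose U0 : {subfield L} := 1%AS; pose U1 : {subfield L} := <<U0; ra>>%AS.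
pose U2 : {subfield L} := <<U1; rb>>%AS.
have in0 (k : K) : k%:A \in U0 by rewrite memvZ ?mem1v.
have in1 u : u \in U0 -> u \in U1 by apply/subvP/subv_adjoin.
have in2 u : u \in U1 -> u \in U2 by apply/subvP/subv_adjoin.
have ra2 : ra ^+ 2 \in U0 by rewrite raE.
have rb2 : rb ^+ 2 \in U1 by rewrite rbE in1.
have rc2 : rc ^+ 2 \in U2 by rewrite rcE in2 ?in1.
have ra1 : ra \in U1 by exact: memv_adjoin.
have rb1 : rb \in U2 by exact: memv_adjoin.
have -> : \dim <<<<<<1; ra>>; rb>>; rc>>%VS =
    (adjoin_degree U2 rc * (adjoin_degree U1 rb * adjoin_degree U0 ra))%N.
  by rewrite (dim_Fadjoin U2) (dim_Fadjoin U1) (dim_Fadjoin U0) dimv1 muln1.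
have := adjoin_sqrt_degree ra2; have := adjoin_sqrt_degree rb2.
have := adjoin_sqrt_degree rc2.
have := adjoin_deg_eq1 U0 ra; have := adjoin_deg_eq1 U1 rb; have := adjoin_deg_eq1 U2 rc.
have gt0 (U : {subfield L}) u : (0 < adjoin_degree U u)%N by [].
have := gt0 U0 ra; have := gt0 U1 rb; have := gt0 U2 rc.
set n2 := adjoin_degree U2 rc; set n1 := adjoin_degree U1 rb; set n0 := adjoin_degree U0 ra.
move=> g2 g1 g0 d2 d1 d0 l2 l1 l0.
have -> : (n2 * (n1 * n0) <= 4)%N = [|| n0 == 1%N, n1 == 1%N | n2 == 1%N].
  move: g0 g1 g2 l0 l1 l2; clear; move: n0 n1 n2.
  by do 3 case=> [|[|[|?]]] //.
rewrite d0 d1 d2.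
have sM (u v : L) (d e : K) : u ^+ 2 = d%:A -> v ^+ 2 = e%:A -> (u * v) ^+ 2 = (d * e)%:A.
  by move=> uE vE; rewrite exprMn uE vE -[RHS]/(in_alg L _) rmorphM.
have mA := sqrt_mem1 raE; have mB := sqrt_mem1 rbE; have mC := sqrt_mem1 rcE.
have rabE := sM _ _ _ _ raE rbE; have racE := sM _ _ _ _ raE rcE.
have rbcE := sM _ _ _ _ rbE rcE.
have rabcE : (ra * (rb * rc)) ^+ 2 = (a * b * c)%:A by rewrite -mulrA; exact: sM.
have mAB := sqrt_mem1 rabE; have mAC := sqrt_mem1 racE.
have mBC := sqrt_mem1 rbcE; have mABC := sqrt_mem1 rabcE.
have nz (u : L) (d : K) : u ^+ 2 = d%:A -> ~ is_square d -> u != 0.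
  move=> uE nd; apply/eqP => u0; apply: nd; exists 0.
  by move: uE; rewrite u0 expr0n /= => /esym/eqP; rewrite scaler_eq0 oner_eq0 orbF => /eqP ->; rewrite expr0n.
have rb20 : rb ^+ 2 \in U0 by rewrite rbE.
have rc20 : rc ^+ 2 \in U0 by rewrite rcE.
have rbc20 : (rb * rc) ^+ 2 \in U0 by rewrite rbcE.
rewrite /square_dependent; split.
  case/or3P=> [/mA|h|h]; first by tauto.
    have [h'|h'] := sqrt_in_adjoin ra2 rb20 h.
      by move/mB: h'; tauto.
    by move/mAB: h'; tauto.
  have rc2' : rc ^+ 2 \in U1 by rewrite rcE in1.
  have [h'|h'] := sqrt_in_adjoin rb2 rc2' h.
    have [h''|h''] := sqrt_in_adjoin ra2 rc20 h'.
      by move/mC: h''; tauto.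
    by move/mAC: h''; tauto.
  have [h''|h''] := sqrt_in_adjoin ra2 rbc20 h'.
    by move/mBC: h''; tauto.
  by move/mABC: h''; tauto.
have [/mA -> //|na] := classic (is_square a).
have [sb|nb] := classic (is_square b).
  by move=> _; rewrite (in1 _ (proj2 mB sb)) orbT.
have ra0 := nz _ _ raE na; have rb0 := nz _ _ rbE nb.
have quo (U : {subfield L}) u v : u != 0 -> u \in U -> u * v \in U -> v \in U.
  by move=> u0 uU uvU; rewrite -(mulKf u0 v) rpredM ?rpredV.
case=> // -[] // [/mC h|[/mAB h|[/mAC h|[/mBC h|/mABC h]]]].
- by rewrite (in2 _ (in1 _ h)) !orbT.
- by rewrite (quo U1 _ _ ra0 ra1 (in1 _ h)) !orbT.
- by rewrite (quo U2 _ _ ra0 (in2 _ ra1) (in2 _ (in1 _ h))) !orbT.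
- by rewrite (quo U2 _ _ rb0 rb1 (in2 _ (in1 _ h))) !orbT.
- by rewrite (quo U2 _ _ rb0 rb1 (quo U2 _ _ ra0 (in2 _ ra1) (in2 _ (in1 _ h)))) !orbT.
Qed.

End Degree.

(** * Triquadratic extensions with their Galois group *)

(** The Galois group (Z/2)^3; the characters [chi i] are its coordinates and record which square
    roots change sign. *)
Definition G8 : finZmodType := 'rV['F_2]_3.

Definition chi (i : 'I_3) (s : G8) : bool := s 0 i != 0.

Lemma chiD i s r : chi i (s + r) = chi i s (+) chi i r.
Proof.
rewrite /chi mxE; move: (s 0 i) (r 0 i).
by case=> [[|[|?]] //= ?]; case=> [[|[|?]] //= ?].
Qed.

Lemma G8_exp2 (s : G8) : s + s = 0.
Proof. by apply/matrixP => i j; rewrite !mxE; case: (s i j) => [[|[|?]] //= ?]; apply: val_inj. Qed.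

Lemma G8_halving (s : G8) : s != 0 -> exists T, halving s T.
Proof.
move=> s0; have [i si] : exists i, chi i s.
  apply: NNPP => H; case/eqP: s0; apply/rowP => i; rewrite mxE.
  by apply/eqP/negPn/negP => si; apply: H; exists i.
by exists (fun r => ~~ chi i r) => r; rewrite chiD si.
Qed.

Lemma card_G8 : #|G8| = 8%N.
Proof. by rewrite card_mx card_ord. Qed.

Definition chi_elt (i : 'I_3) : G8 := delta_mx 0 i.

Lemma chi_eltE i j : chi j (chi_elt i) = (i == j).
Proof. by rewrite /chi mxE eqxx [j == i]eq_sym /=; case: (i == j). Qed.

Section Triquad.

Variables (k : fieldType) (A B c : k).

(** A sealed interface: [tq_min] is an induction principle for identities between morphisms, and
    [tq_lift] is the universal property that gives base change. *)
Record triquad := Triquad {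
  tq : gfield G8;
  tq_in : {rmorphism k -> tq};
  tq_A : tq; tq_B : tq; tq_C : tq;
  tq_sqA : tq_A ^+ 2 = tq_in A;
  tq_sqB : tq_B ^+ 2 = tq_in B;
  tq_sqC : tq_C ^+ 2 = tq_in c;
  tq_act : forall s u, gact s (tq_in u) = tq_in u;
  tq_actA : forall s, gact s tq_A = (-1) ^+ chi 0 s * tq_A;
  tq_actB : forall s, gact s tq_B = (-1) ^+ chi 1 s * tq_B;
  tq_actC : forall s, gact s tq_C = (-1) ^+ chi 2 s * tq_C;
  tq_min : forall P : tq -> Prop, is_subfield P -> (forall u, P (tq_in u)) ->
    P tq_A -> P tq_B -> P tq_C -> forall u, P u;
  tq_lift : forall (W : fieldType) (f : {rmorphism k -> W}) (wA wB wC : W),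
    wA ^+ 2 = f A -> wB ^+ 2 = f B -> wC ^+ 2 = f c ->
    exists g : {rmorphism tq -> W},
      [/\ forall u, g (tq_in u) = f u, g tq_A = wA, g tq_B = wB & g tq_C = wC]
}.

(** Three quadratic extensions in succession. The seven nonsquare conditions are exactly what
    [quad_not_square] needs to keep the next radicand a nonsquare. *)
Lemma triquad_exists : (2%:R : k) != 0 -> A != 0 -> B != 0 -> c != 0 ->
  ~ square_dependent A B c -> inhabited triquad.
Proof.
move=> two0 A0 B0 c0 nd.
have nsq (u : k) : ~ is_square u -> forall x : k, x ^+ 2 != u.
  by move=> nu x; apply/eqP => xu; apply: nu; exists x.
pose k0 : gfield G8 := @GField G8 k (fun=> idfun) (fun=> erefl) (fun _ _ _ => erefl).
have ndA : ~ is_square A by rewrite /square_dependent in nd; tauto.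
have ndB : ~ is_square B by rewrite /square_dependent in nd; tauto.
have ndC : ~ is_square c by rewrite /square_dependent in nd; tauto.
have ndAB : ~ is_square (A * B) by rewrite /square_dependent in nd; tauto.
have ndAC : ~ is_square (A * c) by rewrite /square_dependent in nd; tauto.
have ndBC : ~ is_square (B * c) by rewrite /square_dependent in nd; tauto.
have ndABC : ~ is_square (A * (B * c)) by rewrite mulrA; rewrite /square_dependent in nd; tauto.
have q1 : quad_ext (chi 0) (A : k0) by apply: quad_ext_exists => //; [exact: chiD|exact: nsq].
have n1 (e : k) : ~ is_square e -> ~ is_square (A * e) -> forall u, u ^+ 2 != qe_in q1 e.
  move=> ne nAe; apply: quad_not_square => //; try exact: nsq.
have q2 : quad_ext (chi 1) (qe_in q1 B).
  apply: quad_ext_exists; [exact: chiD| |exact: n1].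
  by move=> s; rewrite qe_act_in.
have q3 : quad_ext (chi 2) (qe_in q2 (qe_in q1 c)).
  apply: quad_ext_exists; [exact: chiD| |].
    by move=> s; rewrite !qe_act_in.
  apply: quad_not_square => //.
  - by rewrite -(rmorph_nat (qe_in q1)) fmorph_eq0.
  - by rewrite fmorph_eq0.
  - exact: n1.
  - exact: n1.
  - by rewrite -rmorphM; apply: n1.
constructor.
pose i1 := qe_in q1; pose i2 := qe_in q2; pose i3 := qe_in q3.
apply: (@Triquad (qe_sort q3) [the {rmorphism k -> qe_sort q3} of i3 \o (i2 \o i1)]
  (i3 (i2 (qe_root q1))) (i3 (qe_root q2)) (qe_root q3)).
- by rewrite -!rmorphXn qe_root2.
- by rewrite -!rmorphXn qe_root2.
- by rewrite qe_root2.
- by move=> s u; rewrite /= /i3 /i2 /i1 !qe_act_in.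
- by move=> s; rewrite /i3 /i2 !qe_act_in qe_act_root !rmorphM !rmorphXn !rmorphN1.
- by move=> s; rewrite /i3 !qe_act_in qe_act_root !rmorphM !rmorphXn !rmorphN1.
- by move=> s; rewrite qe_act_root.
- move=> P sP Pin PA PB PC u; have [_ _ PD _ PM] := is_subfield_closed sP.
  have P2 v : P (i3 (i2 v)).
    by have [x [y ->]] := qe_split v; rewrite !rmorphD !rmorphM; apply: PD; [exact: Pin|apply: PM PA; exact: Pin].
  have P3 v : P (i3 v).
    by have [x [y ->]] := qe_split v; rewrite !rmorphD !rmorphM; apply: PD; [exact: P2|apply: PM PB; exact: P2].
  by have [x [y ->]] := qe_split u; apply: PD; [exact: P3|apply: PM PC; exact: P3].
- move=> W f wA wB wC eA eB eC.
  have [g1 [g1i g1r]] := @qe_lift _ _ _ _ q1 W f wA eA.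
  have [|g2 [g2i g2r]] := @qe_lift _ _ _ _ q2 W g1 wB; first by rewrite g1i.
  have [|g3 [g3i g3r]] := @qe_lift _ _ _ _ q3 W g2 wC; first by rewrite g2i g1i.
  by exists g3; split=> [u|||] //; rewrite /= /i3 /i2 /i1 ?g3i ?g2i ?g1i.
Qed.

End Triquad.

(** Modulo squares, ac, bc, c generate the same group as a, b, c. *)
Lemma square_dependent_twist (K : fieldType) (a b c : K) : c != 0 ->
  square_dependent (a * c) (b * c) c -> square_dependent a b c.
Proof.
move=> c0; have quo (u v : K) : v != 0 -> is_square (u * v ^+ 2) -> is_square u.
  by move=> v0 [x xE]; exists (x / v); rewrite expr_div_n -xE mulfK // expf_neq0.
rewrite /square_dependent => -[h|[h|[h|[h|[h|[h|h]]]]]]; try tauto.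
- do 3 right; left; apply: (quo _ _ c0); have <- : a * c * (b * c) = a * b * c ^+ 2 by ring.
  by [].
- by left; apply: (quo _ _ c0); have <- : a * c * c = a * c ^+ 2 by ring.
- by right; left; apply: (quo _ _ c0); have <- : b * c * c = b * c ^+ 2 by ring.
- by do 6 right; apply: (quo _ _ c0); have <- : a * c * (b * c) * c = a * b * c * c ^+ 2 by ring.
Qed.

(** * The valuation of a rational function field at a root *)

Section RootValuation.

Variables (G : finZmodType) (k : gfield G) (r : k).

(** A fraction is chosen for each element. The order at [r] does not depend on it, since
    multiplicities add up on cross-multiplied polynomials. *)
Lemma root_valuation_exists : exists v : ext k -> int,
  forall n d, n != 0 -> d != 0 -> v (extP n / extP d) = (mup r n)%:Z - (mup r d)%:Z.
Proof.
have P (u : ext k) : exists nd : {poly k} * {poly k}, nd.2 != 0 /\ u = extP nd.1 / extP nd.2.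
  by have [n [d [d0 uE]]] := ext_split u; exists (n, d).
pose nd u := proj1_sig (constructive_indefinite_description _ (P u)).
have ndP u : (nd u).2 != 0 /\ u = extP (nd u).1 / extP (nd u).2.
  exact: proj2_sig (constructive_indefinite_description _ (P u)).
exists (fun u => (mup r (nd u).1)%:Z - (mup r (nd u).2)%:Z) => n d n0 d0.
have [d'0 e] := ndP (extP n / extP d); move: (nd _).1 (nd _).2 d'0 e => n' d' d'0 e.
have e1 : n * d' = n' * d.
  apply: extP_inj; rewrite !rmorphM; apply/eqP; rewrite -eqr_div ?extP_eq0 //.
  exact/eqP.
have n'0 : n' != 0.
  apply: contraNneq (mulf_neq0 n0 d'0) => n'0; by rewrite e1 n'0 mul0r.
have := congr1 (mup r) e1; rewrite !mupM //; lia.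
Qed.

Definition root_val : ext k -> int :=
  proj1_sig (constructive_indefinite_description _ root_valuation_exists).

Lemma root_val_div n d : n != 0 -> d != 0 ->
  root_val (extP n / extP d) = (mup r n)%:Z - (mup r d)%:Z.
Proof. exact: (proj2_sig (constructive_indefinite_description _ root_valuation_exists)). Qed.

Lemma root_val_extP n : n != 0 -> root_val (extP n) = (mup r n)%:Z.
Proof.
move=> n0; rewrite -[extP n]divr1 -(rmorph1 extP) root_val_div ?oner_neq0 //.
by rewrite (mupNroot (q := 1)) ?root1 // subr0.
Qed.

Lemma ext_split_neq0 (u : ext k) : u != 0 ->
  exists n d, [/\ n != 0, d != 0 & u = extP n / extP d].
Proof.
move=> u0; have [n [d [d0 uE]]] := ext_split u; exists n, d; split=> //.
by apply: contraNneq u0 => n0; rewrite uE n0 rmorph0 mul0r.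
Qed.

Lemma root_valM (u v : ext k) : u != 0 -> v != 0 -> root_val (u * v) = root_val u + root_val v.
Proof.
move=> /ext_split_neq0[n [d [n0 d0 ->]]] /ext_split_neq0[m [e [m0 e0 ->]]].
rewrite mulf_div -!rmorphM !root_val_div ?mulf_neq0 // !mupM //.
by move: (mup r n) (mup r d) (mup r m) (mup r e) => *; lia.
Qed.

(** Acting on coefficients preserves the powers of X - r when [r] is fixed, hence the
    multiplicities. *)
Lemma root_val_act s (u : ext k) : gact s r = r -> root_val (gact s u) = root_val u.
Proof.
move=> fr; have [->|/ext_split_neq0[n [d [n0 d0 ->]]]] := eqVneq u 0; first by rewrite rmorph0.
have mu_act p : p != 0 -> mup r (map_poly (gact s) p) = mup r p.
  move=> p0; have p0' : map_poly (gact s) p != 0 by rewrite map_poly_eq0.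
  have e j : ('X - r%:P) ^+ j = map_poly (gact s) (('X - r%:P) ^+ j).
    by rewrite rmorphXn rmorphB /= map_polyX map_polyC /= fr.
  have le j : (j <= mup r (map_poly (gact s) p))%N = (j <= mup r p)%N.
    by rewrite !mup_geq // {1}e act_dvdp.
  by apply/eqP; rewrite eqn_leq -le leqnn le leqnn.
by rewrite fmorph_div !act_extP !root_val_div ?map_poly_eq0 // !mu_act.
Qed.

Lemma root_val_extC (u : k) : u != 0 -> root_val (extC k u) = 0.
Proof.
by move=> u0; rewrite /extC /= root_val_extP ?polyC_eq0 // mupNroot // rootC.
Qed.

End RootValuation.

(** * Transfer of algebraic dependence, and the tower M(l) *)

Section Transfer.

Variables (K F W : fieldType) (iota : {rmorphism K -> F}) (j : {rmorphism F -> W}).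

Definition comp_iota : {rmorphism K -> W} := [the {rmorphism K -> W} of j \o iota].

Lemma gen_transfer l (v : W) : gen comp_iota (map j l) v -> exists2 u, gen iota l u & v = j u.
Proof.
have sG := gen_subfield iota l; case: (sG) => G1 GB GD.
apply: (@gen_min _ _ comp_iota _ (fun v => exists2 u, gen iota l u & v = j u)).
- split; first by exists 1; rewrite ?rmorph1.
    by move=> _ _ [u gu ->] [u' gu' ->]; exists (u - u'); rewrite ?rmorphB //; exact: GB.
  by move=> _ _ [u gu ->] [u' gu' ->]; exists (u / u'); rewrite ?fmorph_div //; exact: GD.
- by move=> c; exists (iota c) => //; exact: gen_const.
- by move=> _ /mapP[u ul ->]; exists u => //; exact: gen_mem.
Qed.

Lemma acl_transfer l (u : F) : acl comp_iota (map j l) (j u) -> acl iota l u.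
Proof.
case=> p [p0 pE pu].
have [q qE] : exists q, p = map_poly j q.
  by apply: lift_poly => i; have [v _ ->] := gen_transfer (pE i); exists v.
exists q; split; first by move: p0; rewrite qE map_poly_eq0.
  move=> i; have [v gv] := gen_transfer (pE i).
  by rewrite qE coef_map => /fmorph_inj ->.
by move: pu; rewrite qE fmorph_root.
Qed.

End Transfer.

Lemma transcendental_acl (K k W : fieldType) (iota : {rmorphism K -> W})
    (f : {rmorphism k -> W}) l u :
  (forall r, acl iota l (f r)) -> ~ acl iota l u -> transcendental_over f u.
Proof.
move=> af nu p p0; apply/eqP => e; apply: nu; apply: acl_closed.
exists (map_poly f p); split; first by rewrite map_poly_eq0.
  by move=> i; rewrite coef_map; exact: af.
exact/eqP.
Qed.

(* Any subfield containing the base and the variable contains the evaluations. *)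
Lemma ext_eval_min (G : finZmodType) (k : gfield G) (W : fieldType)
    (f : {rmorphism k -> W}) u (tu : transcendental_over f u) (P : W -> Prop) :
  is_subfield P -> (forall r, P (f r)) -> P u -> forall r, P (ext_eval tu r).
Proof.
move=> sP Pf Pu r; have Pp p : P (ext_eval tu (extP p)).
  rewrite ext_eval_extP horner_coef; apply: big_rec; first exact: (sub0 sP).
  move=> i x _ Px; apply: (subD sP) => //; apply: (subM sP); last exact: (subX sP).
  by rewrite coef_map; exact: Pf.
by have [n [d [_ ->]]] := ext_split r; rewrite fmorph_div; case: sP => _ _; apply.
Qed.

Section Tower.

Variables (K F : fieldType) (iota : {rmorphism K -> F}) (A B c : K).
Variables (M : triquad A B c) (Om : triquad (iota A) (iota B) (iota c)).

Local Notation j := (tq_in Om).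
Local Notation jiota := (comp_iota iota j).

Lemma base_change_exists : exists mu : {rmorphism tq M -> tq Om},
  [/\ forall u, mu (tq_in M u) = j (iota u), mu (tq_A M) = tq_A Om,
      mu (tq_B M) = tq_B Om & mu (tq_C M) = tq_C Om].
Proof. by apply: (@tq_lift _ _ _ _ M _ jiota); rewrite ?tq_sqA ?tq_sqB ?tq_sqC. Qed.

Variable mu : {rmorphism tq M -> tq Om}.
Hypothesis muP : [/\ forall u, mu (tq_in M u) = j (iota u), mu (tq_A M) = tq_A Om,
      mu (tq_B M) = tq_B Om & mu (tq_C M) = tq_C Om].

Lemma mu_equivariant : equivariant mu.
Proof.
case: muP => mui muA muB muC; move=> s u; move: u.
apply: (@tq_min _ _ _ _ M (fun u => mu (gact s u) = gact s (mu u))).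
- split; first by rewrite !rmorph1.
    by move=> u v eu ev; rewrite !rmorphB eu ev.
  by move=> u v eu ev; rewrite !fmorph_div eu ev.
- by move=> u; rewrite tq_act mui tq_act.
- by rewrite muA !tq_actA rmorphM rmorphXn rmorphN1 muA.
- by rewrite muB !tq_actB rmorphM rmorphXn rmorphN1 muB.
- by rewrite muC !tq_actC rmorphM rmorphXn rmorphN1 muC.
Qed.

Lemma acl_roots l : [/\ acl jiota l (tq_A Om), acl jiota l (tq_B Om) & acl jiota l (tq_C Om)].
Proof.
split; apply: acl_sqr; rewrite ?tq_sqA ?tq_sqB ?tq_sqC.
- exact: (@acl_const _ _ jiota l A).
- exact: (@acl_const _ _ jiota l B).
- exact: (@acl_const _ _ jiota l c).
Qed.

Lemma acl_mu l u : acl jiota l (mu u).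
Proof.
case: muP => mui muA muB muC; have [aA aB aC] := acl_roots l; move: u.
have [A1 AB AD] := acl_subfield jiota l.
apply: (@tq_min _ _ _ _ M (fun u => acl jiota l (mu u))); rewrite ?muA ?muB ?muC //.
- split; first by rewrite rmorph1.
    by move=> u v eu ev; rewrite rmorphB; exact: AB.
  by move=> u v eu ev; rewrite fmorph_div; exact: AD.
- by move=> u; rewrite mui; exact: (@acl_const _ _ jiota l u).
Qed.

Lemma acl_ext_eval (k : gfield G8) (f : {rmorphism k -> tq Om}) l u
    (tu : transcendental_over f u) : (forall r, acl jiota l (f r)) ->
  forall r, acl jiota (u :: l) (ext_eval tu r).
Proof.
move=> af; apply: ext_eval_min; first exact: acl_subfield.
  by move=> r; apply: acl_sub (af r) => v vl; rewrite inE vl orbT.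
by apply: acl_mem; rewrite mem_head.
Qed.

(* The function field [M(l)] inside [Om], with its norm property. *)
Lemma tower l : indep iota l -> exists (R : gfield G8) (phi : {rmorphism R -> tq Om})
    (nu : {rmorphism tq M -> R}),
  [/\ equivariant phi /\ (forall m, phi (nu m) = mu m),
      forall u, u \in l -> exists r, phi r = j u,
      forall r, acl jiota (map j l) (phi r),
      forall P : tq Om -> Prop, is_subfield P -> (forall m, P (mu m)) ->
        (forall u, u \in l -> P (j u)) -> forall r, P (phi r)
    & forall D : R, D != 0 -> normlike D ->
        exists la g h, D = nu la * gnorm g * h ^+ 2].
Proof.
elim: l => [|u l IHl] /=.
  move=> _; exists (tq M), mu, idfun; split=> //.
  - by split=> //; exact: mu_equivariant.
  - by move=> r; exact: acl_mu.
  - move=> D _ _; exists D, 1, 1; rewrite expr1n mulr1 /gnorm big1 ?mulr1 // => s _.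
    by rewrite rmorph1.
case=> nu_ /IHl[R [phi [nu [[ephi phinu] phil aphi minphi normphi]]]].
have tu : transcendental_over phi (j u).
  by apply: (transcendental_acl aphi) => /acl_transfer.
exists (ext R), (ext_eval tu), [the {rmorphism tq M -> ext R} of extC R \o nu]; split.
- split; first by apply: ext_eval_equivariant => // s; rewrite tq_act.
  by move=> m /=; rewrite ext_eval_extC phinu.
- move=> v; rewrite inE => /orP[/eqP ->|/phil[r rE]].
    by exists (extP 'X); rewrite ext_evalX.
  by exists (extC R r); rewrite ext_eval_extC.
- exact: acl_ext_eval.
- move=> P sP Pm Pl; apply: ext_eval_min => //; last by apply: Pl; rewrite mem_head.
  by move=> r; apply: minphi => // v vl; apply: Pl; rewrite inE vl orbT.
(* Split off one variable with [normlike_ext]; the remaining constant is again [normlike], so the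
   induction hypothesis applies to it. *)
- move=> D D0 nD.
  have [D' [g [h [D'0 g0 h0 nD' ->]]]] := normlike_ext G8_exp2 G8_halving D0 nD.
  have [la [g' [h' ->]]] := normphi D' D'0 nD'.
  exists la, (extC R g' * g), (extC R h' * h).
  have eC : equivariant (extC R) by move=> s v; rewrite act_extC.
  by rewrite gnormM -(gnorm_morph g' eC) !rmorphM /=; ring.
Qed.

End Tower.

(** * The fixed field *)

Lemma conj_components (W : fieldType) (u v r : W) : (2%:R : W) != 0 -> r != 0 ->
  u = (u + r * v + (u - r * v)) / 2%:R /\ v = (u + r * v - (u - r * v)) / (2%:R * r).
Proof. by move=> t0 r0; split; field; rewrite ?t0 ?r0. Qed.

Lemma mul_div_square (W : fieldType) (p q r d u : W) : d != 0 ->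
  p * q * (r / d * u) ^+ 2 * (d * d) = p * q * (r * r) * u ^+ 2.
Proof. by move=> d0; field. Qed.

Lemma four_lines (W : fieldType) (u v w : W) :
  (u - (v + w)) * ((u - - (v + w)) * ((u - (v - w)) * (u - (w - v)))) =
  (u ^+ 2 - v ^+ 2 - w ^+ 2) ^+ 2 - 4%:R * w ^+ 2 * v ^+ 2.
Proof. by ring. Qed.

Local Notation acl_in i := (acl i).

Section FixedField.

Variables (K F : fieldType) (iota : {rmorphism K -> F}) (a b c : K) (x y z : F).
Variable rho : {rmorphism F -> F}.
Hypotheses (two0 : (2%:R : F) != 0) (a0 : a != 0) (b0 : b != 0) (c0 : c != 0).
Hypothesis rhoK : forall k, rho (iota k) = iota k.
Hypotheses (rhox : rho x = - x) (rhoy : rho y = - y).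
Hypothesis rhoz : rho z = iota c * (x ^+ 2 - iota a) * (y ^+ 2 - iota b) / z.
Hypothesis ixyz : indep iota [:: x; y; z].
Hypothesis gxyz : forall u, gen iota [:: x; y; z] u.

Local Notation gen := (gen iota).
Local Notation acl := (acl iota).
Let C (k : K) : F := iota k.
Let phi := C c * (x ^+ 2 - C a) * (y ^+ 2 - C b).

Let Ca0 : C a != 0. Proof. by rewrite fmorph_eq0. Qed.
Let Cb0 : C b != 0. Proof. by rewrite fmorph_eq0. Qed.
Let Cc0 : C c != 0. Proof. by rewrite fmorph_eq0. Qed.

(** [ff_s] and [ff_t] are the coordinates of z in z = s + x t, obtained from z and its image phi /
    z, with x negated by [rho]. Substituting y = w x in s^2 - x^2 t^2 = phi leaves an equation
    quadratic in x^2, for which [ff_Z] and [ff_e] are the variables after completing the square. *)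
Definition ff_w := y / x.
Definition ff_t := (z - phi / z) / (2%:R * x).
Definition ff_s := (z + phi / z) / 2%:R.
Definition ff_e := 2%:R * ff_w * ff_s.
Definition ff_Z := 2%:R * C c * ff_w ^+ 2 * x ^+ 2 + ff_t ^+ 2 - C b * C c - C a * C c * ff_w ^+ 2.

Local Notation w := ff_w.
Local Notation t := ff_t.
Local Notation s := ff_s.
Local Notation e := ff_e.
Local Notation Z := ff_Z.

(* The product of the four linear forms [t +- sqrt (b c) +- sqrt (a c) w]. *)
Definition ff_f := (t ^+ 2 - C b * C c - C a * C c * w ^+ 2) ^+ 2
                  - 4%:R * C a * C b * C c ^+ 2 * w ^+ 2.
Local Notation f := ff_f.
Definition ff_gens := [:: w; t; Z; e].
Local Notation l4 := ff_gens.

Lemma acl_neq0 l u : ~ acl l u -> u != 0.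
Proof. by move=> nu; apply/eqP => u0; apply: nu; rewrite u0; exact: (sub0 (acl_subfield _ _)). Qed.

Lemma xyz_neq0 : [/\ x != 0, y != 0 & z != 0].
Proof. by case: ixyz => nx [ny [nz _]]; split; [apply: acl_neq0 nx|apply: acl_neq0 ny|apply: acl_neq0 nz]. Qed.

Let x0 : x != 0. Proof. by case: xyz_neq0. Qed.
Let y0 : y != 0. Proof. by case: xyz_neq0. Qed.
Let z0 : z != 0. Proof. by case: xyz_neq0. Qed.
Let w0 : w != 0. Proof. by rewrite mulf_neq0 ?invr_neq0. Qed.
Let phi0 : phi != 0.
Proof.
apply/eqP => phi0; have : rho z != 0 by rewrite fmorph_eq0.
by rewrite rhoz -/(C a) -/(C b) -/(C c) -/phi phi0 mul0r eqxx.
Qed.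

Lemma rho_phi : rho phi = phi.
Proof.
rewrite /phi !rmorphM !rmorphB !rmorphXn /C !rhoK rhox rhoy; ring.
Qed.

Lemma rho_z : rho z = phi / z. Proof. exact: rhoz. Qed.

Lemma rho_w : rho w = w.
Proof. by rewrite /w fmorph_div rhox rhoy mulNr invrN mulrN opprK. Qed.

Lemma rho_t : rho t = t.
Proof.
rewrite /t fmorph_div rmorphB fmorph_div rmorphM rmorph_nat rho_phi rho_z rhox.
by field; rewrite oppr_eq0 x0 z0 two0 phi0.
Qed.

Lemma rho_s : rho s = s.
Proof.
rewrite /s fmorph_div rmorphD fmorph_div rmorph_nat rho_phi rho_z.
by field; rewrite z0 two0 phi0.
Qed.

Lemma rho_gens v : v \in l4 -> rho v = v.
Proof.
have rX : rho (x ^+ 2) = x ^+ 2 by rewrite rmorphXn rhox sqrrN.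
rewrite !inE => /or4P[] /eqP ->; rewrite ?rho_w ?rho_t //.
  rewrite /Z; move: rho_w rho_t; move: w t => w' t' rw rt.
  by rewrite !rmorphB rmorphD !rmorphM rmorph_nat /C !rhoK rw rt rhox; ring.
rewrite /e; move: rho_w rho_s; move: w s => w' s' rw rs.
by rewrite !rmorphM rmorph_nat rw rs.
Qed.

Lemma rel_s : s ^+ 2 - x ^+ 2 * t ^+ 2 = phi.
Proof. by rewrite /s /t; field; rewrite x0 z0 two0. Qed.

Lemma yE : y = w * x. Proof. by rewrite /w divfK. Qed.

Lemma zE : z = s + x * t.
Proof. by rewrite /s /t; field; rewrite x0 z0 two0. Qed.

(** Multiply s^2 = x^2 t^2 + c (x^2 - a)(w^2 x^2 - b) by 4 c w^2 and complete the square in x^2: f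
    is the discriminant. *)
Lemma rel_Z : Z ^+ 2 - C c * e ^+ 2 = f.
Proof.
have sE : s ^+ 2 = x ^+ 2 * t ^+ 2 + C c * (x ^+ 2 - C a) * (w ^+ 2 * x ^+ 2 - C b).
  have -> : w ^+ 2 * x ^+ 2 = y ^+ 2 by rewrite -exprMn -yE.
  by rewrite -/phi -rel_s; ring.
have -> : e ^+ 2 = 4%:R * w ^+ 2 * s ^+ 2 by rewrite /e; ring.
by rewrite sE /Z /f; ring.
Qed.

Lemma sE_gens : s = e / (2%:R * w).
Proof. by rewrite /e; field; rewrite two0 w0. Qed.

Lemma x2E_gens : x ^+ 2 = (Z - t ^+ 2 + C b * C c + C a * C c * w ^+ 2) / (2%:R * C c * w ^+ 2).
Proof. by rewrite /Z; field; rewrite two0 w0 Cc0. Qed.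

Section Membership.
Variable E : F -> Prop.
Hypotheses (sE : is_subfield E) (EC : forall k, E (iota k)).
Hypothesis El4 : forall v, v \in l4 -> E v.

Let Ew : E w. Proof. by apply: El4; rewrite !inE eqxx. Qed.
Let Et : E t. Proof. by apply: El4; rewrite !inE eqxx orbT. Qed.
Let EZ : E Z. Proof. by apply: El4; rewrite !inE eqxx !orbT. Qed.
Let Ee : E e. Proof. by apply: El4; rewrite !inE eqxx !orbT. Qed.

Lemma mem_x2 : E (x ^+ 2).
Proof.
rewrite x2E_gens; have Ea := EC a; have Eb := EC b; have Ec := EC c; rewrite /C.
by subfield_mem sE.
Qed.

Lemma mem_s : E s.
Proof. by rewrite sE_gens; subfield_mem sE. Qed.

Lemma mem_t : E t. Proof. exact: Et. Qed.
Lemma mem_w : E w. Proof. exact: Ew. Qed.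

End Membership.

Lemma acl_xyz l : (forall v, v \in l4 -> acl l v) -> forall v, v \in [:: x; y; z] -> acl l v.
Proof.
move=> H; have sE := acl_subfield iota l; have EC := @acl_const _ _ iota l.
have ax : acl l x by apply: acl_sqr; exact: (mem_x2 sE EC H).
have aw := mem_w H; have at_ := mem_t H; have as_ := mem_s sE H.
by move=> v; rewrite !inE => /or3P[] /eqP ->; rewrite ?yE ?zE //; subfield_mem sE.
Qed.

(** x, y, z are algebraic over the four generators, so two elements cannot suffice. This serves
    below to show that denominators do not vanish. *)
Lemma not_two_gens u v : ~ (forall r, r \in l4 -> acl [:: u; v] r).
Proof.
move=> H; have [|zs [sz _]] := @exchange _ _ iota [:: x; y; z] [:: u; v] ixyz.
  exact: acl_xyz.
by move/eqP: sz; rewrite !addnS.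
Qed.

(** Since x^2 lies in the field generated by [ff_gens], the elements p + q x over it form a field.
    It contains x, y = w x and z = s + t x, so it is everything, and [rho] negates the part q x. *)
Lemma fixedP u : rho u = u <-> gen l4 u.
Proof.
have sG := gen_subfield iota l4; have GC := @gen_const _ _ iota l4.
have Gl4 := @gen_mem _ _ iota l4.
have fixG v : gen l4 v -> rho v = v.
  apply: (@gen_min _ _ iota l4 (fun v => rho v = v)) => //; last exact: rho_gens.
  split; first exact: rmorph1.
    by move=> r r' e1 e2; rewrite rmorphB e1 e2.
  by move=> r r' e1 e2; rewrite fmorph_div e1 e2.
split=> [ru|]; last exact: fixG.
have X2 := mem_x2 sG GC Gl4.
have [p [q [Gp [Gq uE]]]] : exists p q, gen l4 p /\ gen l4 q /\ u = p + q * x.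
  apply: (@gen_min _ _ iota [:: x; y; z]
    (fun u => exists p q, gen l4 p /\ gen l4 q /\ u = p + q * x)) (gxyz u) => [|k|v].
  - split; first by exists 1, 0; rewrite mul0r addr0; split; [subfield_mem sG | split=> //; subfield_mem sG].
      move=> _ _ [p [q [Gp [Gq ->]]]] [p' [q' [Gp' [Gq' ->]]]].
      exists (p - p'), (q - q'); split; first by subfield_mem sG.
      by split; [subfield_mem sG | ring].
    move=> _ _ [p [q [Gp [Gq ->]]]] [p' [q' [Gp' [Gq' ->]]]].
    have [n0|n0] := eqVneq (p' + q' * x) 0.
      exists 0, 0; rewrite n0 invr0 mulr0 mul0r addr0.
      by split; [subfield_mem sG | split=> //; subfield_mem sG].
    have n1 : p' - q' * x != 0.
      have -> : p' - q' * x = rho (p' + q' * x).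
        by rewrite rmorphD rmorphM rhox !fixG // mulrN.
      by rewrite fmorph_eq0.
    have n2 : p' ^+ 2 - q' ^+ 2 * x ^+ 2 != 0.
      by rewrite -exprMn subr_sqr mulf_neq0.
    exists ((p * p' - q * q' * x ^+ 2) / (p' ^+ 2 - q' ^+ 2 * x ^+ 2)),
           ((q * p' - p * q') / (p' ^+ 2 - q' ^+ 2 * x ^+ 2)).
    split; first by subfield_mem sG.
    split; first by subfield_mem sG.
    rewrite [_ / _ * x]mulrAC -mulrDl.
    by apply/eqP; rewrite eqr_div //; apply/eqP; ring.
  - exists (iota k), 0; rewrite mul0r addr0; split=> //; split=> //; subfield_mem sG.
  - have Gw := mem_w Gl4; have Gt := mem_t Gl4; have Gs := mem_s sG Gl4.
    rewrite !inE => /or3P[] /eqP ->.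
    + by exists 0, 1; rewrite add0r mul1r; split; [subfield_mem sG | split=> //; subfield_mem sG].
    + by exists 0, w; rewrite add0r -yE; split; [subfield_mem sG | split=> //; subfield_mem sG].
    + by exists s, t; rewrite {1}zE [x * t]mulrC; split; [subfield_mem sG | split=> //; subfield_mem sG].
have : 2%:R * q * x = 0.
  have : rho u = p - q * x by rewrite uE rmorphD rmorphM rhox !fixG // mulrN.
  rewrite ru {1}uE => /eqP; rewrite -subr_eq0 => /eqP h.
  by rewrite -h; ring.
move/eqP; rewrite !mulf_eq0 (negbTE two0) (negbTE x0) orbF /= => /eqP q0.
by rewrite uE q0 mul0r addr0.
Qed.

Lemma f_neq0 : f != 0.
Proof.
apply/eqP => f0; apply: (@not_two_gens w e).
have sA := acl_subfield iota [:: w; e]; have AC := @acl_const _ _ iota [:: w; e].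
have aw : acl [:: w; e] w by apply: acl_mem; rewrite !inE eqxx.
have ae : acl [:: w; e] e by apply: acl_mem; rewrite !inE eqxx orbT.
have Aa := AC a; have Ab := AC b; have Ac := AC c.
have at_ : acl [:: w; e] t.
  apply: acl_sqr.
  have -> : t ^+ 2 = (t ^+ 2 - C b * C c - C a * C c * w ^+ 2) + (C b * C c + C a * C c * w ^+ 2).
    by ring.
  apply: (subD sA); last by rewrite /C; subfield_mem sA.
  apply: acl_sqr; move/eqP: f0; rewrite subr_eq0 => /eqP ->; rewrite /C; subfield_mem sA.
have aZ : acl [:: w; e] Z.
  apply: acl_sqr; move: rel_Z; rewrite f0 => /eqP; rewrite subr_eq0 => /eqP ->.
  by rewrite /C; subfield_mem sA.
by move=> v; rewrite !inE => /or4P[] /eqP ->.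
Qed.

Definition fixed (u : F) := rho u = u.

(** Three generators suffice: their independence follows by counting, as x, y, z are algebraic over
    them. *)
Lemma fixed_rational l : size l = 3 -> (forall v, v \in l -> rho v = v) ->
  (forall v, v \in l4 -> gen l v) -> rational iota fixed.
Proof.
move=> sl fl gl; apply: (@indep_rational _ _ iota l) => [|u].
  apply: (indep_spanning ixyz) => //; apply: acl_xyz => v /gl; exact: acl_gen.
rewrite /fixed fixedP; split; apply: gen_sub => v; first exact: gl.
by move/fl/fixedP.
Qed.

(* [Z ^ 2 - c e ^ 2 = P ^ 2 - c (al Q) ^ 2]: a quadric containing a line. *)
Lemma rational_isotropic (al : K) P Q : gen [:: w; t] P -> gen [:: w; t] Q ->
  f = P ^+ 2 - C c * C al ^+ 2 * Q ^+ 2 -> rational iota fixed.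
Proof.
move=> gP gQ fE.
have sub (l : seq F) (v : F) : w \in l -> t \in l -> gen [:: w; t] v -> gen l v.
  move=> wl tl; apply: gen_sub => r; rewrite !inE => /orP[] /eqP ->; exact: gen_mem.
have d0 : e - C al * Q != 0.
  apply/eqP => d0; have eE : e = C al * Q by apply/eqP; rewrite -subr_eq0 d0.
  apply: (@not_two_gens w t); have sA := acl_subfield iota [:: w; t].
  have aw : acl [:: w; t] w by apply: acl_mem; rewrite !inE eqxx.
  have at_ : acl [:: w; t] t by apply: acl_mem; rewrite !inE eqxx orbT.
  have aP := acl_gen gP; have aQ := acl_gen gQ; have aal := @acl_const _ _ iota [:: w; t] al.
  have ae : acl [:: w; t] e by rewrite eE; subfield_mem sA.
  have aZ : acl [:: w; t] Z.
    apply: acl_sqr; have -> : Z ^+ 2 = P ^+ 2.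
      by move: rel_Z; rewrite fE eE => /eqP; rewrite -subr_eq0 => /eqP h; apply/eqP; rewrite -subr_eq0 -h; apply/eqP; ring.
    by subfield_mem sA.
  by move=> v; rewrite !inE => /or4P[] /eqP ->.
(* The equation reads (Z - P)(Z + P) = c (e - al Q)(e + al Q). The parameter [la] of one ruling
   makes it linear in e, with w and t free. *)
pose la := (Z - P) / (e - C al * Q).
have ZE : Z = P + la * (e - C al * Q) by rewrite divfK // addrC subrK.
have eq1 : C c * (e + C al * Q) = la * (Z + P).
  apply: (mulIf d0); rewrite -[la * _ * _]mulrA [(Z + P) * _]mulrC mulrA divfK //.
  have := rel_Z; rewrite fE => /eqP; rewrite -subr_eq0 => /eqP h.
  by apply/eqP; rewrite -subr_eq0 -[X in _ == X]oppr0 -h; apply/eqP; ring.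
have eq2 : e * (C c - la ^+ 2) = 2%:R * la * P - la ^+ 2 * C al * Q - C c * C al * Q.
  have : C c * (e + C al * Q) = la * (P + la * (e - C al * Q) + P) by rewrite -ZE.
  by move/eqP; rewrite -subr_eq0 => /eqP h; apply/eqP; rewrite -subr_eq0 -h; apply/eqP; ring.
(* If la^2 = c, the linear equation forces P = la al Q, so that f = 0. *)
have n0 : C c - la ^+ 2 != 0.
  apply/eqP => n0; have cE : C c = la ^+ 2 by apply/eqP; rewrite -subr_eq0 n0.
  have la0 : la != 0 by apply: contraNneq Cc0 => la0; rewrite cE la0 expr0n.
  have := f_neq0; rewrite fE cE.
  have -> : P ^+ 2 - la ^+ 2 * C al ^+ 2 * Q ^+ 2 = (P - la * C al * Q) * (P + la * C al * Q) by ring.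
  have -> : P - la * C al * Q = 0; last by rewrite mul0r eqxx.
  apply: (mulfI (mulf_neq0 two0 la0)); rewrite mulr0.
  by move: eq2; rewrite n0 mulr0 cE => h; rewrite h; ring.
apply: (@fixed_rational [:: la; w; t]) => // [v|].
  have fP v' : gen [:: w; t] v' -> rho v' = v'.
    move=> gv; apply/fixedP; apply: (sub _ v') gv; by rewrite !inE eqxx ?orbT.
  have re : rho e = e by apply: rho_gens; rewrite !inE eqxx !orbT.
  have rZ : rho Z = Z by apply: rho_gens; rewrite !inE eqxx !orbT.
  rewrite !inE => /or3P[] /eqP ->; rewrite ?rho_w ?rho_t //.
  rewrite /la fmorph_div [rho (Z - P)]rmorphB [rho (e - _)]rmorphB [rho (C al * Q)]rmorphM.
  by rewrite rZ re !fP // /C rhoK.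
pose l3 := [:: la; w; t]; have sG := gen_subfield iota l3.
have gla : gen l3 la by apply: gen_mem; rewrite !inE eqxx.
have gw : gen l3 w by apply: gen_mem; rewrite !inE eqxx orbT.
have gt : gen l3 t by apply: gen_mem; rewrite !inE eqxx !orbT.
have wl : w \in l3 by rewrite !inE eqxx orbT.
have tl : t \in l3 by rewrite !inE eqxx !orbT.
have gP' := sub l3 P wl tl gP; have gQ' := sub l3 Q wl tl gQ.
have gal := @gen_const _ _ iota l3 al; have gc := @gen_const _ _ iota l3 c.
have ge : gen l3 e.
  by rewrite -(mulfK n0 e) eq2 /C; subfield_mem sG.
have gZ : gen l3 Z by rewrite ZE /C; subfield_mem sG.
by move=> v; rewrite !inE => /or4P[] /eqP ->.
Qed.

(* [Z' ^ 2 - c e' ^ 2 = (l ^ 2 - B) (m ^ 2 - B)] is a quadric over [K(l)] with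
   the rational point [(m, Z', e') = (l, l ^ 2 - B, 0)]. *)
Lemma rational_product (B : K) (l m Z' e' : F) :
  [/\ rho l = l, rho m = m, rho Z' = Z' & rho e' = e'] ->
  (forall v, v \in l4 -> gen [:: l; m; Z'; e'] v) ->
  Z' ^+ 2 - C c * e' ^+ 2 = (l ^+ 2 - C B) * (m ^+ 2 - C B) -> rational iota fixed.
Proof.
move=> [rl rm rZ re] gl rel.
have notin u v : ~ [/\ acl [:: u; v] l, acl [:: u; v] m, acl [:: u; v] Z' & acl [:: u; v] e'].
  move=> [al am aZ ae]; apply: (@not_two_gens u v) => r /gl/acl_gen; apply: acl_trans => r'.
  by rewrite !inE => /or4P[] /eqP ->.
have memL u v : acl [:: u; v] u by apply: acl_mem; rewrite !inE eqxx.
have memR u v : acl [:: u; v] v by apply: acl_mem; rewrite !inE eqxx orbT.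
have Z2 : Z' ^+ 2 = (l ^+ 2 - C B) * (m ^+ 2 - C B) + C c * e' ^+ 2 by rewrite -rel subrK.
have ml0 : m - l != 0.
  rewrite subr_eq0; apply/eqP => ml; apply: (@notin l e'); rewrite ml.
  have sA := acl_subfield iota [:: l; e'].
  have AB := @acl_const _ _ iota [:: l; e'] B; have Ac := @acl_const _ _ iota [:: l; e'] c.
  have Al := memL l e'; have Ae := memR l e'.
  by split=> //; apply: acl_sqr; rewrite Z2 ml /C; subfield_mem sA.
have lB0 : l ^+ 2 - C B != 0.
  apply/eqP => lB; apply: (@notin m e').
  have sA := acl_subfield iota [:: m; e'].
  have AB := @acl_const _ _ iota [:: m; e'] B; have Ac := @acl_const _ _ iota [:: m; e'] c.
  have Ae := memR m e'; split=> //.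
    by apply: acl_sqr; move/eqP: lB; rewrite subr_eq0 => /eqP ->.
  by apply: acl_sqr; rewrite Z2 lB mul0r add0r /C; subfield_mem sA.
(* Slopes of the chord through the rational point. After substitution one factor [mu] cancels and
   the equation becomes linear in [mu]. *)
pose mu := m - l; pose ze := (Z' - (l ^+ 2 - C B)) / mu; pose et := e' / mu.
have ZE : Z' = l ^+ 2 - C B + mu * ze by rewrite /ze mulrC divfK // addrC subrK.
have eE : e' = mu * et by rewrite /et mulrC divfK.
have mE : m = l + mu by rewrite /mu addrC subrK.
have eqmu : mu * (ze ^+ 2 - C c * et ^+ 2 - (l ^+ 2 - C B)) =
    (l ^+ 2 - C B) * (2%:R * l - 2%:R * ze).
  apply: (mulfI ml0); rewrite -/mu.
  move: rel; rewrite {1}ZE {1}eE {1}mE => /eqP; rewrite -subr_eq0 => /eqP h.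
  by apply/eqP; rewrite -subr_eq0 -h; apply/eqP; ring.
(* Vanishing would force ze = l and c et^2 = B. Then everything would be algebraic over l and m. *)
have n0 : ze ^+ 2 - C c * et ^+ 2 - (l ^+ 2 - C B) != 0.
  apply/eqP => n0; move: eqmu; rewrite n0 mulr0 => /esym/eqP.
  rewrite mulf_eq0 (negbTE lB0) -mulrBr mulf_eq0 (negbTE two0) subr_eq0 /= => /eqP lz.
  have ce : C c * et ^+ 2 = C B.
    apply/eqP; rewrite -subr_eq0 -oppr_eq0; apply/eqP; rewrite -[RHS]n0 lz.
    by ring.
  apply: (@notin l m); have sA := acl_subfield iota [:: l; m].
  have AB := @acl_const _ _ iota [:: l; m] B; have Ac := @acl_const _ _ iota [:: l; m] c.
  have Al := memL l m; have Am := memR l m.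
  have Aet : acl [:: l; m] et.
    apply: acl_sqr; have -> : et ^+ 2 = C B / C c by rewrite -ce mulrC mulKf.
    by rewrite /C; subfield_mem sA.
  split=> //; last by rewrite eE /mu; subfield_mem sA.
  by rewrite ZE -lz /mu /C; subfield_mem sA.
apply: (@fixed_rational [:: l; ze; et]) => // [v|].
  rewrite !inE => /or3P[] /eqP -> //.
    by rewrite /ze /mu fmorph_div !rmorphB rmorphXn rZ rl rm /C rhoK.
  by rewrite /et /mu fmorph_div rmorphB re rl rm.
pose l3 := [:: l; ze; et]; have sG := gen_subfield iota l3.
have Gl : gen l3 l by apply: gen_mem; rewrite !inE eqxx.
have Gz : gen l3 ze by apply: gen_mem; rewrite !inE eqxx orbT.
have Ge : gen l3 et by apply: gen_mem; rewrite !inE eqxx !orbT.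
have GB := @gen_const _ _ iota l3 B; have Gc := @gen_const _ _ iota l3 c.
have Gmu : gen l3 mu by rewrite -(mulfK n0 mu) eqmu /C; subfield_mem sG.
move=> v /gl; apply: gen_sub => r; rewrite !inE => /or4P[] /eqP -> //.
- by rewrite mE; subfield_mem sG.
- by rewrite ZE /C; subfield_mem sG.
- by rewrite eE; subfield_mem sG.
Qed.

(** Z is a square root over w, t, e, so these three carry the whole transcendence degree. *)
Lemma not_acl1 u v : (acl [:: u; v] w /\ acl [:: u; v] t) -> ~ acl [:: u; v] e.
Proof.
move=> [aw at_] ae; apply: (@not_two_gens u v).
have sA := acl_subfield iota [:: u; v].
have Aa := @acl_const _ _ iota [:: u; v] a; have Ab := @acl_const _ _ iota [:: u; v] b.
have Ac := @acl_const _ _ iota [:: u; v] c.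
have aZ : acl [:: u; v] Z.
  apply: acl_sqr; have -> : Z ^+ 2 = f + C c * e ^+ 2 by rewrite -rel_Z subrK.
  by rewrite /f /C; subfield_mem sA.
by move=> r; rewrite !inE => /or4P[] /eqP ->.
Qed.

Lemma w_neq_const k : w != C k.
Proof.
apply/eqP => wk; apply: (@not_acl1 t e); last by apply: acl_mem; rewrite !inE eqxx orbT.
by split; [rewrite wk; exact: acl_const | apply: acl_mem; rewrite !inE eqxx].
Qed.

Lemma t_neq0 : t != 0.
Proof.
apply/eqP => t0; apply: (@not_acl1 w e); last by apply: acl_mem; rewrite !inE eqxx orbT.
split; first by apply: acl_mem; rewrite !inE eqxx.
by rewrite t0 -(rmorph0 iota); exact: acl_const.
Qed.

(** For a, b or abc a square, one of three ways to write f as a difference of squares gives P^2 - c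
    (k Q)^2. For c a square, Z^2 - c e^2 factors. For ab, ac or bc a square, the four linear forms
    pair up over K into two quadratic factors of f. *)
Lemma rational_of_squares : square_dependent a b c -> rational iota fixed.
Proof.
have rw := rho_w; have rt := rho_t.
have rZ : rho Z = Z by apply: rho_gens; rewrite !inE eqxx !orbT.
have re : rho e = e by apply: rho_gens; rewrite !inE eqxx !orbT.
have rdiv u v : rho u = u -> rho v = v -> rho (u / v) = u / v.
  by move=> ru rv; rewrite fmorph_div ru rv.
have Cn0 k u : u != 0 -> u = k ^+ 2 -> C k != 0.
  by move=> u0 uk; rewrite fmorph_eq0; apply: contraNneq u0 => k0; rewrite uk k0 expr0n.
have sq u k : u = k ^+ 2 -> C u = C k ^+ 2 by move=> ->; rewrite /C rmorphXn.
have CM u v : C (u * v) = C u * C v by rewrite /C rmorphM.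
have wt : [/\ gen [:: w; t] w & gen [:: w; t] t].
  by split; apply: gen_mem; rewrite !inE eqxx ?orbT.
case: wt => gw gt; have sG := gen_subfield iota [:: w; t].
have ga := @gen_const _ _ iota [:: w; t] a; have gb := @gen_const _ _ iota [:: w; t] b.
have gc := @gen_const _ _ iota [:: w; t] c.
case=> [[k /sq kE]|[[k /sq kE]|[[k kE]|[[k kE]|[[k kE]|[[k kE]|[k kE]]]]]]].
- apply: (@rational_isotropic k (t ^+ 2 + C a * C c * w ^+ 2 - C b * C c) (2%:R * w * t)).
  + by rewrite /C; subfield_mem sG.
  + by subfield_mem sG.
  + by rewrite -kE /f; ring.
- apply: (@rational_isotropic k (t ^+ 2 + C b * C c - C a * C c * w ^+ 2) (2%:R * t)).
  + by rewrite /C; subfield_mem sG.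
  + by subfield_mem sG.
  + by rewrite -kE /f; ring.
- have k0 := Cn0 _ _ c0 kE; move/sq: kE => kE.
  have fact : (Z - C k * e) * (Z + C k * e) = f by rewrite -rel_Z kE; ring.
  have n0 : Z - C k * e != 0.
    by apply: contraNneq f_neq0 => h; rewrite -fact h mul0r.
  apply: (@fixed_rational [:: Z - C k * e; w; t]) => // [v|].
    rewrite !inE => /or3P[] /eqP -> //.
    by rewrite [rho (Z - _)]rmorphB [rho (C k * e)]rmorphM rZ re /C rhoK.
  pose l3 := [:: Z - C k * e; w; t]; have sG3 := gen_subfield iota l3.
  have g1 : gen l3 (Z - C k * e) by apply: gen_mem; rewrite !inE eqxx.
  have g2 : gen l3 w by apply: gen_mem; rewrite !inE eqxx orbT.
  have g3 : gen l3 t by apply: gen_mem; rewrite !inE eqxx !orbT.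
  have g4 := @gen_const _ _ iota l3 a; have g5 := @gen_const _ _ iota l3 b.
  have g6 := @gen_const _ _ iota l3 c; have g7 := @gen_const _ _ iota l3 k.
  have g8 : gen l3 (Z + C k * e).
    by rewrite -(mulKf n0 (Z + C k * e)) fact /f; subfield_mem sG3.
  have g9 : gen l3 Z.
    have -> : Z = ((Z - C k * e) + (Z + C k * e)) / 2%:R by move: Z e => Z1 e1; field.
    by apply: (subM sG3); [apply: (subD sG3) | subfield_mem sG3].
  have g10 : gen l3 e.
    have -> : e = ((Z + C k * e) - (Z - C k * e)) / (2%:R * C k).
      by move: Z e => Z1 e1; field; rewrite two0 k0.
    apply: (subM sG3); last by rewrite /C; subfield_mem sG3.
    by apply: (subD sG3) => //; apply: (subN sG3).
  by move=> v; rewrite !inE => /or4P[] /eqP ->.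
(* ab = k^2: f is the product of t^2 - ac (w + k/a)^2 and t^2 - ac (w - k/a)^2, to be divided by the
   squares of w + k/a and w - k/a. *)
- have k0 := Cn0 _ _ (mulf_neq0 a0 b0) kE; move/sq: kE; rewrite CM => kE.
  pose w1 := w + C k / C a; pose w2 := w - C k / C a.
  have w10 : w1 != 0.
    rewrite /w1 addr_eq0 /C -fmorph_div -rmorphN; exact: w_neq_const.
  have w20 : w2 != 0.
    rewrite /w2 subr_eq0 /C -fmorph_div; exact: w_neq_const.
  have t0 := t_neq0; have bE : C b = C k ^+ 2 / C a by rewrite -kE mulrC mulKf.
  apply: (@rational_product (a * c) (t / w1) (t / w2) (Z / (w1 * w2)) (e / (w1 * w2))).
  + have rw1 : rho w1 = w1 by rewrite /w1 [LHS]rmorphD [rho (C k / _)]fmorph_div rw /C !rhoK.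
    have rw2 : rho w2 = w2 by rewrite /w2 [LHS]rmorphB [rho (C k / _)]fmorph_div rw /C !rhoK.
    have rww : rho (w1 * w2) = w1 * w2 by rewrite [LHS]rmorphM rw1 rw2.
    by split; exact: rdiv.
  + pose l5 := [:: t / w1; t / w2; Z / (w1 * w2); e / (w1 * w2)].
    have sG5 := gen_subfield iota l5.
    have g1 : gen l5 (t / w1) by apply: gen_mem; rewrite !inE eqxx.
    have g2 : gen l5 (t / w2) by apply: gen_mem; rewrite !inE eqxx orbT.
    have g3 : gen l5 (Z / (w1 * w2)) by apply: gen_mem; rewrite !inE eqxx !orbT.
    have g4 : gen l5 (e / (w1 * w2)) by apply: gen_mem; rewrite !inE eqxx !orbT.
    have g5 := @gen_const _ _ iota l5 a; have g6 := @gen_const _ _ iota l5 k.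
    have tE : t = 2%:R * C k / (C a * ((t / w1)^-1 - (t / w2)^-1)).
      have d : (t / w1)^-1 - (t / w2)^-1 = 2%:R * C k / (C a * t).
        by rewrite !(invf_div t) /w1 /w2; field; rewrite Ca0 t0.
      by rewrite d; field; rewrite Ca0 t0 two0 k0.
    have gt5 : gen l5 t.
      rewrite tE; apply: (subM sG5); first by rewrite /C; subfield_mem sG5.
      apply: (subV sG5); apply: (subM sG5) => //.
      by apply: (subD sG5); [apply: (subV sG5) | apply: (subN sG5); apply: (subV sG5)].
    have gw1 : gen l5 w1.
      have -> : w1 = t / (t / w1) by rewrite (invf_div t) mulrCA mulfV // mulr1.
      by apply: (subM sG5) => //; apply: (subV sG5).
    have gw2 : gen l5 w2.
      have -> : w2 = t / (t / w2) by rewrite (invf_div t) mulrCA mulfV // mulr1.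
      by apply: (subM sG5) => //; apply: (subV sG5).
    have gw5 : gen l5 w.
      have -> : w = w1 - C k / C a by rewrite /w1 addrK.
      by apply: (subD sG5) => //; rewrite /C; subfield_mem sG5.
    have gww : gen l5 (w1 * w2) by apply: (subM sG5).
    have ww0 : w1 * w2 != 0 by rewrite mulf_neq0.
    have gZ : gen l5 Z by rewrite -(divfK ww0 Z); apply: (subM sG5).
    have ge : gen l5 e by rewrite -(divfK ww0 e); apply: (subM sG5).
    by move=> v; rewrite !inE => /or4P[] /eqP ->.
  + have fE : f = (t ^+ 2 - C a * C c * w1 ^+ 2) * (t ^+ 2 - C a * C c * w2 ^+ 2).
      by rewrite /f /w1 /w2 bE; field.
    have -> : (Z / (w1 * w2)) ^+ 2 - C c * (e / (w1 * w2)) ^+ 2 = f / (w1 * w2) ^+ 2.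
      rewrite -rel_Z; have := mulf_neq0 w10 w20; move: (w1 * w2) Z e => W Z1 e1 W0.
      by field.
    rewrite fE CM; clear fE; move: w1 w2 w10 w20 t => u1 u2 u10 u20 t1.
    by field; rewrite u10 u20.
(* ac = k^2: f = ((t - k w)^2 - bc)((t + k w)^2 - bc). *)
- have k0 := Cn0 _ _ (mulf_neq0 a0 c0) kE; move/sq: kE; rewrite CM => kE.
  apply: (@rational_product (b * c) (t - C k * w) (t + C k * w) Z e) => //.
  + split=> //.
      by rewrite [LHS]rmorphB [rho (C k * w)]rmorphM rt rw /C rhoK.
    by rewrite [LHS]rmorphD [rho (C k * w)]rmorphM rt rw /C rhoK.
  + pose l5 := [:: t - C k * w; t + C k * w; Z; e]; have sG5 := gen_subfield iota l5.
    have g1 : gen l5 (t - C k * w) by apply: gen_mem; rewrite !inE eqxx.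
    have g2 : gen l5 (t + C k * w) by apply: gen_mem; rewrite !inE eqxx orbT.
    have g3 : gen l5 Z by apply: gen_mem; rewrite !inE eqxx !orbT.
    have g4 : gen l5 e by apply: gen_mem; rewrite !inE eqxx !orbT.
    have g6 := @gen_const _ _ iota l5 k.
    have gw5 : gen l5 w.
      have -> : w = ((t + C k * w) - (t - C k * w)) / (2%:R * C k).
        by move: t w => t1 w1; field; rewrite two0 k0.
      apply: (subM sG5); last by rewrite /C; subfield_mem sG5.
      by apply: (subD sG5) => //; apply: (subN sG5).
    have gt5 : gen l5 t.
      have -> : t = ((t - C k * w) + (t + C k * w)) / 2%:R by move: t w => t1 w1; field.
      by apply: (subM sG5); [apply: (subD sG5) | subfield_mem sG5].
    by move=> v; rewrite !inE => /or4P[] /eqP ->.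
  + by rewrite rel_Z /f CM; have := kE; move: t w => t1 w1 kE'; ring: kE'.
(* bc = k^2: f = ((t - k)^2 - ac w^2)((t + k)^2 - ac w^2), to be divided by w^4. *)
- have k0 := Cn0 _ _ (mulf_neq0 b0 c0) kE; move/sq: kE; rewrite CM => kE.
  apply: (@rational_product (a * c) ((t - C k) / w) ((t + C k) / w) (Z / w ^+ 2) (e / w ^+ 2)).
  + have rw2 : rho (w ^+ 2) = w ^+ 2 by rewrite [LHS]rmorphXn rw.
    by split; apply: rdiv => //; [rewrite [LHS]rmorphB | rewrite [LHS]rmorphD]; rewrite rt /C rhoK.
  + pose l5 := [:: (t - C k) / w; (t + C k) / w; Z / w ^+ 2; e / w ^+ 2].
    have sG5 := gen_subfield iota l5.
    have g1 : gen l5 ((t - C k) / w) by apply: gen_mem; rewrite !inE eqxx.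
    have g2 : gen l5 ((t + C k) / w) by apply: gen_mem; rewrite !inE eqxx orbT.
    have g3 : gen l5 (Z / w ^+ 2) by apply: gen_mem; rewrite !inE eqxx !orbT.
    have g4 : gen l5 (e / w ^+ 2) by apply: gen_mem; rewrite !inE eqxx !orbT.
    have g6 := @gen_const _ _ iota l5 k.
    have gw5 : gen l5 w.
      have -> : w = 2%:R * C k / ((t + C k) / w - (t - C k) / w).
        rewrite -mulrBl; have -> : t + C k - (t - C k) = 2%:R * C k by ring.
        by rewrite invf_div mulrCA mulfV ?mulr1 // mulf_neq0.
      apply: (subM sG5); first by rewrite /C; subfield_mem sG5.
      by apply: (subV sG5); apply: (subD sG5) => //; apply: (subN sG5).
    have gw2 : gen l5 (w ^+ 2) by apply: (subX sG5).
    have w20 : w ^+ 2 != 0 by rewrite expf_neq0.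
    have gt5 : gen l5 t.
      have -> : t = (t - C k) / w * w + C k by rewrite divfK // subrK.
      by apply: (subD sG5) => //; apply: (subM sG5).
    have gZ : gen l5 Z by rewrite -(divfK w20 Z); apply: (subM sG5).
    have ge : gen l5 e by rewrite -(divfK w20 e); apply: (subM sG5).
    by move=> v; rewrite !inE => /or4P[] /eqP ->.
  + have -> : (Z / w ^+ 2) ^+ 2 - C c * (e / w ^+ 2) ^+ 2 = f / (w ^+ 2) ^+ 2.
      rewrite -rel_Z; have := w0; move: w Z e => W Z1 e1 W0.
      by field.
    have fE : f = ((t - C k) ^+ 2 - C a * C c * w ^+ 2) * ((t + C k) ^+ 2 - C a * C c * w ^+ 2).
      by rewrite /f; have := kE; move: t w => t1 w1 kE'; ring: kE'.
    rewrite fE CM; clear fE; have := w0; move: w t => w1 t1 w10.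
    by field.
- have k0 : C k != 0 by apply: Cn0 kE; rewrite !mulf_neq0.
  move/sq: kE; rewrite !CM => kE.
  apply: (@rational_isotropic k (t ^+ 2 - C b * C c - C a * C c * w ^+ 2) (2%:R * w)).
  + by rewrite /C; subfield_mem sG.
  + by subfield_mem sG.
  + by rewrite -kE /f; ring.
Qed.

Hypothesis squareF : forall k, is_square (iota k) -> is_square k.

(** * The obstruction to rationality *)

Section Obstruction.

(* [A] and [B] are variables so that rewriting leaves the type of [M] and [Om] alone. *)
Variables (A B : K).
Hypotheses (AE : A = a * c) (BE : B = b * c).
Variables (M : triquad A B c) (Om : triquad (iota A) (iota B) (iota c)).
Variable mu : {rmorphism tq M -> tq Om}.
Hypothesis muP : [/\ forall u, mu (tq_in M u) = tq_in Om (iota u), mu (tq_A M) = tq_A Om,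
      mu (tq_B M) = tq_B Om & mu (tq_C M) = tq_C Om].

Local Notation j := (tq_in Om).
Local Notation jiota := (comp_iota iota j).
Local Notation aclj := (acl_in jiota).
Local Notation rA := (tq_A Om).
Local Notation rB := (tq_B Om).
Local Notation rC := (tq_C Om).

Lemma rA2 : rA ^+ 2 = j (C a * C c).
Proof. by rewrite tq_sqA; congr (tq_in _ _); rewrite AE rmorphM. Qed.

Lemma rB2 : rB ^+ 2 = j (C b * C c).
Proof. by rewrite tq_sqB; congr (tq_in _ _); rewrite BE rmorphM. Qed.

Lemma rC2 : rC ^+ 2 = j (C c). Proof. exact: tq_sqC. Qed.

Lemma f_gen : gen l4 f.
Proof.
have sG := gen_subfield iota l4; have Gl4 := @gen_mem _ _ iota l4.
have Gw := mem_w Gl4; have Gt := mem_t Gl4.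
have Ga := @gen_const _ _ iota l4 a; have Gb := @gen_const _ _ iota l4 b.
by have Gc := @gen_const _ _ iota l4 c; rewrite /f /C; subfield_mem sG.
Qed.

(** Each s != 0 negates one of sqrt(ac), sqrt(bc), sqrt c, and f is a norm form for each of these
    roots. Hence f is [normlike] in M(l), and [tower] applies. *)
Lemma f_norm l : indep iota l -> (forall v, v \in l4 -> gen l v) ->
  exists la (g h : tq Om), j f = mu la * gnorm g * h ^+ 2 /\
    forall P : tq Om -> Prop, is_subfield P -> (forall m, P (mu m)) ->
      (forall u, u \in l -> P (j u)) -> P g /\ P h.
Proof.
move=> il gl.
have [R [ph [nu [[eph phnu] phl _ phmin phnorm]]]] := tower muP il.
have [mui muA muB muC] := muP.
have lift u : gen l4 u -> exists r, ph r = j u.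
  move=> gu; have {}gu : gen l u by apply: gen_sub gu.
  apply: (@gen_min _ _ iota l (fun u => exists r, ph r = j u)) gu => //.
    split; first by exists 1; rewrite !rmorph1.
      by move=> u1 v1 [r1 e1] [r2 e2]; exists (r1 - r2); rewrite !rmorphB e1 e2.
    by move=> u1 v1 [r1 e1] [r2 e2]; exists (r1 / r2); rewrite !fmorph_div e1 e2.
  by move=> k; exists (nu (tq_in M k)); rewrite phnu mui.
have sG := gen_subfield iota l4; have Gl4 := @gen_mem _ _ iota l4.
have Gw := mem_w Gl4; have Gt := mem_t Gl4.
have GZ : gen l4 Z by apply: Gl4; rewrite !inE eqxx !orbT.
have Ge : gen l4 e by apply: Gl4; rewrite !inE eqxx !orbT.
have Ga := @gen_const _ _ iota l4 a; have Gb := @gen_const _ _ iota l4 b.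
have Gc := @gen_const _ _ iota l4 c.
have [D DE] := lift _ f_gen.
have nrm (s' : G8) (m : tq M) (r d : tq Om) P Q : mu m = r -> r ^+ 2 = d ->
    gact s' r = - r -> gen l4 P -> gen l4 Q -> j f = j P ^+ 2 - d * j Q ^+ 2 ->
    exists al, D = al * gact s' al.
  move=> mr r2 sr /lift[rP PE] /lift[rQ QE] fE.
  exists (rP + nu m * rQ); apply: (fmorph_inj ph).
  rewrite DE fE -r2 rmorphM eph !(rmorphD, rmorphM) phnu mr PE QE sr !tq_act.
  ring.
have nD : normlike D.
  move=> s' s0.
  have [i si] : exists i, chi i s'.
    apply: NNPP => H; case/eqP: s0; apply/rowP => i; rewrite mxE.
    by apply/eqP/negPn/negP => si; apply: H; exists i.
  have i3 : [\/ i = 0, i = 1 | i = 2].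
    by case: i {si} => [[|[|[|?]]] //= h]; [constructor 1|constructor 2|constructor 3]; apply: val_inj.
  case: i3 si => -> si.
  - apply: (@nrm s' (tq_A M) rA (j (C a * C c)) (t ^+ 2 + C a * C c * w ^+ 2 - C b * C c) (2%:R * w * t)) => //.
    + exact: rA2.
    + by rewrite tq_actA si expr1 mulN1r.
    + by rewrite /C; subfield_mem sG.
    + by subfield_mem sG.
    + by rewrite -!rmorphXn -rmorphM -rmorphB; congr (j _); rewrite /f; ring.
  - apply: (@nrm s' (tq_B M) rB (j (C b * C c)) (t ^+ 2 + C b * C c - C a * C c * w ^+ 2) (2%:R * t)) => //.
    + exact: rB2.
    + by rewrite tq_actB si expr1 mulN1r.
    + by rewrite /C; subfield_mem sG.
    + by subfield_mem sG.
    + by rewrite -!rmorphXn -rmorphM -rmorphB; congr (j _); rewrite /f; ring.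
  - apply: (@nrm s' (tq_C M) rC (j (C c)) Z e) => //.
    + exact: rC2.
    + by rewrite tq_actC si expr1 mulN1r.
    + by rewrite -!rmorphXn -rmorphM -rmorphB -rel_Z.
have D0 : D != 0.
  by rewrite -(fmorph_eq0 ph) DE fmorph_eq0 f_neq0.
have [la [g [h gE]]] := phnorm D D0 nD.
exists la, (ph g), (ph h); split.
  rewrite -DE gE [LHS]rmorphM [ph (h ^+ 2)]rmorphXn [ph (nu la * _)]rmorphM phnu.
  by rewrite (gnorm_morph g eph).
by move=> P sP Pm Pl; split; apply: phmin.
Qed.

Lemma indep_tw : indep iota [:: t; w].
Proof.
split; last split=> //.
  move=> at_; apply: (@not_acl1 w e); last by apply: acl_mem; rewrite !inE eqxx orbT.
  split; first by apply: acl_mem; rewrite !inE eqxx.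
  by apply: acl_sub at_ => v; rewrite !inE => ->.
move=> aw; apply: (@not_acl1 t e); last by apply: acl_mem; rewrite !inE eqxx orbT.
split; last by apply: acl_mem; rewrite !inE eqxx.
by apply: acl_sub aw.
Qed.

(** Once sqrt c is available, Z^2 - c e^2 = f factors as zeta times its conjugate f / zeta. Thus
    zeta replaces both Z and e as a free variable over M(w, t). *)
Definition zeta : tq Om := j Z + rC * j e.
Local Notation R1 := (ext (tq M)).
Local Notation R2 := (ext R1).

Lemma jf_neq0 : j f != 0. Proof. by rewrite fmorph_eq0 f_neq0. Qed.

Lemma zeta_conj : zeta * (j Z - rC * j e) = j f.
Proof.
have -> : j f = j Z ^+ 2 - rC ^+ 2 * j e ^+ 2.
  by rewrite rC2 -!rmorphXn -rmorphM -rmorphB rel_Z.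
by rewrite /zeta; ring.
Qed.

Lemma zeta_neq0 : zeta != 0.
Proof. by apply: contraNneq jf_neq0 => z1; rewrite -zeta_conj z1 mul0r. Qed.

Lemma zeta_bar : j Z - rC * j e = j f / zeta.
Proof. by rewrite -zeta_conj [RHS]mulrC mulKf ?zeta_neq0. Qed.

Lemma act_zeta s' : gact s' zeta = if chi 2 s' then j f / zeta else zeta.
Proof.
rewrite -zeta_bar {1}/zeta rmorphD rmorphM !tq_act tq_actC.
by case: (chi 2 s'); rewrite ?expr1 ?expr0 ?mulN1r ?mulNr ?mul1r.
Qed.

Lemma rC_neq0 : rC != 0.
Proof. by rewrite -sqrf_eq0 rC2 fmorph_eq0 Cc0. Qed.

Let twoOm : (2%:R : tq Om) != 0.
Proof. by rewrite -(rmorph_nat j) fmorph_eq0. Qed.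

Lemma jZe : j Z = (zeta + j f / zeta) / 2%:R /\ j e = (zeta - j f / zeta) / (2%:R * rC).
Proof.
by rewrite -zeta_bar; apply: conj_components; [exact: twoOm | exact: rC_neq0].
Qed.

Lemma zeta_not_acl : ~ aclj (map j [:: t; w]) zeta.
Proof.
set l := map j _ => az; have sA := acl_subfield jiota l.
have af : aclj l (j f).
  have jf : gen [:: t; w] f.
    have sG := gen_subfield iota [:: t; w].
    have Gw : gen [:: t; w] w by apply: gen_mem; rewrite !inE eqxx orbT.
    have Gt : gen [:: t; w] t by apply: gen_mem; rewrite !inE eqxx.
    have Ga := @gen_const _ _ iota [:: t; w] a; have Gb := @gen_const _ _ iota [:: t; w] b.
    by have Gc := @gen_const _ _ iota [:: t; w] c; rewrite /f /C; subfield_mem sG.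
  apply: (@gen_min _ _ iota [:: t; w] (fun u => aclj l (j u))) jf.
  - have [A1 AB AD] := sA; split; first by rewrite rmorph1.
      by move=> u v au av; rewrite rmorphB; exact: AB.
    by move=> u v au av; rewrite fmorph_div; exact: AD.
  - by move=> k; exact: (@acl_const _ _ jiota l k).
  - by move=> v vl; apply: acl_mem; exact: map_f.
have [_ _ aC] := @acl_roots _ _ iota A B c Om l; have [ZE eE] := jZe.
have aZ : aclj l (j Z) by rewrite ZE; subfield_mem sA.
have ae : aclj l (j e) by rewrite eE; subfield_mem sA.
apply: (@not_two_gens t w) => v; rewrite !inE => /or4P[] /eqP ->.
- by apply: acl_mem; rewrite !inE eqxx orbT.
- by apply: acl_mem; rewrite !inE eqxx.
- exact: acl_transfer aZ.
- exact: acl_transfer ae.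
Qed.

Lemma mu_acl0 : forall m, aclj [::] (mu m).
Proof. by move=> m; exact: acl_mu. Qed.

Lemma trans_w : transcendental_over mu (j w).
Proof.
apply: (transcendental_acl mu_acl0) => aw.
by have [_ [nw _]] := indep_tw; apply: nw; apply: (@acl_transfer _ _ _ iota j).
Qed.

Local Notation phi1 := (ext_eval trans_w).

Lemma phi1_acl : forall u, aclj [:: j w] (phi1 u).
Proof. exact: acl_ext_eval mu_acl0. Qed.

Lemma trans_t : transcendental_over phi1 (j t).
Proof.
apply: (transcendental_acl phi1_acl) => at_.
by have [nt _] := indep_tw; apply: nt; apply: (@acl_transfer _ _ _ iota j).
Qed.

Local Notation phi2 := (ext_eval trans_t).

Lemma phi2_acl : forall u, aclj [:: j t; j w] (phi2 u).
Proof. exact: acl_ext_eval phi1_acl. Qed.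

Lemma trans_zeta : transcendental_over phi2 zeta.
Proof. by apply: (transcendental_acl phi2_acl); exact: zeta_not_acl. Qed.

Local Notation phi3 := (ext_eval trans_zeta).

Lemma phi2_equivariant : equivariant phi2.
Proof.
apply: ext_eval_equivariant; last by move=> s'; rewrite tq_act.
apply: ext_eval_equivariant; last by move=> s'; rewrite tq_act.
exact: (mu_equivariant muP).
Qed.

Let rB1 : R1 := extC (tq M) (tq_B M).
Let rAW : R1 := extC (tq M) (tq_A M) * extP 'X.
(** The root in t of one linear factor of f. It involves sqrt(ac) and sqrt(bc) only, so [chi_elt 2],
    which negates sqrt c alone, fixes it. This is why M is generated by sqrt(ac), sqrt(bc), sqrt c
    rather than by the roots of a, b, c. *)
Definition line_root : R1 := rB1 + rAW.

Definition fR : R2 :=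
  extP (\prod_(u <- [:: line_root; - line_root; rB1 - rAW; rAW - rB1]) ('X - u%:P)).

Lemma phi2_fR : phi2 fR = j f.
Proof.
have [mui muA muB muC] := muP.
have eB : phi1 rB1 = rB by rewrite ext_eval_extC muB.
have eA : phi1 rAW = rA * j w by rewrite rmorphM ext_eval_extC muA ext_evalX.
have eL : phi1 line_root = rB + rA * j w by rewrite [LHS]rmorphD eB eA.
have eL' : phi1 (rB1 - rAW) = rB - rA * j w by rewrite [LHS]rmorphB eB eA.
have eL'' : phi1 (rAW - rB1) = rA * j w - rB by rewrite [LHS]rmorphB eB eA.
have eN : phi1 (- line_root) = - (rB + rA * j w) by rewrite [LHS]rmorphN eL.
have jfE : j f = (j t ^+ 2 - rB ^+ 2 - (rA * j w) ^+ 2) ^+ 2 -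
    4%:R * (rA * j w) ^+ 2 * rB ^+ 2.
  rewrite exprMn rA2 rB2 -(rmorph_nat j) -!rmorphXn -!rmorphM -!rmorphB -rmorphXn -rmorphB.
  by congr (j _); rewrite /f; ring.
have ev us : (map_poly phi1 (\prod_(u <- us) ('X - u%:P))).[j t] = \prod_(u <- us) (j t - phi1 u).
  rewrite rmorph_prod horner_prod; apply: eq_bigr => u _.
  by rewrite rmorphB /= map_polyX map_polyC hornerD hornerN hornerX hornerC.
rewrite jfE -four_lines ext_eval_extP ev !big_cons big_nil mulr1.
by rewrite eL eL' eL'' eN.
Qed.

Lemma fR_fixed s' : gact s' fR = fR.
Proof. by apply: (fmorph_inj phi2); rewrite phi2_equivariant phi2_fR tq_act. Qed.

Lemma fR_neq0 : fR != 0.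
Proof. by rewrite -(fmorph_eq0 phi2) phi2_fR jf_neq0. Qed.

Lemma line_root_val : root_val line_root fR = 1.
Proof.
have twoR : (2%:R : R1) != 0.
  by rewrite -(fmorph_eq0 phi1) rmorph_nat twoOm.
have rA0 : tq_A M != 0.
  rewrite -sqrf_eq0 tq_sqA fmorph_eq0 AE; exact: mulf_neq0.
have rB0 : tq_B M != 0.
  rewrite -sqrf_eq0 tq_sqB fmorph_eq0 BE; exact: mulf_neq0.
have rB10 : rB1 != 0 by rewrite fmorph_eq0.
have rAW0 : rAW != 0 by rewrite mulf_neq0 ?fmorph_eq0 // extP_eq0 polyX_eq0.
have lr0 : line_root != 0.
  have -> : line_root = extP ((tq_B M)%:P + tq_A M *: 'X).
    by rewrite rmorphD -mul_polyC rmorphM.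
  rewrite extP_eq0; apply/eqP => /(congr1 (fun p : {poly tq M} => p`_1)).
  by rewrite coefD coefC coefZ coefX /= mulr1 add0r coef0 => /eqP; rewrite (negbTE rA0).
rewrite root_val_extP; last by apply: monic_neq0; exact: monic_prod_XsubC.
rewrite mu_prod_XsubC /= eqxx.
have n1 : (- line_root == line_root) = false.
  apply/negbTE; rewrite eq_sym -addr_eq0 -mulr2n -mulr_natl mulf_eq0 negb_or twoR.
  exact: lr0.
have n2 : (rB1 - rAW == line_root) = false.
  apply/negbTE; rewrite eq_sym -subr_eq0 /line_root.
  have -> : rB1 + rAW - (rB1 - rAW) = 2%:R * rAW by ring.
  by rewrite mulf_neq0.
have n3 : (rAW - rB1 == line_root) = false.
  apply/negbTE; rewrite eq_sym -subr_eq0 /line_root.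
  have -> : rB1 + rAW - (rAW - rB1) = 2%:R * rB1 by ring.
  by rewrite mulf_neq0.
by rewrite n1 n2 n3.
Qed.

Lemma line_root_fixed : gact (chi_elt 2) line_root = line_root.
Proof.
rewrite /line_root rmorphD rmorphM !act_extC act_extP map_polyX tq_actA tq_actB.
by rewrite !chi_eltE /= !expr0 !mul1r.
Qed.

Local Notation theta p := (phi3 (extP p)).
Local Notation tN := (tnorm fR (chi 2)).
Local Notation tA := (tact fR (chi 2)).

(** Replacing zeta by f / zeta in p gives the reversed polynomial divided by zeta^(deg p). *)
Lemma act_theta s' p : gact s' (theta p) =
  theta (tA s' p) * phi3 (if chi 2 s' then (extP 'X)^-1 ^+ (size p).-1 else 1).
Proof.
rewrite !ext_eval_extP -horner_map act_zeta -map_poly_comp.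
have -> : map_poly (gact s' \o phi2) p = map_poly phi2 (map_poly (gact s') p).
  by rewrite -map_poly_comp; apply: eq_map_poly => u /=; rewrite phi2_equivariant.
rewrite /tact; case: ifP => _; last by rewrite rmorph1 mulr1.
rewrite reverse_eval ?zeta_neq0 // phi2_fR size_map_poly.
rewrite rmorphXn fmorphV ext_evalX [RHS]mulrAC -exprMn mulfV ?zeta_neq0 //.
by rewrite expr1n mul1r.
Qed.

Lemma tw_halving : halving (chi_elt 0) (fun r => ~~ chi 0 r).
Proof. by move=> r; rewrite chiD chi_eltE. Qed.

(** Translation by [chi_elt 0] pairs off the elements with a given value of [chi 2], so powers of
    zeta and f that come from these elements only contribute squares. *)
Lemma prod_tw_square (b' : bool) (R : comNzRingType) (u : R) :
  exists m, \prod_(s' : G8 | chi 2 s' == b') u = (u ^+ m) ^+ 2.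
Proof.
exists #|[pred s' : G8 | (chi 2 s' == b') && ~~ chi 0 s']|.
rewrite (@big_halving _ _ _ _ (chi_elt 0) (fun r => ~~ chi 0 r)) /=.
- by rewrite !prodr_const expr2.
- exact: tw_halving.
- by move=> r; rewrite chiD chi_eltE.
Qed.

Lemma gnorm_theta p : exists2 q, q != 0 & gnorm (theta p) = theta (tN p) * phi3 q ^+ 2.
Proof.
have [m mE] := prod_tw_square true ((extP 'X : ext R2)^-1 ^+ (size p).-1).
exists ((extP 'X)^-1 ^+ (size p).-1 ^+ m).
  by rewrite !expf_neq0 // invr_neq0 // extP_eq0 polyX_eq0.
rewrite /gnorm (eq_bigr _ (fun s' _ => act_theta s' p)) big_split /=.
rewrite /tnorm -!rmorph_prod; congr (_ * _); rewrite -rmorphXn; congr (phi3 _).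
rewrite -mE [RHS]big_mkcond /=; apply: eq_bigr => s' _.
by rewrite eqb_id.
Qed.

Lemma tnorm_X : exists2 q : {poly R2}, q != 0 & tN 'X = q ^+ 2.
Proof.
have [m1 e1] := prod_tw_square true (fR%:P : {poly R2}).
have [m2 e2] := prod_tw_square false ('X : {poly R2}).
exists (fR%:P ^+ m1 * 'X ^+ m2).
  by rewrite mulf_neq0 // expf_neq0 ?polyC_eq0 ?fR_neq0 ?polyX_eq0.
rewrite exprMn -e1 -e2 /tnorm (bigID (chi 2)) /=; congr (_ * _).
  apply: eq_big => [s'|s' tws]; first by rewrite eqb_id.
  rewrite /tact tws map_polyX; apply/polyP => i.
  rewrite /reverse size_polyX coef_poly coefC coefX.
  by case: i => [|[|i]] //=; rewrite ?mul1r ?mul0r ?expr1 // subnn ?mul0r.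
apply: eq_big => [s'|s' ntws]; first by rewrite eqbF_neg.
by rewrite /tact (negbTE ntws) map_polyX.
Qed.

(** M(w, t, zeta) contains the whole fixed field: Z and e are recovered from zeta and f / zeta. *)
Lemma phi3_image (P : F) : gen l4 P -> exists u, phi3 u = j P.
Proof.
move=> gP; have [mui muA muB muC] := muP.
have in2 (u : R2) : exists v, phi3 v = phi2 u by exists (extC R2 u); rewrite ext_eval_extC.
have in1 (u : R1) : exists v, phi3 v = phi1 u.
  by have [v vE] := in2 (extC R1 u); exists v; rewrite vE ext_eval_extC.
have in0 (u : tq M) : exists v, phi3 v = mu u.
  by have [v vE] := in1 (extC _ u); exists v; rewrite vE ext_eval_extC.
pose Im v := exists u, phi3 u = v.
have sI : is_subfield Im.
  split; first by exists 1; rewrite rmorph1.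
    by move=> _ _ [u <-] [v <-]; exists (u - v); rewrite rmorphB.
  by move=> _ _ [u <-] [v <-]; exists (u / v); rewrite fmorph_div.
have Iz : Im zeta by exists (extP 'X); rewrite ext_evalX.
have If : Im (j f) by have [v vE] := in2 fR; exists v; rewrite vE phi2_fR.
have IC : Im rC by have [v vE] := in0 (tq_C M); exists v; rewrite vE muC.
have It : Im (j t) by have [v vE] := in2 (extP 'X); exists v; rewrite vE ext_evalX.
have Iw : Im (j w) by have [v vE] := in1 (extP 'X); exists v; rewrite vE ext_evalX.
have [ZE eE] := jZe.
apply: (@gen_min _ _ iota l4 (fun u => Im (j u))) gP.
- split; first by rewrite rmorph1; case: sI.
    by move=> u v au av; rewrite rmorphB; case: sI => _ IB _; exact: IB.
  by move=> u v au av; rewrite fmorph_div; case: sI => _ _ ID; exact: ID.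
- by move=> k; have [v vE] := in0 (tq_in M k); exists v; rewrite vE mui.
- move=> v; rewrite !inE => /or4P[] /eqP -> //; rewrite ?ZE ?eE; subfield_mem sI.
Qed.

Lemma not_rational_obstruction : ~ rational iota fixed.
Proof.
case=> S [iS ES].
have [mui muA muB muC] := muP.
(* A transcendence basis [S] may be any set, but the four generators involve only finitely many of
   its elements. *)
have [l [ul lS gl]] : exists l, [/\ uniq l, forall v, v \in l -> S v & forall v, v \in l4 -> gen l v].
  have one v : generated_field iota S v -> exists2 l, (forall v, v \in l -> S v) & gen l v.
    move=> gv; apply: (gv (fun v => exists2 l, (forall v, v \in l -> S v) & gen l v)).
    - have cat l1 l2 : (forall v, v \in l1 -> S v) -> (forall v, v \in l2 -> S v) ->
          forall v, v \in l1 ++ l2 -> S v.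
        by move=> h1 h2 r; rewrite mem_cat => /orP[/h1|/h2].
      have monoL l1 l2 r : gen l1 r -> gen (l1 ++ l2) r.
        by apply: gen_sub => r' h; apply: gen_mem; rewrite mem_cat h.
      have monoR l1 l2 r : gen l2 r -> gen (l1 ++ l2) r.
        by apply: gen_sub => r' h; apply: gen_mem; rewrite mem_cat h orbT.
      split; first by exists [::] => //; case: (gen_subfield iota [::]).
        move=> u1 u2 [l1 s1 g1] [l2 s2 g2]; exists (l1 ++ l2); first exact: cat.
        by case: (gen_subfield iota (l1 ++ l2)) => _ GB _; apply: GB; [exact: monoL|exact: monoR].
      move=> u1 u2 [l1 s1 g1] [l2 s2 g2]; exists (l1 ++ l2); first exact: cat.
      by case: (gen_subfield iota (l1 ++ l2)) => _ _ GD; apply: GD; [exact: monoL|exact: monoR].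
    - by move=> k; exists [::] => //; exact: gen_const.
    - by move=> s1 Ss; exists [:: s1] => [r|]; [rewrite inE => /eqP -> | apply: gen_mem; rewrite mem_head].
  have all : forall l0 : seq F, (forall v, v \in l0 -> generated_field iota S v) ->
      exists2 l, (forall v, v \in l -> S v) & forall v, v \in l0 -> gen l v.
    elim=> [_|v l0 IHl H]; first by exists [::].
    have [|l1 s1 g1] := IHl; first by move=> r rl; apply: H; rewrite inE rl orbT.
    have [|l2 s2 g2] := one v; first by apply: H; rewrite mem_head.
    exists (l1 ++ l2) => r; first by rewrite mem_cat => /orP[/s1|/s2].
    rewrite inE => /orP[/eqP ->|/g1 g1r]; [apply: gen_sub g2 | apply: gen_sub g1r].
      by move=> r' h; apply: gen_mem; rewrite mem_cat h orbT.
    by move=> r' h; apply: gen_mem; rewrite mem_cat h.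
  have [|l sl gl] := all l4; first by move=> v vl; apply/ES; exact: rho_gens.
  exists (undup l); split; rewrite ?undup_uniq // => v; rewrite ?mem_undup; first exact: sl.
  by move/gl; apply: gen_sub => r h; apply: gen_mem; rewrite mem_undup.
have il := algebraically_independent_indep iS ul lS.
have [la [g [h [fE gh]]]] := f_norm il gl.
have [[g' gE] [h' hE]] : (exists u, phi3 u = g) /\ (exists u, phi3 u = h).
  apply: (gh (fun v => exists u, phi3 u = v)).
  - split; first by exists 1; rewrite rmorph1.
      by move=> _ _ [u <-] [v <-]; exists (u - v); rewrite rmorphB.
    by move=> _ _ [u <-] [v <-]; exists (u / v); rewrite fmorph_div.
  - move=> m; exists (extC R2 (extC R1 (extC _ m))).
    by rewrite !ext_eval_extC.
  - move=> u ul'; apply: phi3_image; apply/fixedP; apply/ES.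
    by move=> E _ _; apply; exact: lS.
have la0 : la != 0.
  by apply: contraNneq jf_neq0 => l0; rewrite fE l0 rmorph0 !mul0r.
have h0 : h' != 0.
  by apply: contraNneq jf_neq0 => h0; rewrite fE -hE h0 rmorph0 expr0n mulr0.
have g0 : g' != 0.
  apply: contraNneq jf_neq0 => g0; rewrite fE -gE g0 rmorph0 /gnorm (bigD1 0) //=.
  by rewrite rmorph0 !(mul0r, mulr0).
(* With g = n / d, the norm of g times the square of the norm of d is the norm of n d, so up to
   squares g may be taken polynomial in zeta. *)
have [n [d [n0 d0 g'E]]] := ext_split_neq0 g0.
(* The parity argument needs a nonzero constant term. The powers of zeta split off here have square
   twisted norm by [tnorm_X]. *)
have [m [p1 nzp1 ndE]] : exists m, exists2 p1 : {poly R2}, p1`_0 != 0 & n * d = p1 * 'X^m.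
  have [m [p1 rp pE]] := multiplicity_XsubC (n * d) 0.
  exists m; exists p1; last by rewrite pE subr0.
  by move: rp; rewrite mulf_neq0 //= rootE horner_coef0.
have p10 : p1 != 0 by apply: contraNneq nzp1 => ->; rewrite coef0.
have [q1 q10 e1] := gnorm_theta (n * d); have [q2 q20 e2] := gnorm_theta d.
have [q3 q30 e3] := tnorm_X.
have tNX i : tN ('X^i) = (q3 ^+ i) ^+ 2.
  elim: i => [|i IHi].
    by rewrite !expr0 expr1n /tnorm big1 // => s' _; exact: tact1.
  have X0 : 'X != 0 :> {poly R2} by rewrite polyX_eq0.
  have -> : tN ('X^(i.+1)) = tN 'X * tN ('X^i).
    by rewrite exprS (tnormM _ fR_neq0) // expf_neq0.
  by rewrite IHi e3 -exprMn -exprS.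
pose u2 := extP (tN d) * q2 ^+ 2.
have u2E : gnorm (theta d) = phi3 u2 by rewrite e2 /u2 [RHS]rmorphM [phi3 (q2 ^+ 2)]rmorphXn.
have thd0 : theta d != 0 by rewrite fmorph_eq0 extP_eq0.
have u20 : u2 != 0.
  by rewrite -(fmorph_eq0 phi3) -u2E; apply/prodf_neq0 => s' _; rewrite fmorph_eq0.
have gnE : gnorm g * phi3 u2 ^+ 2 = gnorm (theta (n * d)).
  rewrite expr2 mulrA -u2E -gnormM -gE g'E [phi3 (_ / _)]fmorph_div divfK //.
  by rewrite -gnormM -!rmorphM.
pose la2 : R2 := extC R1 (extC _ la).
pose E := extP (q3 ^+ m) * q1 * h'.
have key : extC R2 fR * u2 ^+ 2 = extC R2 la2 * extP (tN p1) * E ^+ 2.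
  apply: (fmorph_inj phi3).
  have k1 : phi3 (extC R2 fR) = j f by rewrite ext_eval_extC phi2_fR.
  have k2 : phi3 (extC R2 la2) = mu la by rewrite !ext_eval_extC.
  have k3 : phi3 E = theta (q3 ^+ m) * phi3 q1 * h by rewrite /E -hE [LHS]rmorphM [phi3 (_ * q1)]rmorphM.
  have k4 : theta (tN (n * d)) = theta (tN p1) * theta (q3 ^+ m) ^+ 2.
    rewrite ndE (tnormM _ fR_neq0) ?expf_neq0 ?polyX_eq0 // tNX.
    by rewrite [extP _]rmorphM [extP (_ ^+ 2)]rmorphXn [LHS]rmorphM [phi3 (_ ^+ 2)]rmorphXn.
  rewrite [LHS]rmorphM [phi3 (u2 ^+ 2)]rmorphXn k1 fE.
  rewrite [RHS]rmorphM [phi3 (_ * extP (tN p1))]rmorphM [phi3 (E ^+ 2)]rmorphXn k2 k3.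
  have -> : mu la * gnorm g * h ^+ 2 * phi3 u2 ^+ 2 = mu la * (gnorm g * phi3 u2 ^+ 2) * h ^+ 2.
    by move: (mu la) (gnorm g) (phi3 u2) => *; ring.
  rewrite gnE e1 k4.
  by move: (mu la) (theta (tN p1)) (theta (q3 ^+ m)) (phi3 q1) => *; ring.
have E0 : E != 0 by rewrite !mulf_neq0 // extP_eq0 expf_neq0.
have [un [ud [un0 ud0 UE]]] := ext_split_neq0 (mulf_neq0 E0 (invr_neq0 u20)).
have key2 : fR%:P * ud ^+ 2 = la2%:P * tN p1 * un ^+ 2.
  apply: extP_inj; rewrite !(rmorphM extP).
  have EE : E = extP un / extP ud * u2 by rewrite -UE divfK.
  have eud0 : extP ud != 0 by rewrite extP_eq0.
  apply: (mulIf (expf_neq0 2 u20)); rewrite [LHS]mulrAC.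
  have -> : extP fR%:P * u2 ^+ 2 = extC R2 fR * u2 ^+ 2 by [].
  rewrite key EE -[extP la2%:P]/(extC R2 la2).
  exact: mul_div_square.
(* Multiplying [key2] by f exhibits f la N(p1) un^2 as the square of f ud. *)
apply: (@tnorm_not_square _ _ fR (chi 2) G8_exp2 G8_halving fR_neq0 fR_fixed (chiD 2)
  (chi_elt 2) (root_val line_root) _ card_G8 (@root_valM _ _ line_root) _ line_root_val
  p1 la2 un (fR *: ud) nzp1 _ _ un0).
- by rewrite chi_eltE.
- by move=> u; apply: root_val_act; exact: line_root_fixed.
- by rewrite !fmorph_eq0.
- by apply: root_val_extC; rewrite fmorph_eq0.
- have -> : fR * la2 *: tN p1 * un ^+ 2 = fR%:P * (la2%:P * tN p1 * un ^+ 2).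
    by rewrite -mul_polyC polyCM !mulrA.
  by rewrite -key2 -mul_polyC exprMn; ring.
Qed.

End Obstruction.

(** Elements of K that are squares in F are squares in K, so the triquadratic extension keeps its
    full group over F. *)
Lemma not_rational_of_nonsquares : ~ square_dependent a b c -> ~ rational iota fixed.
Proof.
move=> nd; have twoK : (2%:R : K) != 0 by rewrite -(fmorph_eq0 iota) rmorph_nat.
have nd' : ~ square_dependent (a * c) (b * c) c by move/(square_dependent_twist c0).
have ndF : ~ square_dependent (iota (a * c)) (iota (b * c)) (iota c).
  rewrite /square_dependent -!rmorphM => h; apply: nd'; rewrite /square_dependent.
  by case: h => [/squareF|[/squareF|[/squareF|[/squareF|[/squareF|[/squareF|/squareF]]]]]]; tauto.
have [M] : inhabited (triquad (a * c) (b * c) c).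
  by apply: triquad_exists => //; rewrite mulf_neq0.
have [Om] : inhabited (triquad (iota (a * c)) (iota (b * c)) (iota c)).
  by apply: triquad_exists => //; rewrite fmorph_eq0 // mulf_neq0.
have [mu muP] := base_change_exists M Om.
exact: (not_rational_obstruction erefl erefl muP).
Qed.

End FixedField.

(** * Rational functions in three variables *)

Section Ratfun3.

Variable K : fieldType.
Local Notation C := (ratfun3C K).
Local Notation x := (ratfun3X K (inord 0)).
Local Notation y := (ratfun3X K (inord 1)).
Local Notation z := (ratfun3X K (inord 2)).

Lemma mmap_ratfun3 p : mmap C (@ratfun3X K) p = tofrac p.
Proof.
apply: (@mpoly_rmorph_ext _ _ _ [the {rmorphism _ -> _} of mmap C (@ratfun3X K)]
  [the {rmorphism _ -> _} of @tofrac {mpoly K[3]}]) => [k|i] /=.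
  by rewrite mmapC.
by rewrite mmapX mmap1U.
Qed.

Lemma ratfun3X_cases i : ratfun3X K i \in [:: x; y; z].
Proof.
have : i \in [:: inord 0; inord 1; inord 2 : 'I_3].
  by rewrite !inE -!val_eqE /= !inordK //; case: i => [[|[|[|?]]]].
exact: (map_f (@ratfun3X K)).
Qed.

Lemma ratfun3_indep : indep C [:: x; y; z].
Proof.
have /tuple_indepP it : tuple_indep C (@ratfun3X K).
  by move=> p; rewrite mmap_ratfun3 => /eqP; rewrite tofrac_eq0 => /eqP.
apply: (indep_spanning it) => // v /tlistP[i ->].
by apply: acl_mem; exact: ratfun3X_cases.
Qed.

Lemma ratfun3_gen u : gen C [:: x; y; z] u.
Proof.
have [n [d [_ ->]]] := fraction_split u; have [_ _ GD] := gen_subfield C [:: x; y; z].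
apply: GD; rewrite -mmap_ratfun3; apply: gen_sub (@gen_mmap _ _ C _ (@ratfun3X K) _) => v /tlistP[i ->];
  by apply: gen_mem; exact: ratfun3X_cases.
Qed.

(** Compare leading coefficients in k d^2 = n^2. *)
Lemma ratfun3_square k : is_square (C k) -> is_square k.
Proof.
case=> r; have [n [d [d0 ->]]] := fraction_split r => e.
have e1 : k%:MP * d ^+ 2 = n ^+ 2.
  apply/eqP; rewrite -tofrac_eq tofracM !tofracXn; apply/eqP.
  by rewrite -[tofrac k%:MP]/(C k) e expr_div_n divfK // expf_neq0 // tofrac_eq0.
have [->|k0] := eqVneq k 0; first by exists 0; rewrite expr0n.
exists (mleadc n / mleadc d).
have ld0 : mleadc d != 0 by rewrite mleadc_eq0.
have dd0 : d * d != 0 by rewrite mulf_neq0.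
have km0 : k%:MP_[3] != 0 by rewrite mpolyC_eq0.
have n0 : n != 0.
  have := mulf_neq0 km0 (expf_neq0 2 d0).
  by rewrite e1 expf_eq0.
have sqE (p : {mpoly K[3]}) : p != 0 -> mleadc (p * p) = mleadc p * mleadc p.
  by move=> p0; rewrite mleadcM_proper // mulf_neq0 ?mleadc_eq0.
have e2 : mleadc (k%:MP * (d * d)) = mleadc (n * n) by rewrite -!expr2 e1.
have e3 : k * (mleadc d * mleadc d) = mleadc n * mleadc n.
  have e4 : mleadc (k%:MP * (d * d)) = mleadc (k%:MP_[3]) * mleadc (d * d).
    by apply: mleadcM_proper; rewrite mulf_neq0 // mleadc_eq0.
  by rewrite -!sqE // -e2 e4 mleadcC.
by rewrite expr_div_n !expr2 -e3 mulfK // mulf_neq0.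
Qed.

Lemma fixed_by_groupE (T : Type) (rho : T -> T) u : fixed_by_group rho u <-> rho u = u.
Proof.
split=> [|ru g]; first by apply; exact: generated_group_gen.
elim=> [//|//|g1 g2 _ e1 _ e2|g1 g2 _ e1 gK _] /=; first by rewrite e2.
by rewrite -{1}e1 gK.
Qed.

Variables (a b c : K).
Hypotheses (charK : 2%N \notin [pchar K]) (a0 : a != 0) (b0 : b != 0) (c0 : c != 0).

(** Stated for arbitrary generating coordinates, so that it covers [rho] in x, y, z and [rho'] after
    a change of variables. *)
Lemma rational_fixed_iff (rho : {rmorphism ratfun3 K -> ratfun3 K}) (x' y' z' : ratfun3 K) :
  K_automorphism C rho -> indep C [:: x'; y'; z'] -> (forall u, gen C [:: x'; y'; z'] u) ->
  rho x' = - x' -> rho y' = - y' ->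
  rho z' = C c * (x' ^+ 2 - C a) * (y' ^+ 2 - C b) / z' ->
  rational C (fixed_by_group rho) <-> square_dependent a b c.
Proof.
move=> [_ rhoK] ixyz gxyz rx ry rz.
have two0 : (2%:R : ratfun3 K) != 0.
  rewrite -(rmorph_nat C) fmorph_eq0; apply: contra charK => two.
  by rewrite inE /= two.
have iff : rational C (fixed_by_group rho) <-> rational C (fixed rho).
  by split=> -[S [iS ES]]; exists S; split=> // u; rewrite -ES fixed_by_groupE.
rewrite iff; split=> [|sd].
  by move=> rat; apply: NNPP => nd; apply: (not_rational_of_nonsquares two0 a0 b0 c0 rhoK rx ry rz ixyz gxyz ratfun3_square nd rat).
exact: (rational_of_squares two0 a0 b0 c0 rhoK rx ry rz ixyz gxyz sd).
Qed.

End Ratfun3.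

(** * The two automorphisms *)

Lemma twist_identity (W : fieldType) (a b c x y z : W) : y != 0 -> z != 0 ->
  - (c * (x ^+ 2 - a * y ^+ 2) * (y ^+ 2 - b) / z) / - y =
  c * ((x / y) ^+ 2 - a) * (y ^+ 2 - b) / (z / y).
Proof. by move=> y0 z0; field; rewrite oppr_eq0 y0 z0. Qed.

Theorem theorem9 (K : fieldType) (charK : 2%N \notin [pchar K]) (a b c : K)
    (a0 : a != 0) (b0 : b != 0) (c0 : c != 0)
    (L : fieldExtType K) (sqrta sqrtb sqrtc : L)
    (sqrtaE : sqrta ^+ 2 = a%:A)
    (sqrtbE : sqrtb ^+ 2 = b%:A)
    (sqrtcE : sqrtc ^+ 2 = c%:A)
    (rho rho' : {rmorphism ratfun3 K -> ratfun3 K}) :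
  let C := ratfun3C K in
  let x := ratfun3X K (inord 0) in
  let y := ratfun3X K (inord 1) in
  let z := ratfun3X K (inord 2) in
  K_automorphism C rho ->
  rho x = - x ->
  rho y = - y ->
  rho z = C c * (x ^+ 2 - C a) * (y ^+ 2 - C b) / z ->
  K_automorphism C rho' ->
  rho' x = x ->
  rho' y = - y ->
  rho' z = - (C c * (x ^+ 2 - C a * y ^+ 2) * (y ^+ 2 - C b) / z) ->
  (rational C (fixed_by_group rho) <->
     (\dim <<1 & [:: sqrta; sqrtb; sqrtc]>>%VS <= 4)%N)
  /\
  (rational C (fixed_by_group rho') <->
     (\dim <<1 & [:: sqrta; sqrtb; sqrtc]>>%VS <= 4)%N).
Proof.
move=> C x y z autr rx ry rz autr' rx' ry' rz'.
have twoK : (2%:R : K) != 0 by apply: contra charK => two; rewrite inE /= two.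
rewrite !(dim_triquadratic twoK sqrtaE sqrtbE sqrtcE).
have ixyz := ratfun3_indep K; have gxyz := @ratfun3_gen K.
split; first exact: (rational_fixed_iff charK a0 b0 c0 autr ixyz gxyz rx ry rz).
have [x0 y0 z0] := xyz_neq0 ixyz.
(* In the coordinates [x / y, y, z / y], [rho'] takes the form of [rho]. *)
pose x' := x / y; pose z' := z / y.
have sG := gen_subfield C [:: x'; y; z'].
have gx' : gen C [:: x'; y; z'] x' by apply: gen_mem; rewrite !inE eqxx.
have gy' : gen C [:: x'; y; z'] y by apply: gen_mem; rewrite !inE eqxx orbT.
have gz' : gen C [:: x'; y; z'] z' by apply: gen_mem; rewrite !inE eqxx !orbT.
have gv v : v \in [:: x; y; z] -> gen C [:: x'; y; z'] v.
  rewrite !inE => /or3P[] /eqP -> //.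
    by rewrite -/x -(divfK y0 x); exact: (subM sG).
  by rewrite -/z -(divfK y0 z); exact: (subM sG).
apply: (@rational_fixed_iff K a b c charK a0 b0 c0 rho' x' y z' autr').
- by apply: (indep_spanning ixyz) => // v /gv; exact: acl_gen.
- by move=> u; apply: gen_sub (gxyz u); exact: gv.
- by rewrite /x' fmorph_div rx' ry' invrN mulrN.
- exact: ry'.
- by rewrite /z' /x' fmorph_div rz' ry'; exact: twist_identity.
Qed.
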